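(* Let $K$ be an algebraically closed field of characteristic zero, let $A=K+K[x]x^2$, let $a$ be a regular element of $A$ such that $a\notin K$, and let $X,Y\in\mathrm{Max}(a)$ be two decompositions of maximal length of $a$ into irreducible elements of $A$. Then the decomposition $Y$ can be obtained from the decomposition $X$ by finitely many transformations of the four types (Adm), ($\mathcal{C}a$), ($\mathcal{C}b$), ($\mathcal{C}c$) defined in the context.
   Context: Composition: $(a\circ b)(x):=a(b(x))$. $K[x]^*$ denotes the group of units of the monoid $(K[x],\circ)$, i.e. the polynomials of degree 1; inverses $u^{-1}$ are with respect to $\circ$; $K^*=K\setminus\{0\}$. $A=K+K[x]x^2=\{a\in K[x]\mid a'(0)=0\}$ is the subalgebra of $K[x]$ generated by $x^2,x^3$. A polynomial of $K[x]$ is irreducible if it has degree $>1$ and is not a composition of two polynomials of degree $>1$. An element of $A\setminus K$ is irreducible in $A$ if it is not a composition $b\circ c$ with $b,c\in A\setminus K$. For $a\in K[x]$ with $\deg a>1$, the length $l(a)$ is the number of factors in any decomposition of $a$ into irreducible polynomials of $K[x]$ (it is independent of the decomposition). For $a\in A\setminus K$, $l_A(a)$ is the maximal $r$ such that $a=p_1\circ\cdots\circ p_r$ with all $p_i$ irreducible in $A$; $\mathrm{Max}(a)$ is the set of decompositions $p_1\circ\cdots\circ p_r$ of $a$ into irreducible elements of $A$ with $r=l_A(a)$. The element $a$ is regular if $l_A(a)=l(a)$. $T_n$ is the trigonometric (Chebyshev) polynomial, $T_n(\cos t)=\cos(nt)$. For a non-scalar $f\in K[x]$, a degree 1 polynomial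 $\lambda+\mu x$ is called $f$-admissible if $\lambda$ is a root of the derivative $f'$. Transformations. Let $a\in A\setminus K$ with $r:=l_A(a)=l(a)$ and $Z=p_1\circ\cdots\circ p_i\circ p_{i+1}\circ\cdots\circ p_r\in\mathrm{Max}(a)$. Each transformation produces a new decomposition $Z^*\in\mathrm{Max}(a)$, where $Z^*=p_1\circ\cdots\circ p_{i-1}\circ p_i^*\circ p_{i+1}^*\circ p_{i+2}^*\circ p_{i+3}\circ\cdots\circ p_r$ if $i+1<r$, and $Z^*=p_1\circ\cdots\circ p_{r-2}\circ p_{r-1}^*\circ p_r^*$ if $i+1=r$. (Adm) In both cases $p_i^*:=p_i\circ u$ and $p_{i+1}^*:=u^{-1}\circ p_{i+1}$, where $u\in K[x]^*$ is $p_i$-admissible, and $p_{i+2}^*:=p_{i+2}$ if $i+1<r$. In the remaining three cases $\gcd(\deg(p_i),\deg(p_{i+1}))=1$, all $\lambda_j\in K[x]^*$, $p$ is a prime number, $g\in K[x]$, and the polynomials $x^sg^p(x)$ and $x^sg(x^p)$ satisfy $g(0)\ne0$. ($\mathcal{C}a$) If $i+1<r$, $p_i=\lambda_1\circ T_k\circ\lambda_2$ and $p_{i+1}=\lambda_2^{-1}\circ T_l\circ\lambda_3$, where $k,l$ are distinct odd primes, $\lambda_2$ is $T_k$-admissible and $\lambda_3$ is $T_l$-admissible, then $p_i^*:=\lambda_1\circ T_l\circ\lambda_4$, $p_{i+1}^*:=\lambda_4^{-1}\circ T_k\circ\lambda_3\circ\lambda_5$, $p_{i+2}^*:=\lambda_5^{-1}\circ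 p_{i+2}$, where $\lambda_4$ is $T_l$-admissible and $\lambda_5$ is $T_k\circ\lambda_3$-admissible. ($\mathcal{C}b$) If $i+1<r$, $p_i=\lambda_1\circ x^p$ and $p_{i+1}=[x^sg(x^p)]\circ\lambda_2$, where $\lambda_2$ is $x^sg(x^p)$-admissible, then $p_i^*:=\lambda_1\circ[x^sg^p]\circ\lambda_3$, $p_{i+1}^*:=\lambda_3^{-1}\circ x^p\circ\lambda_2\circ\lambda_4$, $p_{i+2}^*:=\lambda_4^{-1}\circ p_{i+2}$, where $\lambda_3$ is $x^sg^p$-admissible and $\lambda_2\circ\lambda_4$ is $x^p$-admissible. If $i+1=r$, $p_{r-1}=\lambda_1\circ x^p$ and $p_r=[x^sg(x^p)]\circ\lambda_2$, where $s\ge2$ and $\lambda_2\in K^*x$, then $p_{r-1}^*:=\lambda_1\circ[x^sg^p]$ and $p_r^*:=x^p\circ\lambda_2$. ($\mathcal{C}c$) If $i+1<r$, $p_i=\lambda_1\circ[x^sg^p]\circ\lambda_2$ and $p_{i+1}=\lambda_2^{-1}\circ x^p\circ\lambda_3$, where $\lambda_2$ is $x^sg^p$-admissible and $\lambda_3$ is $x^p$-admissible, then $p_i^*:=\lambda_1\circ x^p$, $p_{i+1}^*:=[x^sg(x^p)]\circ\lambda_3\circ\lambda_4$, $p_{i+2}^*:=\lambda_4^{-1}\circ p_{i+2}$, where $\lambda_3\circ\lambda_4$ is $x^sg(x^p)$-admissible. If $i+1=r$, $p_{r-1}=\lambda_1\circ x^sg^p$ with $s\ge2$, and $p_r=x^p\circ\lambda_2$,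 where $\lambda_2$ is $x^p$-admissible, then $p_{r-1}^*:=\lambda_1\circ x^p$ and $p_r^*:=[x^sg(x^p)]\circ\lambda_2$. *)

(* Defs.v *)
From HB Require Import structures.
From mathcomp Require Import all_boot all_order all_algebra.
From mathcomp Require Import ring.
From Stdlib Require Import Relation_Operators.

Set Implicit Arguments.
Unset Strict Implicit.
Unset Printing Implicit Defensive.

Import GRing.Theory.
Local Open Scope ring_scope.

Section Decompositions.
Variable K : fieldType.
Implicit Types (a b c f g p q u : {poly K}) (s t Z : seq {poly K}).

(* [size 0 = 0], so [deg 0 = 0]. *)
Definition deg p : nat := (size p).-1.

Definition is_scalar p : Prop := exists c : K, p = c%:P.

Definition compunit u : Prop := deg u = 1%N.

Definition compinv u : {poly K} := (u`_1)^-1 *: ('X - (u`_0)%:P).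

Lemma compinvK u : compunit u ->
  u \Po compinv u = 'X /\ compinv u \Po u = 'X.
Proof.
rewrite /compunit /deg => du.
have su : size u = 2%N by move: du; case: (size u) => [|[|[|]]].
have u1 : u`_1 != 0.
  by rewrite -[1%N]/(2.-1) -su -lead_coefE lead_coef_eq0 -size_poly_eq0 su.
have uE : u = u`_1 *: 'X + (u`_0)%:P.
  apply/polyP=> -[|[|i]]; rewrite !coefE ?mulr0 ?mulr1 ?add0r ?addr0 //=.
  by rewrite nth_default // su.
split.
  rewrite {2}uE comp_polyD comp_polyZ comp_polyX comp_polyC /compinv scalerA.
  by rewrite mulfV // scale1r subrK.
rewrite /compinv comp_polyZ comp_polyB comp_polyX comp_polyC {2}uE addrK.
by rewrite scalerA mulVf // scale1r.
Qed.

(* [composite [:: p1; ..; pr]] is p1 o ... o pr, i.e. p1 (p2 (... (pr (x)))). *)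
Definition composite s : {poly K} := foldr (fun p q => p \Po q) 'X s.

Definition irred p : Prop :=
  (1 < deg p)%N /\
  ~ (exists b c, [/\ (1 < deg b)%N, (1 < deg c)%N & p = b \Po c]).

Definition inA a : Prop := a^`().[0] = 0.

Definition inA_nonscalar a : Prop := inA a /\ ~ is_scalar a.

Definition irredA p : Prop :=
  inA_nonscalar p /\
  ~ (exists b c, [/\ inA_nonscalar b, inA_nonscalar c & p = b \Po c]).

Definition decomposition a s : Prop :=
  composite s = a /\ forall p, p \in s -> irred p.

Definition decompA a s : Prop :=
  composite s = a /\ forall p, p \in s -> irredA p.

(* By Ritt's first theorem, in characteristic zero at most one [n] satisfies
   this, so this is the graph of the length function l. *)
Definition is_length a (n : nat) : Prop :=
  exists s, decomposition a s /\ size s = n.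

Definition is_lengthA a (r : nat) : Prop :=
  (exists s, decompA a s /\ size s = r) /\
  forall s, decompA a s -> (size s <= r)%N.

Definition inMax a s : Prop := decompA a s /\ is_lengthA a (size s).

Definition regular a : Prop := exists r, is_lengthA a r /\ is_length a r.

Fixpoint cheb (n : nat) : {poly K} :=
  if n is m.+1 then
    if m is k.+1 then ('X * cheb m) *+ 2 - cheb k else 'X
  else 1.

(* The identity T_n (cos t) = cos (n t), with z = exp (i t). *)
Lemma chebE (n : nat) (z : K) : 2%:R != 0 :> K -> z != 0 ->
  (cheb n).[(z + z^-1) / 2%:R] = (z ^+ n + z ^- n) / 2%:R.
Proof.
move=> h2 z0; elim/ltn_ind: n => -[|[|n]] IH.
- by rewrite /= hornerC expr0 invr1 -[1 + 1]/(2%:R) mulfV.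
- by rewrite /= hornerX expr1.
rewrite -[cheb n.+2]/(('X * cheb n.+1) *+ 2 - cheb n).
rewrite hornerD hornerN hornerMn hornerM hornerX !IH // !exprS -mulr_natl.
have zn : z ^+ n != 0 by rewrite expf_neq0.
by move: (z ^+ n) zn => w w0; field; rewrite ?h2 ?z0 ?w0.
Qed.

(* [u`_0] is the constant term lambda of u = lambda + mu x. *)
Definition admissible f u : Prop := compunit u /\ root f^`() u`_0.

(* x^s g^m (x) and x^s g(x^m) *)
Definition xg_pow (s : nat) g (m : nat) : {poly K} := 'X^s * g ^+ m.
Definition xg_subst (s : nat) g (m : nat) : {poly K} := 'X^s * (g \Po 'X^m).

(* In the four relations below a decomposition is displayed with its factors
   before p_i gathered in [s] and those after the last modified one in [t]. *)

Inductive tr_adm : seq {poly K} -> seq {poly K} -> Prop :=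
| TrAdm s t p q u :
    admissible p u ->
    tr_adm (s ++ [:: p, q & t])
           (s ++ [:: p \Po u, compinv u \Po q & t]).

Inductive tr_Ca : seq {poly K} -> seq {poly K} -> Prop :=
| TrCa s t p q h (k l : nat) (l1 l2 l3 l4 l5 : {poly K}) :
    coprime (deg p) (deg q) ->
    prime k -> odd k -> prime l -> odd l -> k <> l ->
    compunit l1 ->
    admissible (cheb k) l2 ->
    admissible (cheb l) l3 ->
    admissible (cheb l) l4 ->
    admissible (cheb k \Po l3) l5 ->
    p = l1 \Po (cheb k \Po l2) ->
    q = compinv l2 \Po (cheb l \Po l3) ->
    tr_Ca (s ++ [:: p, q, h & t])
          (s ++ [:: l1 \Po (cheb l \Po l4),
                    compinv l4 \Po (cheb k \Po (l3 \Po l5)),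
                    compinv l5 \Po h & t]).

Inductive tr_Cb : seq {poly K} -> seq {poly K} -> Prop :=
| TrCb_inner s t p q h (m e : nat) g (l1 l2 l3 l4 : {poly K}) :
    coprime (deg p) (deg q) ->
    prime m -> g.[0] <> 0 ->
    compunit l1 -> compunit l4 ->
    admissible (xg_subst e g m) l2 ->
    admissible (xg_pow e g m) l3 ->
    admissible 'X^m (l2 \Po l4) ->
    p = l1 \Po 'X^m ->
    q = xg_subst e g m \Po l2 ->
    tr_Cb (s ++ [:: p, q, h & t])
          (s ++ [:: l1 \Po (xg_pow e g m \Po l3),
                    compinv l3 \Po ('X^m \Po (l2 \Po l4)),
                    compinv l4 \Po h & t])
| TrCb_last s p q (m e : nat) g (l1 l2 : {poly K}) :
    coprime (deg p) (deg q) ->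
    prime m -> g.[0] <> 0 -> (2 <= e)%N ->
    compunit l1 ->
    (exists2 mu : K, mu <> 0 & l2 = mu *: 'X) ->
    p = l1 \Po 'X^m ->
    q = xg_subst e g m \Po l2 ->
    tr_Cb (s ++ [:: p; q])
          (s ++ [:: l1 \Po xg_pow e g m; 'X^m \Po l2]).

Inductive tr_Cc : seq {poly K} -> seq {poly K} -> Prop :=
| TrCc_inner s t p q h (m e : nat) g (l1 l2 l3 l4 : {poly K}) :
    coprime (deg p) (deg q) ->
    prime m -> g.[0] <> 0 ->
    compunit l1 -> compunit l4 ->
    admissible (xg_pow e g m) l2 ->
    admissible 'X^m l3 ->
    admissible (xg_subst e g m) (l3 \Po l4) ->
    p = l1 \Po (xg_pow e g m \Po l2) ->
    q = compinv l2 \Po ('X^m \Po l3) ->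
    tr_Cc (s ++ [:: p, q, h & t])
          (s ++ [:: l1 \Po 'X^m,
                    xg_subst e g m \Po (l3 \Po l4),
                    compinv l4 \Po h & t])
| TrCc_last s p q (m e : nat) g (l1 l2 : {poly K}) :
    coprime (deg p) (deg q) ->
    prime m -> g.[0] <> 0 -> (2 <= e)%N ->
    compunit l1 ->
    admissible 'X^m l2 ->
    p = l1 \Po xg_pow e g m ->
    q = 'X^m \Po l2 ->
    tr_Cc (s ++ [:: p; q])
          (s ++ [:: l1 \Po 'X^m; xg_subst e g m \Po l2]).

Definition transformation a Z Z' : Prop :=
  inMax a Z /\ [\/ tr_adm Z Z', tr_Ca Z Z', tr_Cb Z Z' | tr_Cc Z Z'].

Definition obtainable a : seq {poly K} -> seq {poly K} -> Prop :=
  clos_refl_trans _ (transformation a).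

End Decompositions.

(* Main.v *)
Require Import Defs.
From HB Require Import structures.
From mathcomp Require Import all_boot all_order all_algebra.
From mathcomp Require Import ring zify.
From Stdlib Require Import Classical Relation_Operators.

(** The element a is regular, so the decompositions of a over A of maximal
length are as long as its complete decompositions in K[x].  By Ritt's first
theorem (ritt1) all their factors are then irreducible in K[x]: a reducible
factor could be split, giving a longer complete decomposition.  Hence X and Y
are complete decompositions of a in K[x] whose factors all have a derivative
vanishing at 0, and they have to be connected by moves that stay among such
decompositions.

This is done by induction on the degree (inner_reach, connected).  Let p and q be
the last factors of X and Y.  If q = u o p with u of degree 1, then p and q are
cancelled.  Otherwise the lemma diamond gives c o p = d o q with c and d
irreducible and deg p, deg q coprime, and a = b o c o p = b o d o q.
Choose a complete decomposition B of b.  By induction X is connected to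
(B, c, p) and (B, d, q) to Y, and (B, c, p), (B, d, q) differ by one exchange of
two adjacent factors.  Up to units on the left, the only last factors on
this path are p and q, whose derivatives vanish at 0; every other factor is put
into A by a unit u inserted on its right such that u(0) is a critical point, and
this is what the transformation (Adm) does.  The exchange itself is one
of the three other transformations by Ritt's second theorem (ritt2).

Both theorems of Ritt are proved here by elementary means.  For F = f o p = g o q
of degree N, the polynomial F(X) - F(x) in two variables has
X^N - x^N as form of highest total degree.  This form is squarefree in
characteristic zero, so a factor of F(X) - F(x) is determined by its form of
highest degree (divisor_uniq).  Applied to the greatest common divisor of
p(X) - p(x) and q(X) - q(x), this gives a common right component of p and q of
degree at least gcd(deg p, deg q) (common_right_component).  If the
degrees are coprime and M(p, q) = 0 is the relation of least degree, it gives
M(p(x), q(X)) = - M(p(X), q(x)), and X = 0 yields a common left multiple of p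
and q of degree deg p * deg q (common_left_multiple).

For the second theorem, let a o b = c o d with a, c irreducible and coprime degrees
deg a = deg d, deg b = deg c.  The fibres of a, c are compared by the
Riemann-Hurwitz count: d is too ramified unless, at each
ramification point of a of index e, all points but one of the corresponding
fibre of c have an index divisible by e (ramification).  If neither a
nor c is a power up to units, this forces two critical values, with
fibres of type (1, 2, .., 2) for a and for c (dihedral_fibres).  Such
polynomials satisfy a Pell equation and are Chebyshev polynomials
up to units (cheb_char).  If, say, a is a power x^m up to units, then so is d,
and c has the form x^s g^m (cyclic_square). *)

Set Implicit Arguments.
Unset Strict Implicit.
Unset Printing Implicit Defensive.

Import GRing.Theory.
Local Open Scope ring_scope.

(** * Composition of polynomials, units and right factors *)

Section Basics.
Variable K : fieldType.
Implicit Types (a b c f g p q u v : {poly K}).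

Lemma deg_comp p q : deg (p \Po q) = (deg p * deg q)%N.
Proof. exact: size_comp_poly. Qed.

Lemma deg_gt0 p : (0 < deg p)%N = (1 < size p)%N.
Proof. by rewrite /deg; case: (size p) => [|[]]. Qed.

Lemma sizeE_deg p : (0 < deg p)%N -> size p = (deg p).+1.
Proof. by rewrite /deg; case: (size p). Qed.

Lemma deg_neq0 p : (0 < deg p)%N -> p != 0.
Proof. by apply: contraTneq => ->; rewrite /deg size_poly0. Qed.

Lemma sizeE p : p != 0 -> size p = (deg p).+1.
Proof. by rewrite /deg => p0; rewrite prednK // size_poly_gt0. Qed.

Lemma degM p q : p != 0 -> q != 0 -> deg (p * q) = (deg p + deg q)%N.
Proof. by move=> p0 q0; rewrite /deg size_mul // !sizeE // addSn addnS. Qed.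

Lemma degX p n : deg (p ^+ n) = (deg p * n)%N.
Proof. exact: size_exp. Qed.

Lemma comp_poly_exp p q n : (p ^+ n) \Po q = (p \Po q) ^+ n.
Proof. exact: (rmorphXn (comp_poly q)). Qed.

Lemma deg0_const p : deg p = 0%N -> p = (p`_0)%:P.
Proof. by move=> d0; apply: size1_polyC; move: d0; rewrite /deg; case: (size p) => [|[]]. Qed.

Lemma degN0_scalar p : ~ is_scalar p -> (0 < deg p)%N.
Proof.
move=> np; rewrite lt0n; apply/eqP => /deg0_const e; apply: np.
by exists p`_0.
Qed.

Lemma comp_can_r q p p' : (0 < deg q)%N -> p \Po q = p' \Po q -> p = p'.
Proof.
rewrite deg_gt0 => sq /eqP; rewrite -subr_eq0 -comp_polyB comp_poly_eq0 //.
by rewrite subr_eq0 => /eqP.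
Qed.

Lemma unit_gt0 u : compunit u -> (0 < deg u)%N.
Proof. by rewrite /compunit => ->. Qed.

Lemma compunitE u : compunit u -> u = u`_1 *: 'X + (u`_0)%:P /\ u`_1 != 0.
Proof.
move=> cu; have su := sizeE_deg (unit_gt0 cu); rewrite cu in su.
have u1 : u`_1 != 0.
  by rewrite -[1%N]/(2.-1) -su -lead_coefE lead_coef_eq0 -size_poly_eq0 su.
split=> //; apply/polyP=> -[|[|i]]; rewrite !coefE ?mulr0 ?mulr1 ?add0r ?addr0 //=.
by rewrite nth_default // su.
Qed.

Lemma unit_lin (k c : K) : k != 0 -> compunit (k *: 'X + c%:P).
Proof.
move=> k0; rewrite /compunit /deg size_polyDl ?size_scale ?size_polyX //.
by apply: leq_ltn_trans (size_polyC_leq1 c) _.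
Qed.

Lemma unit_XsubC (c : K) : compunit ('X - c%:P).
Proof. by rewrite /compunit /deg size_XsubC. Qed.

Lemma unit_XaddC (c : K) : compunit ('X + c%:P).
Proof. by rewrite /compunit /deg size_XaddC. Qed.

Lemma unit_X : compunit ('X : {poly K}).
Proof. by rewrite /compunit /deg size_polyX. Qed.

Lemma unit_comp u v : compunit u -> compunit v -> compunit (u \Po v).
Proof. by rewrite /compunit deg_comp => -> ->. Qed.

Lemma unit_inv u : compunit u -> compunit (compinv u).
Proof.
move=> cu; have [_ u1] := compunitE cu.
by rewrite /compunit /deg /compinv size_scale ?invr_eq0 // size_XsubC.
Qed.

Lemma compVK u p : compunit u -> compinv u \Po (u \Po p) = p.
Proof. by move=> /compinvK [_ e]; rewrite comp_polyA e comp_polyX. Qed.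

Lemma compKV u p : compunit u -> u \Po (compinv u \Po p) = p.
Proof. by move=> /compinvK [e _]; rewrite comp_polyA e comp_polyX. Qed.

Lemma compVKr u p : compunit u -> (p \Po compinv u) \Po u = p.
Proof. by move=> /compinvK [_ e]; rewrite -comp_polyA e comp_polyXr. Qed.

Lemma compKVr u p : compunit u -> (p \Po u) \Po compinv u = p.
Proof. by move=> /compinvK [e _]; rewrite -comp_polyA e comp_polyXr. Qed.

Lemma compinv_inv u : compunit u -> compinv (compinv u) = u.
Proof.
move=> cu; have ci := unit_inv cu.
apply: (@comp_can_r (compinv u)); first exact: unit_gt0.
by rewrite (compinvK ci).2 (compinvK cu).1.
Qed.

Lemma compinvX : compinv ('X : {poly K}) = 'X.
Proof. by rewrite /compinv !coefE /= invr1 subr0 scale1r. Qed.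

Lemma deg_unit_l u p : compunit u -> deg (u \Po p) = deg p.
Proof. by rewrite deg_comp => ->; rewrite mul1n. Qed.

Lemma deg_unit_r u p : compunit u -> deg (p \Po u) = deg p.
Proof. by rewrite deg_comp => ->; rewrite muln1. Qed.

Lemma inv_horner u (x : K) : compunit u -> (compinv u).[u.[x]] = x.
Proof. by move=> /compinvK [_ e]; rewrite -horner_comp e hornerX. Qed.

End Basics.

Section Closed.
Variable K : closedFieldType.
Implicit Types (a b c f g h p q u v : {poly K}).

Lemma poly_eq_nonroot (E p q : {poly K}) : E != 0 ->
  (forall x, ~~ root E x -> p.[x] = q.[x]) -> p = q.
Proof.
move=> E0 H; apply/eqP; rewrite -subr_eq0; apply/negPn/negP => d0.
have /closed_nonrootP [x] : E * (p - q) != 0 by rewrite mulf_neq0.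
by rewrite rootM negb_or => /andP [/H e]; rewrite rootE hornerD hornerN e subrr eqxx.
Qed.

Lemma poly_eq_horner p q : (forall x, p.[x] = q.[x]) -> p = q.
Proof. by move=> H; apply: (@poly_eq_nonroot 1) => //; exact: oner_neq0. Qed.

(** For a single good x, write p - p(x) = s (h - h(x)). Modulo h - h(y) both p
and h become constant, hence so does s, at least when h(y) <> h(x). So s
satisfies the same hypothesis with a larger set E of excluded points, and one
concludes by induction on the degree. *)
Lemma right_factor_generic h E p : (1 < size h)%N -> E != 0 ->
  (forall x, ~~ root E x -> h - (h.[x])%:P %| p - (p.[x])%:P) ->
  exists p1, p = p1 \Po h.
Proof.
move=> sh; have [n] := ubnP (size p).
elim: n => // n IH in p E *; rewrite ltnS => sp E0 H.
have [sp1|sp1] := leqP (size p) 1.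
  by exists (p`_0)%:P; rewrite comp_polyC; apply: size1_polyC.
have /closed_nonrootP [x xE] := E0.
have /dvdpP [s Es] := H _ xE.
have hx : h - (h.[x])%:P != 0.
  rewrite subr_eq0; apply/eqP => e; move: sh.
  by rewrite e ltnNge size_polyC_leq1.
have spC (r : {poly K}) (c : K) : (1 < size r)%N -> size (r - c%:P) = size r.
  move=> sr; rewrite size_polyDl // size_polyN.
  exact: leq_ltn_trans (size_polyC_leq1 _) _.
have s0 : s != 0.
  apply/eqP => s0; move: Es; rewrite s0 mul0r => /eqP; rewrite subr_eq0 => /eqP e.
  by move: sp1; rewrite e ltnNge size_polyC_leq1.
have [s1 Es1] : exists s1, s = s1 \Po h.
  (* the new factor excludes h y = h x, so that one can divide by h y - h x *)
  apply: (IH s (E * (h - (h.[x])%:P))); last first.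
  - move=> y; rewrite rootM negb_or => /andP [yE yh].
    have k0 : h.[y] - h.[x] != 0.
      by move: yh; rewrite rootE !hornerE.
    have : h - (h.[y])%:P %| (h.[y] - h.[x]) *: (s - (s.[y])%:P).
      have -> : (h.[y] - h.[x]) *: (s - (s.[y])%:P)
         = (p - (p.[y])%:P) - s * (h - (h.[y])%:P).
        have -> : p = s * (h - (h.[x])%:P) + (p.[x])%:P by rewrite -Es subrK.
        rewrite !hornerE -!mul_polyC !polyCD !polyCN !polyCM !polyCD !polyCN; ring.
      by rewrite dvdp_sub ?H // dvdp_mull.
    by rewrite dvdpZr.
  - by rewrite mulf_neq0.
  - apply: leq_trans sp; rewrite -(spC p (p.[x])) // Es size_mul // spC //.
    by move: sh; case: (size h) => [|[|k]] //= _; rewrite addnS addnS /= ltnS leq_addr.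
exists (s1 * ('X - (h.[x])%:P) + (p.[x])%:P).
by rewrite comp_polyD comp_polyM comp_polyB comp_polyX !comp_polyC -Es1 -Es subrK.
Qed.

End Closed.

(** * The norm form of a polynomial over a fibre *)

(** The companion matrix, with a size that is visibly a successor, as
horner_mx requires. *)
Lemma exists_companion (R : comNzRingType) n (D : {poly R}) :
  D \is monic -> size D = n.+2 -> exists A : 'M[R]_n.+1, char_poly A = D.
Proof.
move=> mD sD; have := companionmxK mD.
by move: (companionmx D); rewrite sD /= => A e; exists A.
Qed.

Section Norm.
Variable K : closedFieldType.
Implicit Types (a b c f g h p q u v : {poly K}).

Lemma char_poly_horner (n : nat) (A : 'M[K]_n.+1) x :
  (char_poly A).[x] = \det (x%:M - A).
Proof.
rewrite /char_poly -[_.[x]]/(horner_eval x _) -det_map_mx; congr (\det _).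
apply/matrixP => i j; rewrite !mxE /=.
by rewrite /horner_eval hornerD hornerN hornerC hornerMn hornerX.
Qed.

Lemma prod_const_seq (I : Type) (rs : seq I) (k : K) :
  \prod_(x <- rs) k = k ^+ size rs.
Proof. by rewrite big_const_seq count_predT iter_mulr mulr1. Qed.

(** The determinant is multiplicative in q and K is closed, so this reduces to
linear q, where it is the evaluation of the characteristic polynomial. *)
Lemma det_horner_mx n (A : 'M[K]_n.+1) rs q :
  char_poly A = \prod_(x <- rs) ('X - x%:P) ->
  \det (horner_mx A q) = \prod_(x <- rs) q.[x].
Proof.
move=> eA; have srs : size rs = n.+1.
  by have := size_char_poly A; rewrite eA size_prod_XsubC => -[].
have [->|q0] := eqVneq q 0.
  rewrite rmorph0 det0; case: rs srs {eA} => //= x rs _.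
  by rewrite big_cons horner0 mul0r.
have [gs ->] := closed_field_poly_normal q.
rewrite linearZ /= detZ.
under [RHS]eq_bigr do rewrite hornerZ.
rewrite big_split /= prod_const_seq srs; congr (_ * _).
elim: gs => [|y gs IH].
  by rewrite !big_nil rmorph1 det1 big1 // => x _; rewrite hornerE.
rewrite big_cons rmorphM /= -[_ * horner_mx A _]/(_ *m _) det_mulmx IH.
under [RHS]eq_bigr do rewrite hornerM.
rewrite big_split /=; congr (_ * _).
rewrite rmorphB /= horner_mx_X horner_mx_C -opprB -scaleN1r detZ -char_poly_horner eA.
rewrite horner_prod -srs -prod_const_seq -big_split /=.
by apply: eq_bigr => x _; rewrite !hornerE mulN1r opprB.
Qed.

Lemma char_poly_horner_mx n (A : 'M[K]_n.+1) rs q :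
  char_poly A = \prod_(x <- rs) ('X - x%:P) ->
  char_poly (horner_mx A q) = \prod_(x <- rs) ('X - (q.[x])%:P).
Proof.
move=> eA; apply: poly_eq_horner => y.
rewrite char_poly_horner.
have -> : y%:M - horner_mx A q = horner_mx A (y%:P - q).
  by rewrite rmorphB /= horner_mx_C.
rewrite (det_horner_mx _ eA) horner_prod.
by apply: eq_bigr => x _; rewrite !hornerE.
Qed.

(** M is the norm of Z - q for the extension K(x) / K(p), in which p is
replaced by a variable y. Taking for M a characteristic polynomial makes it
polynomial in y, and valid with multiplicities at the branch points of p. *)
Lemma norm_form p q : (0 < deg p)%N ->
  exists M : {poly {poly K}}, [/\ M \is monic, size M = (deg p).+1 &
    forall y rs, p - y%:P = lead_coef p *: \prod_(x <- rs) ('X - x%:P) ->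
      map_poly (horner_eval y) M = \prod_(x <- rs) ('X - (q.[x])%:P)].
Proof.
move=> dp; have p0 := deg_neq0 dp.
have lp : lead_coef p != 0 by rewrite lead_coef_eq0.
pose k := (lead_coef p)^-1; have k0 : k != 0 by rewrite invr_eq0.
pose D : {poly {poly K}} := map_poly polyC (k *: p) - (k *: 'X)%:P.
have s1 : size (map_poly polyC (k *: p)) = size p.
  by rewrite size_map_polyC size_scale.
have sC : (size ((k *: 'X : {poly K})%:P : {poly {poly K}}) < size (map_poly polyC (k *: p)))%N.
  by rewrite s1 (leq_ltn_trans (size_polyC_leq1 _)) // -deg_gt0.
have sD : size D = size p by rewrite /D size_polyDl ?size_polyN.
have mD : D \is monic.
  rewrite monicE /D lead_coefDl ?size_polyN //.
  rewrite lead_coef_map_inj //; last exact: polyC_inj.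
  by rewrite lead_coefZ mulVf.
have [n En] : exists n, deg p = n.+1 by case: (deg p) dp => // n _; exists n.
have [A eA] := exists_companion mD (etrans sD (etrans (sizeE_deg dp) (congr1 succn En))).
exists (char_poly (horner_mx A (map_poly polyC q))); split.
- exact: char_poly_monic.
- by rewrite size_char_poly En.
move=> y rs Ep; rewrite map_char_poly map_horner_mx /=.
have -> : map_poly (horner_eval y) (map_poly polyC q) = q.
  by rewrite -map_poly_comp /= map_poly_id // => x _; rewrite /= /horner_eval hornerC.
apply: char_poly_horner_mx; rewrite -map_char_poly eA /D rmorphB /=.
rewrite map_polyC /= {2}/horner_eval hornerZ hornerX -map_poly_comp /=.
rewrite map_poly_id; last by move=> x _; rewrite /= /horner_eval hornerC.
have -> : k *: p - (k * y)%:P = k *: (p - y%:P).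
  by rewrite scalerBr -[k *: y%:P]mul_polyC polyCM.
by rewrite Ep scalerA mulVf // scale1r.
Qed.

End Norm.

(** * Forms of highest total degree *)

Section SizeLemmas.
Variable R : idomainType.
Implicit Types P Q B : {poly R}.

Lemma size_lead P N t : (size P <= N.+1)%N -> P`_N = t -> t != 0 ->
  size P = N.+1 /\ lead_coef P = t.
Proof.
move=> sP PN t0; have sE : size P = N.+1.
  apply/eqP; rewrite eqn_leq sP ltnNge; apply: contra t0 => /leq_sizeP /(_ N (leqnn _)).
  by rewrite PN => ->.
by split=> //; rewrite lead_coefE sE.
Qed.

Lemma coef_exp_top B m n : (0 < n)%N -> (size B <= m.+1)%N ->
  (size (B ^+ n)%R <= (n * m).+1)%N /\ (B ^+ n)`_(n * m) = (B`_m) ^+ n.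
Proof.
move=> n0 sB; split.
  apply: leq_trans (size_poly_exp_leq _ _) _; rewrite ltnS mulnC leq_mul //.
  by case: (size B) sB.
have [e|ne] := eqVneq (size B) m.+1.
  have -> : B`_m = lead_coef B by rewrite lead_coefE e.
  by rewrite -lead_coef_exp lead_coefE size_exp e mulnC.
have sB' : (size B <= m)%N by move: sB; rewrite leq_eqVlt (negPf ne).
rewrite (leq_sizeP _ _ sB') // expr0n -[n == 0%N]negbK -lt0n n0 /=.
have [->|B0] := eqVneq B 0; first by rewrite expr0n -[n == 0%N]negbK -lt0n n0 coef0.
have sBp : (0 < size B)%N by rewrite size_poly_gt0.
apply/(leq_sizeP _ (n * m)) => //; apply: leq_trans (size_poly_exp_leq _ _) _.
move: sBp sB'; case: (size B) => //= k _ km; rewrite mulnC.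
by rewrite ltn_mul2l n0.
Qed.

Lemma size_sub_lead P Q : P != 0 -> size P = size Q -> lead_coef P = lead_coef Q ->
  (size (P - Q)%R < size P)%N.
Proof.
move=> P0 sPQ lPQ; rewrite -[X in (_ < X)%N]prednK ?size_poly_gt0 // ltnS.
apply/leq_sizeP => j; rewrite leq_eqVlt => /predU1P [<-|lt].
  rewrite coefB; move: lPQ; rewrite !lead_coefE -sPQ => ->; exact: subrr.
have h : (size P <= j)%N by move: lt; case: (size P).
by rewrite coefB !nth_default ?subr0 // -sPQ.
Qed.

(** Nonzero terms of distinct degrees cannot cancel each other. *)
Lemma size_sum_distinct n (t : 'I_n -> {poly R}) :
  (forall i j, t i != 0 -> t j != 0 -> size (t i) = size (t j) -> i = j) ->
  forall i, (size (t i) <= size (\sum_i t i)%R)%N.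
Proof.
move=> dist i.
pose i0 := [arg max_(j > i) size (t j)].
have i0max j : (size (t j) <= size (t i0))%N.
  by rewrite /i0; case: arg_maxnP => // k _; apply.
apply: leq_trans (i0max i) _.
have [->|n0] := eqVneq (t i0) 0; first by rewrite size_poly0.
rewrite leqNgt; apply/negP => lt.
have : (\sum_i t i)`_(size (t i0)).-1 = 0.
  by apply: nth_default; move: lt; case: (size (t i0)).
rewrite coef_sum (bigD1 i0) //= big1 ?addr0 => [|j ji0].
  by apply/eqP; rewrite -lead_coefE lead_coef_eq0.
have [->|j0] := eqVneq (t j) 0; first by rewrite coef0.
apply: nth_default; rewrite -ltnS prednK ?size_poly_gt0 //.
rewrite ltn_neqAle i0max andbT; apply: contra ji0 => /eqP e.
by apply/eqP; apply: dist.
Qed.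

Lemma monic_div P B : B \is monic ->
  exists Q r, P = Q * B + r /\ (size r < size B)%N.
Proof.
move=> mB; exists (Pdiv.Ring.rdivp P B), (Pdiv.Ring.rmodp P B); split.
  exact: Pdiv.RingMonic.rdivp_eq.
by rewrite Pdiv.Ring.ltn_rmodpN0 // monic_neq0.
Qed.

End SizeLemmas.

Section TopForm.
Variable K : closedFieldType.
Implicit Types (c f g h p q : {poly K}) (U V : {poly {poly K}}).

(** The variables are x (inner) and X (outer). The substitution X = Y x turns
U into a polynomial in x over K[Y]: its degree is the total degree of U, and
its leading coefficient is the form of highest total degree of U,
dehomogenised at x = 1. *)
Definition tform U : {poly {poly K}} := (map_poly (map_poly polyC) U).['X%:P * 'X].
Definition top U : {poly K} := lead_coef (tform U).

Lemma tformM U V : tform (U * V) = tform U * tform V.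
Proof. by rewrite /tform rmorphM hornerM. Qed.
Lemma tformB U V : tform (U - V) = tform U - tform V.
Proof. by rewrite /tform rmorphB hornerD hornerN. Qed.
Lemma tformN U : tform (- U) = - tform U.
Proof. by rewrite /tform rmorphN hornerN. Qed.

Lemma coef_tform U k j :
  ((tform U)`_k)`_j = if (j <= k)%N then (U`_j)`_(k - j) else 0.
Proof.
have sN : (size (map_poly (map_poly polyC) U) <= maxn (size U) j.+1)%N.
  by rewrite leq_max (leq_trans (size_poly _ _)).
rewrite /tform (horner_coef_wide _ sN) coef_sum coef_sum.
have jN : (j < maxn (size U) j.+1)%N by rewrite leq_max leqnn orbT.
have E i : (((map_poly (map_poly polyC) U)`_i * ('X%:P * 'X) ^+ i)`_k)`_j =
   if (i <= k)%N && (i == j) then (U`_j)`_(k - j) else 0.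
  rewrite exprMn -rmorphXn /= mulrA coefMXn; case: ltnP => ik; first by rewrite coef0.
  by rewrite coefMC coef_map /= coef_map /= coefCM coefXn eq_sym; case: eqVneq => [->|_];
    rewrite ?mulr1 ?mulr0.
rewrite (bigD1 (Ordinal jN)) //= E eqxx andbT big1 ?addr0 // => i ij.
by rewrite E; case: eqP => [e|_]; rewrite ?andbF //; move: ij; rewrite -val_eqE /= e eqxx.
Qed.

Lemma tform_eq0 U : tform U = 0 -> U = 0.
Proof.
move=> e; apply/polyP => j; apply/polyP => l; have := coef_tform U (l + j) j.
by rewrite e leq_addl addnK !coef0.
Qed.

Lemma top_eq0 U : U != 0 -> top U != 0.
Proof. by apply: contraNneq; rewrite /top => /eqP; rewrite lead_coef_eq0 => /eqP /tform_eq0 ->. Qed.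

Lemma topM U V : top (U * V) = top U * top V.
Proof. by rewrite /top tformM lead_coefM. Qed.

Lemma size_top U : (size (top U) <= size U)%N.
Proof.
apply/leq_sizeP => j sj; rewrite /top lead_coefE coef_tform.
by case: ifP => // _; rewrite (nth_default _ sj) coef0.
Qed.

(** Let R = U - V. Then V divides R * U', so top V divides top R since it is
prime to top U'. But top R has degree at most deg_X R < deg_X V, so R = 0. *)
Lemma divisor_uniq U U' V V' : U * U' = V * V' -> V != 0 ->
  size U = size V -> lead_coef U = lead_coef V ->
  top U = top V -> size (top V) = size V -> coprimep (top V) (top U') -> U = V.
Proof.
move=> e V0 sUV lUV tUV sV cop; apply/eqP; rewrite -subr_eq0; apply/negPn/negP => R0.
have U0 : U != 0 by rewrite -size_poly_eq0 sUV size_poly_eq0.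
have sR : (size (U - V)%R < size V)%N by rewrite -sUV size_sub_lead.
have : (U - V) * U' = V * (V' - U') by rewrite mulrBl e mulrBr.
move/(congr1 top); rewrite !topM => eT.
have : top V %| top (U - V).
  by rewrite -(Gauss_dvdpl _ cop) eT dvdp_mulr.
move/(dvdp_leq (top_eq0 R0)); rewrite sV leqNgt => /negP; apply.
exact: leq_ltn_trans (size_top _) sR.
Qed.

Lemma tformC c : tform c%:P = c^:P.
Proof. by rewrite /tform map_polyC hornerC. Qed.

Lemma coef_tform_lift c k : (tform c^:P)`_k = c`_k *: 'X^k.
Proof.
apply/polyP => j; rewrite coef_tform coefZ coefXn coef_map /= coefC.
case: (ltngtP j k) => [lt|gt|->]; rewrite ?mulr0 //=.
  by rewrite subn_eq0 leqNgt lt.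
by rewrite subnn mulr1.
Qed.

Lemma size_tform_lift c : (size (tform c^:P) <= size c)%N.
Proof.
by apply/leq_sizeP => j sj; rewrite coef_tform_lift nth_default // scale0r.
Qed.

Lemma top_fibre_diff f : (0 < deg f)%N ->
  top (f^:P - f%:P) = lead_coef f *: ('X^(deg f) - 1) /\
  size (tform (f^:P - f%:P)) = (deg f).+1.
Proof.
move=> df; have f0 := deg_neq0 df.
have H1 : (size (tform (f^:P - f%:P)%R) <= (deg f).+1)%N.
  apply/leq_sizeP => j sj; rewrite tformB coefB coef_tform_lift tformC coef_map /=.
  by rewrite [f`_j]nth_default ?scale0r ?subr0 // sizeE_deg.
have H2 : (tform (f^:P - f%:P))`_(deg f) = lead_coef f *: ('X^(deg f) - 1).
  rewrite tformB coefB coef_tform_lift tformC coef_map /= lead_coefE.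
  by rewrite scalerBr -alg_polyC.
have H3 : lead_coef f *: ('X^(deg f) - 1) != 0.
  by rewrite scaler_eq0 lead_coef_eq0 negb_or f0 /= -size_poly_gt0 size_XnsubC.
by have [? ?] := size_lead H1 H2 H3.
Qed.

End TopForm.

Section CharZero.
Variable K : closedFieldType.
Hypothesis char0 : [pchar K] =i pred0.
Implicit Types (c f g h p q u : {poly K}) (U V : {poly {poly K}}).

Lemma natK0 n : (0 < n)%N -> n%:R != 0 :> K.
Proof. by move=> n0; have /pcharf0P -> := char0; rewrite -lt0n. Qed.

Lemma size_deriv_char0 p : (0 < deg p)%N ->
  size p^`() = deg p /\ lead_coef p^`() = lead_coef p *+ deg p.
Proof.
move=> dp; have := @size_lead _ p^`() (deg p).-1 (lead_coef p *+ deg p).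
rewrite prednK //; apply.
- rewrite -ltnS -sizeE_deg //.
  by apply: lt_size_deriv; apply: deg_neq0.
- by rewrite coef_deriv prednK // lead_coefE.
by rewrite -mulr_natr mulf_neq0 ?natK0 // lead_coef_eq0 deg_neq0.
Qed.

Lemma deriv_neq0 p : (0 < deg p)%N -> p^`() != 0.
Proof. by move=> dp; rewrite -size_poly_gt0 (size_deriv_char0 dp).1. Qed.

(** A common root would be a double root of X^N - 1, which is separable in
characteristic zero. *)
Lemma coprime_unity u u' (k : K) N : (0 < N)%N -> k != 0 ->
  u * u' = k *: ('X^N - 1) -> coprimep u u'.
Proof.
move=> N0 k0 e; apply/Pdiv.ClosedField.coprimepP => x /eqP ux; apply/eqP => u'x.
have := congr1 (fun r => r^`().[x]) e; rewrite derivM !hornerE ux u'x mulr0 mul0r add0r.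
rewrite derivZ derivB derivXn derivC subr0 !hornerE => /esym/eqP.
rewrite hornerMn hornerXn mulf_eq0 (negPf k0) /= -mulr_natl mulf_eq0 (negPf (natK0 N0)) /=.
rewrite expf_eq0 => /andP [_ /eqP x0].
have := congr1 (fun r => r.[x]) e; rewrite !hornerE ux mul0r x0 expr0n.
by rewrite -[N == 0%N]negbK -lt0n N0 /= => /esym/eqP; rewrite sub0r mulrN1 oppr_eq0 (negPf k0).
Qed.
End CharZero.

(** * The relation between two polynomials of coprime degrees *)

Section Relation.
Variable K : closedFieldType.
Implicit Types (c f g h p q u : {poly K}) (M R G : {poly {poly K}}).

(** The value R(p, q) of R(Y, Z), where Z is the outer variable. *)
Definition bieval p q R : {poly K} := (map_poly (comp_poly p) R).[q].

Lemma bievalE p q R n : (size R <= n)%N ->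
  bieval p q R = \sum_(i < n) (R`_i \Po p) * q ^+ i.
Proof.
move=> sR; rewrite /bieval (@horner_coef_wide _ n); last exact: leq_trans (size_poly _ _) sR.
by apply: eq_bigr => i _; rewrite coef_map.
Qed.

Lemma bieval_horner p q R x :
  (bieval p q R).[x] = (map_poly (horner_eval p.[x]) R).[q.[x]].
Proof.
rewrite /bieval -[LHS]/(horner_eval x _) -horner_map -map_poly_comp.
congr (_.[_]); apply: eq_map_poly => r /=; by rewrite /horner_eval horner_comp.
Qed.

Lemma modn_coprime_inj n m i j a b : coprime n m -> (i < n)%N -> (j < n)%N ->
  (a * n + i * m = b * n + j * m)%N -> i = j.
Proof.
move=> cop; wlog le_ij : i j a b / (i <= j)%N.
  move=> H ilt jlt e; case: (leqP i j) => [le|/ltnW le]; first exact: (H _ _ _ _ le ilt jlt e).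
  by symmetry; apply: (H _ _ _ _ le jlt ilt (esym e)).
move=> ilt jlt e.
have : (n %| (j - i) * m)%N.
  have -> : ((j - i) * m = a * n - b * n)%N by rewrite mulnBl; lia.
  by rewrite -mulnBl dvdn_mull.
rewrite Gauss_dvdl // => dv; have [z|/dvdn_leq] := posnP (j - i)%N; first by lia.
by move=> /(_ _ dv); lia.
Qed.

Section Fixed.
Variables p q : {poly K}.
Hypotheses (dp : (0 < deg p)%N) (dq : (0 < deg q)%N).
Hypothesis cop : coprime (deg p) (deg q).

Let size_term (r : {poly K}) i : r != 0 ->
  size ((r \Po p) * q ^+ i) = (deg r * deg p + i * deg q).+1.
Proof.
move=> r0; have q0 := deg_neq0 dq.
have rp0 : r \Po p != 0 by rewrite comp_poly_eq0 // -deg_gt0.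
by rewrite sizeE ?mulf_neq0 ?expf_neq0 // degM ?expf_neq0 // deg_comp degX [(i * _)%N]mulnC.
Qed.

(** The degrees of the terms r_i(p) q^i with i < deg p are distinct modulo deg
p, so these terms do not cancel. *)
Lemma bieval_size R i : (size R <= deg p)%N -> R`_i != 0 ->
  (deg R`_i * deg p + i * deg q < size (bieval p q R))%N.
Proof.
move=> sR Ri0; have ilt : (i < deg p)%N.
  by apply: leq_trans sR; rewrite ltnNge; apply: contra Ri0 => h; rewrite nth_default.
rewrite -(size_term _ Ri0) (bievalE p q sR).
apply: leq_trans (@size_sum_distinct _ _ (fun i : 'I_(deg p) => (R`_i \Po p) * q ^+ i) _ (Ordinal ilt)).
  by [].
move=> j k j0 k0; rewrite !size_term => [[e]||].
- by apply/val_inj/(modn_coprime_inj cop _ _ e).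
- by apply: contraNneq k0 => ->; rewrite comp_poly0 mul0r.
- by apply: contraNneq j0 => ->; rewrite comp_poly0 mul0r.
Qed.

Lemma bieval_eq0 R : (size R <= deg p)%N -> bieval p q R = 0 -> R = 0.
Proof.
move=> sR e; apply/polyP => i; rewrite coef0; apply/eqP/negPn/negP => h.
by have := bieval_size sR h; rewrite e size_poly0.
Qed.

Variable M : {poly {poly K}}.
Hypotheses (monM : M \is monic) (sM : size M = (deg p).+1).
Hypothesis M0 : bieval p q M = 0.

Lemma relation_dvd G : bieval p q G = 0 -> exists Q, G = Q * M.
Proof.
move=> G0; have [Q [r [eG sr]]] := monic_div G monM.
exists Q; rewrite eG.
suff -> : r = 0 by rewrite addr0.
apply: bieval_eq0; first by rewrite -ltnS -sM.
move: G0; rewrite eG /bieval rmorphD rmorphM hornerD hornerM.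
by rewrite -/(bieval p q M) M0 mulr0 add0r.
Qed.

Let R := M - 'X^(deg p).
Let sR : (size R <= deg p)%N.
Proof.
rewrite -ltnS -sM; have MN0 : M != 0 by rewrite monic_neq0.
apply: size_sub_lead => //; first by rewrite size_polyXn sM.
by rewrite lead_coefXn (monicP monM).
Qed.

Let bR : bieval p q R = - q ^+ deg p.
Proof.
rewrite /bieval /R rmorphB /= map_polyXn hornerD hornerN hornerXn.
by rewrite -/(bieval p q M) M0 sub0r.
Qed.

Let sbR : size (bieval p q R) = (deg p * deg q).+1.
Proof. by rewrite bR size_polyN sizeE ?expf_neq0 ?deg_neq0 // degX mulnC. Qed.

Let coefM i : (i < deg p)%N -> M`_i = R`_i.
Proof. by move=> h; rewrite /R coefB coefXn ltn_eqF // subr0. Qed.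

(** In M(p, q) = 0 the degrees of the terms are distinct modulo deg p, except
for q^(deg p) and the constant term M_0(p). Hence these two have the largest
degree and cancel, and all others are smaller; relation_coef0 is the other
half of this. *)
Lemma relation_coef_small i : (0 < i < deg p)%N -> M`_i != 0 ->
  (deg M`_i * deg p + i * deg q < deg p * deg q)%N.
Proof.
move=> /andP [i0 ip]; rewrite coefM // => Ri0.
have := bieval_size sR Ri0; rewrite sbR ltnS leq_eqVlt => /predU1P [e|//].
have e' : (deg R`_i * deg p + i * deg q = deg q * deg p + 0 * deg q)%N by rewrite e; lia.
by have := modn_coprime_inj cop ip dp e' => i00; rewrite i00 in i0.
Qed.

Lemma relation_coef0 :
  size (M`_0 \Po p) = (deg p * deg q).+1 /\
  lead_coef (M`_0 \Po p) = - lead_coef q ^+ deg p.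
Proof.
apply: size_lead.
- rewrite coefM //; have [->|h] := eqVneq R`_0 0; first by rewrite comp_poly0 size_poly0.
  have := bieval_size sR h; rewrite sbR mul0n addn0 -deg_comp /deg.
  by case: (size _).
- have := congr1 (fun r : {poly K} => r`_(deg p * deg q)) bR.
  rewrite (bievalE p q sR) coef_sum (bigD1 (Ordinal dp)) //= expr0 mulr1 big1 => [|i i0].
    rewrite addr0 coefM // => ->; rewrite coefN; congr (- _).
    have sq : (size q <= (deg q).+1)%N by rewrite sizeE_deg.
    have [_ ->] := coef_exp_top dp sq.
    by rewrite lead_coefE.
  have [->|h] := eqVneq R`_i 0; first by rewrite comp_poly0 mul0r coef0.
  apply: nth_default; rewrite size_term //.
  have i0' : (0 < i)%N by rewrite lt0n; move: i0; rewrite -val_eqE.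
  have := @relation_coef_small i; rewrite i0' ltn_ord coefM // => /(_ isT h).
  by [].
by rewrite oppr_eq0 expf_neq0 // lead_coef_eq0 deg_neq0.
Qed.

Lemma deg_relation_coef0 : deg M`_0 = deg q.
Proof.
have [s0 _] := relation_coef0; apply/eqP; rewrite -(eqn_pmul2r dp) -deg_comp.
by rewrite {1}/deg s0 mulnC.
Qed.

(** The morphism L and the argument B stand for lifts of p and q to two
variables. Only the two dominating terms of M contribute to the highest
coefficient. This is used for M(p(x), q(X)), for M(p(X), q(x)) and for the
forms of highest degree of both. *)
Lemma relation_lift (L : {rmorphism {poly K} -> {poly {poly K}}}) (B : {poly {poly K}}) :
  (forall r, (size (L r) <= size r)%N) -> (size B <= (deg q).+1)%N ->
  let S := (map_poly (L \o comp_poly p) M).[B] in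
  (size S <= (deg p * deg q).+1)%N /\
  S`_(deg p * deg q) = B`_(deg q) ^+ deg p + (L (M`_0 \Po p))`_(deg p * deg q).
Proof.
move=> sL sB S; have [sBn cBn] := coef_exp_top dp sB.
have ES : S = B ^+ deg p + \sum_(i < deg p) (L (M`_i \Po p)) * B ^+ i.
  rewrite /S (@horner_coef_wide _ (deg p).+1); last by rewrite -sM size_poly.
  rewrite big_ord_recr /= addrC; congr (_ + _).
    rewrite coef_map /= -[M`_(deg p)]/(M`_((deg p).+1.-1)) -sM -lead_coefE (monicP monM).
    by rewrite !rmorph1 mul1r.
  by apply: eq_bigr => i _; rewrite coef_map.
have small (i : 'I_(deg p)) : i != Ordinal dp ->
  (size (L (M`_i \Po p) * B ^+ i)%R <= deg p * deg q)%N.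
  move=> i0; have i0' : (0 < i)%N by rewrite lt0n; move: i0; rewrite -val_eqE.
  have [->|h] := eqVneq M`_i 0; first by rewrite comp_poly0 rmorph0 mul0r size_poly0.
  have := @relation_coef_small i; rewrite i0' ltn_ord => /(_ isT h) lt.
  have [sBi _] := coef_exp_top i0' sB.
  apply: leq_trans (size_polyMleq _ _) _.
  have : (size (L (M`_i \Po p)) <= (deg M`_i * deg p).+1)%N.
    by apply: leq_trans (sL _) _; rewrite -deg_comp /deg; case: (size _).
  move: lt sBi; move: (size (L _)) (size (B ^+ i)) (deg p * deg q)%N (deg M`_i * deg p)%N (i * deg q)%N; lia.
have sz0 : (size (L (M`_0 \Po p)) <= (deg p * deg q).+1)%N.
  by apply: leq_trans (sL _) _; rewrite relation_coef0.1.
rewrite ES (bigD1 (Ordinal dp)) //= expr0 mulr1; split.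
  apply: leq_trans (size_polyD _ _) _; rewrite geq_max sBn /=.
  apply: leq_trans (size_polyD _ _) _; rewrite geq_max sz0 /=.
  apply: leq_trans (size_sum _ _ _) _; apply/bigmax_leqP => i /small.
  by move=> h; apply: leq_trans h _.
rewrite !coefD cBn coef_sum [X in _ + (_ + X)]big1 ?addr0 // => i /small.
by move=> h; rewrite nth_default.
Qed.

End Fixed.
End Relation.

(** * Common left multiples *)

Section Multiple.
Variable K : closedFieldType.
Implicit Types (c f g h p q u : {poly K}) (M R G : {poly {poly K}}).

(** The function tform, displayed as a composition of ring morphisms so that
its morphism structure is inferred. *)
Definition tform_rmorph : {poly {poly K}} -> {poly {poly K}} :=
  (horner_eval ('X%:P * 'X : {poly {poly K}})) \o (map_poly (map_poly polyC)).
HB.instance Definition _ := GRing.RMorphism.on tform_rmorph.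

Lemma tform_horner_lift (L : {rmorphism {poly K} -> {poly {poly K}}}) M (B : {poly {poly K}}) :
  tform (map_poly L M).[B] = (map_poly (tform_rmorph \o L) M).[tform B].
Proof.
rewrite -[LHS]/(tform_rmorph _) -[tform B]/(tform_rmorph B) -horner_map; congr (_.[_]).
by rewrite [RHS]map_poly_comp.
Qed.

Lemma norm_relation p q : (0 < deg p)%N ->
  exists M : {poly {poly K}}, [/\ M \is monic, size M = (deg p).+1,
    bieval p q M = 0 &
    forall y rs, p - y%:P = lead_coef p *: \prod_(x <- rs) ('X - x%:P) ->
      map_poly (horner_eval y) M = \prod_(x <- rs) ('X - (q.[x])%:P)].
Proof.
move=> dp; have [M [mM sM HM]] := norm_form q dp.
exists M; split=> //; apply: poly_eq_horner => x.
rewrite bieval_horner horner0.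
have [rs Ers] := closed_field_poly_normal (p - (p.[x])%:P).
have lE : lead_coef (p - (p.[x])%:P) = lead_coef p.
  by rewrite lead_coefDl // size_polyN (leq_ltn_trans (size_polyC_leq1 _)) // -deg_gt0.
rewrite lE in Ers; rewrite (HM _ _ Ers).
have : root (p - (p.[x])%:P) x by rewrite rootE !hornerE subrr.
rewrite Ers rootZ ?lead_coef_eq0 ?deg_neq0 // root_prod_XsubC => xin.
rewrite horner_prod; apply/eqP; rewrite prodf_seq_eq0; apply/hasP.
by exists x; rewrite // !hornerE subrr.
Qed.

Hypothesis char0 : [pchar K] =i pred0.

(** Both M(p(x), q(X)) and - M(p(X), q(x)) divide F(X) - F(x), where F = f o p
= g o q, and both have l (X^N - x^N) as form of highest degree, where N = deg
p * deg q. By divisor_uniq they are equal; for X = 0 this equates a polynomial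
in p with a polynomial in q. *)
Lemma common_left_multiple f g p q : f \Po p = g \Po q -> (0 < deg f)%N ->
  (0 < deg p)%N -> (0 < deg q)%N -> coprime (deg p) (deg q) ->
  exists c d, [/\ c \Po p = d \Po q, deg c = deg q & deg d = deg p].
Proof.
move=> e df dp dq cop.
have [M [mM sM M0 _]] := norm_relation q dp.
have nm0 : (0 < deg p * deg q)%N by rewrite muln_gt0 dp dq.
set N := (deg p * deg q)%N in nm0 *.
pose l := lead_coef q ^+ deg p.
have l0 : l != 0 by rewrite expf_neq0 // lead_coef_eq0 deg_neq0.
have [s0 lc0] := relation_coef0 dp dq cop mM sM M0.
have c0N : (M`_0 \Po p)`_N = - l by rewrite -lc0 lead_coefE s0.
have CN0 (r : {poly K}) : (r%:P : {poly {poly K}})`_N = 0.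
  by rewrite coefC gtn_eqF.
pose L1 : {rmorphism {poly K} -> {poly {poly K}}} := polyC.
pose L2 : {rmorphism {poly K} -> {poly {poly K}}} := map_poly polyC.
pose L3 : {rmorphism {poly K} -> {poly {poly K}}} := tform_rmorph \o polyC.
pose L4 : {rmorphism {poly K} -> {poly {poly K}}} := tform_rmorph \o map_poly polyC.
have eL3 r : L3 r = r^:P by rewrite -[LHS]/(tform r%:P) tformC.
have eL4 r : L4 r = tform r^:P by [].
(* W1 = M(p(x), q(X)) and W2 = M(p(X), q(x)); their forms of highest degree
   are the same sums with L3 and L4 *)
pose W1 := (map_poly (L1 \o comp_poly p) M).[q^:P].
pose W2 := (map_poly (L2 \o comp_poly p) M).[q%:P].
have lift := relation_lift dp dq cop mM sM M0.
have sqm : (size q <= (deg q).+1)%N by rewrite sizeE_deg.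
have [|| sW1 cW1] := lift L1 q^:P.
- by move=> r; rewrite /= size_polyC; case: eqP => [->|/eqP h]; rewrite ?size_poly0 // size_poly_gt0.
- by rewrite size_map_polyC.
have [|| sW2 cW2] := lift L2 q%:P.
- by move=> r; rewrite size_map_polyC.
- by apply: leq_trans (size_polyC_leq1 _) _.
have [|| sT1 cT1] := lift L3 (tform q^:P).
- by move=> r; rewrite eL3 size_map_polyC.
- by apply: leq_trans (size_tform_lift _) _.
have [|| sT2 cT2] := lift L4 (tform q%:P).
- by move=> r; rewrite eL4 size_tform_lift.
- by rewrite tformC size_map_polyC.
have ET1 : (map_poly (L3 \o comp_poly p) M).[tform q^:P] = tform W1.
  by rewrite /W1 tform_horner_lift.
have ET2 : (map_poly (L4 \o comp_poly p) M).[tform q%:P] = tform W2.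
  by rewrite /W2 tform_horner_lift.
rewrite {}ET1 in sT1 cT1; rewrite {}ET2 in sT2 cT2.
rewrite -/W1 -/N in sW1 cW1; rewrite -/W2 -/N in sW2 cW2.
rewrite -/N in sT1 cT1 sT2 cT2.
have qlc : q`_(deg q) = lead_coef q by rewrite lead_coefE.
have {}cW1 : W1`_N = l%:P.
  by rewrite cW1 /= CN0 addr0 coef_map /= qlc -rmorphXn.
have {}cW2 : W2`_N = - l%:P.
  rewrite cW2 /= coef_map /= c0N coefC (gtn_eqF dq) expr0n (gtn_eqF dp) add0r.
  by rewrite rmorphN.
have {}cT1 : (tform W1)`_N = l *: ('X^N - 1).
  rewrite cT1 coef_tform_lift qlc eL3 coef_map /= c0N.
  rewrite -!mul_polyC exprMn -exprM -rmorphXn /= -/l [(deg q * _)%N]mulnC -/N.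
  by rewrite mulrBr mulr1 rmorphN.
have {}cT2 : (tform W2)`_N = - (l *: ('X^N - 1)).
  rewrite cT2 eL4 coef_tform_lift c0N tformC coef_map /= qlc.
  by rewrite -rmorphXn /= -/l -!mul_polyC rmorphN mulrBr mulr1; ring.
have t0 : l *: ('X^N - 1) != 0 :> {poly K}.
  by rewrite scaler_eq0 (negPf l0) -size_poly_eq0 size_XnsubC.
have lP0 : l%:P != 0 :> {poly K} by rewrite polyC_eq0.
have [szW1 lW1] := size_lead sW1 cW1 lP0.
have [szT1 lT1] := size_lead sT1 cT1 t0.
have [szW2 lW2] : size (- W2) = N.+1 /\ lead_coef (- W2) = l%:P.
  by apply: size_lead lP0; rewrite ?size_polyN // coefN cW2 opprK.
have [szT2 lT2] : size (tform (- W2)) = N.+1 /\ lead_coef (tform (- W2)) = l *: ('X^N - 1).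
  by apply: size_lead t0; rewrite tformN ?size_polyN // coefN cT2 opprK.
pose G := g^:P - f%:P.
have G0 : bieval p q G = 0.
  rewrite /bieval /G rmorphB /= map_polyC hornerD hornerN hornerC /= e.
  rewrite -map_poly_comp /= -[g \Po q]/((g^:P).[q]).
  by rewrite (@eq_map_poly _ _ _ polyC) ?subrr // => x; rewrite /= comp_polyC.
have [Q EQ] := relation_dvd dp dq cop mM sM M0 G0.
pose Q1 := (map_poly (L1 \o comp_poly p) Q).[q^:P].
pose Q2 := (map_poly (L2 \o comp_poly p) Q).[q%:P].
pose H := (f \Po p)^:P - (f \Po p)%:P : {poly {poly K}}.
have E1 : W1 * Q1 = H.
  rewrite mulrC -hornerM -rmorphM -EQ /G rmorphB hornerD hornerN /= map_polyC hornerC /=.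
  rewrite -map_poly_comp; congr (_ - _).
  rewrite (@eq_map_poly _ _ _ (map_poly polyC \o polyC)); last first.
    by move=> x; rewrite /= comp_polyC map_polyC.
  rewrite e map_comp_poly /comp_poly -map_poly_comp.
  by congr (_.[_]); apply: eq_map_poly => x; rewrite /= map_polyC.
have E2 : W2 * Q2 = - H.
  rewrite mulrC -hornerM -rmorphM -EQ /G rmorphB hornerD hornerN /= map_polyC hornerC /=.
  rewrite -map_poly_comp /H opprB; congr (_ - _).
  rewrite (@eq_map_poly _ _ _ (polyC \o polyC)); last first.
    by move=> x; rewrite /= comp_polyC map_polyC.
  by rewrite map_poly_comp horner_map e.
have dF : (0 < deg (f \Po p))%N by rewrite deg_comp muln_gt0 df.
have [topH _] := top_fibre_diff dF.
have EW : W1 = - W2.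
  apply: (@divisor_uniq _ W1 Q1 (- W2) Q2).
  - by rewrite E1 mulNr E2 opprK.
  - by rewrite -size_poly_eq0 szW2.
  - by rewrite szW1 szW2.
  - by rewrite lW1 lW2.
  - by rewrite /top lT1 lT2.
  - by rewrite /top lT2 szW2 size_scale ?size_XnsubC.
  apply: (@coprime_unity _ char0 _ _ (lead_coef (f \Po p)) (deg (f \Po p))) => //.
    by rewrite lead_coef_eq0 deg_neq0.
  rewrite /top lT2 -lT1 -/(top W1) -/(top Q1) -topM E1.
  exact: topH.
(* evaluation at X = 0 *)
have key := congr1 (fun U : {poly {poly K}} => U.[0]) EW.
exists (M.[(q.[0])%:P]), (- map_poly (horner_eval p.[0]) M).
have d0 := deg_relation_coef0 dp dq cop mM sM M0.
have eq0 : M.[(q.[0])%:P] \Po p = - map_poly (horner_eval p.[0]) M \Po q.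
  transitivity (W1.[0]).
    rewrite /W1 -[RHS]/(horner_eval 0 _) -[LHS]/(comp_poly p _).
    rewrite -(horner_map (comp_poly p)) -(horner_map (horner_eval 0)); congr (_.[_]).
    - rewrite -map_poly_comp; apply: eq_map_poly => x /=.
      by rewrite /horner_eval hornerC.
    - by rewrite /= comp_polyC /horner_eval -[X in _ = _.[X]]/(0%:P) horner_map.
  rewrite key hornerN rmorphN; congr (- _).
  rewrite /W2 -[LHS]/(horner_eval 0 _) -horner_map.
  rewrite -map_poly_comp /= /comp_poly -map_poly_comp /=; congr (_.[_]).
  - apply: eq_map_poly => x /=; rewrite /horner_eval -[0 in LHS]/(0%:P) horner_map /=.
    by rewrite horner_comp.
  - by rewrite /horner_eval hornerC.
have dd : deg (- map_poly (horner_eval p.[0]) M) = deg p.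
  rewrite /deg size_polyN size_map_poly_id0 ?sM //.
  by rewrite (monicP mM) /horner_eval hornerC oner_neq0.
split=> //; apply/eqP; rewrite -(eqn_pmul2r dp) -deg_comp eq0 deg_comp dd mulnC.
by [].
Qed.

End Multiple.

(** * Common right components *)

Lemma add_squeeze (a b c d N : nat) : (a <= c)%N -> (b <= d)%N ->
  (a + b = N)%N -> (c + d = N)%N -> a = c /\ b = d.
Proof. lia. Qed.

Section Luroth.
Variable K : closedFieldType.
Implicit Types (c f g h p q u : {poly K}) (P U V G : {poly {poly K}}).

Lemma eval_eq0_factor U (x : K) : map_poly (horner_eval x) U = 0 ->
  exists U1, U = ('X - x%:P) *: U1.
Proof.
move=> e; exists (map_poly (fun c => c %/ ('X - x%:P)) U).
apply/polyP => i; rewrite coefZ coef_map_id0 ?div0p // mulrC divpK //.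
rewrite dvdp_XsubCl rootE; have := congr1 (fun r : {poly K} => r`_i) e.
by rewrite coef_map coef0 => /eqP.
Qed.

(** Gauss's lemma. Every root of c annihilates U or V modulo x minus that
root, since K[X] is a domain; so the linear factors of c can be cancelled one
after the other. *)
Lemma gauss_factor c P U V : c != 0 -> c *: P = U * V ->
  exists U' V' c1 c2, [/\ c1 != 0, c2 != 0, P = U' * V' & c1 *: U = c2 *: U'].
Proof.
have [n] := ubnP (size c); elim: n => // n IH in c U V *; rewrite ltnS => sc c0 e.
have [sc1|sc1] := eqVneq (size c) 1%N.
  have /size_poly1P [k k0 ck] : size c == 1%N by rewrite sc1.
  exists ((k^-1)%:P *: U), V, 1, k%:P; split; rewrite ?oner_neq0 ?polyC_eq0 //.
    by rewrite -scalerAl -e ck scalerA -polyCM mulVf // scale1r.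
  by rewrite scalerA -polyCM mulfV // scale1r.
have /closed_rootP [x cx] := sc1.
have [c' Ec] : exists c', c = c' * ('X - x%:P).
  by apply/dvdpP; rewrite dvdp_XsubCl.
have c'0 : c' != 0 by apply: contraNneq c0 => z; rewrite Ec z mul0r.
have X0 : 'X - x%:P != 0 :> {poly K} by rewrite polyXsubC_eq0.
have sc' : (size c' < n)%N.
  by apply: leq_trans sc; rewrite Ec size_mul // size_XsubC addn2.
have ev0 : map_poly (horner_eval x) U * map_poly (horner_eval x) V = 0.
  rewrite -rmorphM -e -mul_polyC rmorphM /= map_polyC /= /horner_eval.
  by move: cx; rewrite rootE => /eqP ->; rewrite mul0r.
have scl (W Z : {poly {poly K}}) : ('X - x%:P) *: W = ('X - x%:P) *: Z -> W = Z.
  by rewrite -!mul_polyC; apply: mulfI; rewrite polyC_eq0.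
have /orP [/eqP /eval_eq0_factor [U1 EU]|/eqP /eval_eq0_factor [V1 EV]] :
   (map_poly (horner_eval x) U == 0) || (map_poly (horner_eval x) V == 0).
- by rewrite -mulf_eq0 ev0.
- have e1 : c' *: P = U1 * V.
    by apply: scl; rewrite scalerA mulrC -Ec e EU scalerAl.
  have [U' [V' [c1 [c2 [c10 c20 EP E]]]]] := IH _ _ _ sc' c'0 e1.
  exists U', V', c1, (('X - x%:P) * c2); split; rewrite ?mulf_neq0 //.
  by rewrite EU scalerA mulrC -!scalerA E.
have e1 : c' *: P = U * V1.
  by apply: scl; rewrite scalerA mulrC -Ec e EV -scalerAr.
have [U' [V' [c1 [c2 [c10 c20 EP E]]]]] := IH _ _ _ sc' c'0 e1.
by exists U', V', c1, c2.
Qed.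

(** The polynomial p(X) - p(x), whose zeros are the pairs of points in the
same fibre of p. *)
Definition fibre_diff p : {poly {poly K}} := p^:P - p%:P.

Lemma fibre_diff_comp_dvd f p : exists P1, fibre_diff (f \Po p) = fibre_diff p * P1.
Proof.
elim/poly_ind: f => [|f c [P1 E]].
  by exists 0; rewrite comp_poly0 /fibre_diff rmorph0 subr0 mulr0.
exists (P1 * p^:P + (f \Po p)%:P).
rewrite comp_polyD comp_polyM comp_polyX comp_polyC /fibre_diff.
rewrite !rmorphD !rmorphM /= !map_polyC mulrDr !mulrA -E /fibre_diff; ring.
Qed.

Lemma size_fibre_diff p : (0 < deg p)%N ->
  size (fibre_diff p) = (deg p).+1 /\ lead_coef (fibre_diff p) = (lead_coef p)%:P.
Proof.
move=> dp; have s : (size ((p%:P)%R : {poly {poly K}}) < size (p^:P)%R)%N.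
  by rewrite size_map_polyC (leq_ltn_trans (size_polyC_leq1 _)) // -deg_gt0.
rewrite /fibre_diff size_polyDl ?lead_coefDl ?size_polyN // size_map_polyC sizeE_deg //.
by rewrite lead_coef_map_inj //; apply: polyC_inj.
Qed.

Lemma eval_fibre_diff p x : map_poly (horner_eval x) (fibre_diff p) = p - (p.[x])%:P.
Proof.
rewrite rmorphB /= map_polyC /= -map_poly_comp map_poly_id // => y _.
by rewrite /= /horner_eval hornerC.
Qed.

Lemma size_tform_pos U : top U != 0 -> size (top U) = size U ->
  (size U <= size (tform U))%N.
Proof.
move=> t0 sU; have U0 : (0 < size U)%N by rewrite -sU size_poly_gt0.
have : (top U)`_(size U).-1 != 0 by rewrite -sU -lead_coefE lead_coef_eq0.
rewrite /top lead_coefE coef_tform; case: leqP => [h _|]; last by rewrite eqxx.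
have : (0 < size (tform U))%N.
  by rewrite size_poly_gt0; apply: contraNneq t0 => e; rewrite /top e lead_coef0.
by move: h U0; case: (size U) => // a; case: (size (tform U)).
Qed.

Hypothesis char0 : [pchar K] =i pred0.

(** Phi is the greatest common divisor over K(x), normalised by Gauss's lemma.
The cofactors P', Q' occur as a product in F(X) - F(x), so top P' and top Q'
are coprime; hence X^d - x^d, with d the gcd of the degrees, divides top Phi.
That top Phi divides X^n - x^n up to a constant shows that the coefficient
Phi(x, 0) has the full degree in x. *)
Lemma fibre_diff_gcd f g p q : f \Po p = g \Po q -> (0 < deg f)%N ->
  (0 < deg p)%N -> (0 < deg q)%N ->
  exists (Phi P' Q' A B : {poly {poly K}}) (D : {poly K}),
  [/\ fibre_diff p = Phi * P', fibre_diff q = Phi * Q', D != 0,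
      D *: Phi = A * fibre_diff p + B * fibre_diff q &
   [/\ exists2 k : K, k != 0 & lead_coef Phi = k%:P,
      (gcdn (deg p) (deg q) < size Phi)%N & size Phi`_0 = size Phi]].
Proof.
move=> e df dp dq; set P := fibre_diff p; set Q := fibre_diff q.
have [sP lP] := size_fibre_diff dp; have [sQ lQ] := size_fibre_diff dq.
have P0 : P != 0 by rewrite -size_poly_eq0 sP.
have Q0 : Q != 0 by rewrite -size_poly_eq0 sQ.
have p0 := deg_neq0 dp; have q0 := deg_neq0 dq.
have ulc (r : {poly K}) : r != 0 -> (lead_coef r)%:P \is a @GRing.unit {poly K}.
  by move=> r0; rewrite poly_unitE size_polyC coefC /= unitfE lead_coef_eq0 r0.
have /Pdiv.WeakIdomain.dvdpP [[c A0] /= c0 EA] := dvdp_gcdl P Q.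
rewrite mulrC in EA.
have [Phi [P' [c1 [c2 [c10 c20 EP EPhi]]]]] := gauss_factor c0 EA.
have eqG : gcdp P Q %= Phi by apply/eqpP; exists (c1, c2); rewrite /= ?c10.
have uPhi : lead_coef Phi \is a GRing.unit.
  by have := ulc _ p0; rewrite -lP -/P EP lead_coefM unitrM => /andP [].
have [Q' EQ] : exists Q', Q = Q' * Phi.
  apply/(Pdiv.IdomainUnit.dvdpP uPhi).
  by rewrite -(eqp_dvdl _ eqG) dvdp_gcdr.
rewrite mulrC in EQ.
have uQ' : lead_coef Q' \is a GRing.unit.
  by have := ulc _ q0; rewrite -lQ -/Q EQ lead_coefM unitrM => /andP [].
have [[A1 B1] /= /eqp_trans /(_ eqG) /eqpP [[c3 D] /= /andP [c30 D0]]] := Bezoutp P Q.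
rewrite scalerDr !scalerAl => ED.
set A := c3 *: A1 in ED; set B := c3 *: B1 in ED.
exists Phi, P', Q', A, B, D; split=> //.
have Phi0 : Phi != 0 by apply: contraNneq P0 => z; rewrite EP z mul0r.
have P'0 : P' != 0 by apply: contraNneq P0 => z; rewrite EP z mulr0.
have [P1 EP1] := fibre_diff_comp_dvd f p; have [Q1 EQ1] := fibre_diff_comp_dvd g q.
have E1 : P' * P1 = Q' * Q1.
  by apply: (mulfI Phi0); rewrite !mulrA -EP -EQ -EP1 -EQ1 e.
have E2 : D%:P = A * P' + B * Q'.
  by apply: (mulfI Phi0); rewrite mulrC mul_polyC -ED EP EQ; ring.
have [E EE] : exists E, P1 = E * Q'.
  apply/(Pdiv.IdomainUnit.dvdpP uQ').
  have : Q' %| D *: P1.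
    have -> : D *: P1 = (A * Q1 + B * P1) * Q'.
      by rewrite -mul_polyC E2 mulrDl -mulrA E1; ring.
    exact: dvdp_mull.
  by rewrite dvdpZr.
have dF : (0 < deg (f \Po p))%N by rewrite deg_comp muln_gt0 df.
have [topH _] := top_fibre_diff dF.
(* P' Q' is a factor of F(X) - F(x), whose top form is separable *)
have cop : coprimep (top P') (top Q').
  have : coprimep (top P') (top Q' * (top Phi * top E)).
    apply: (@coprime_unity _ char0 _ _ (lead_coef (f \Po p)) (deg (f \Po p))) => //.
      by rewrite lead_coef_eq0 deg_neq0.
    by rewrite -topH -!topM -/(fibre_diff _) EP1 -/P EP EE; congr top; ring.
  by rewrite coprimepMr => /andP [].
have [topP stP] := top_fibre_diff dp; have [topQ _] := top_fibre_diff dq.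
rewrite -/(fibre_diff p) -/P in topP stP; rewrite -/(fibre_diff q) -/Q in topQ.
have dvX n d : (d %| n)%N -> ('X^d - 1 : {poly K}) %| 'X^n - 1.
  by move=> /dvdnP [k ->]; rewrite mulnC exprM [X in _ %| X]subrX1 dvdp_mulr.
have dvPhi : 'X^(gcdn (deg p) (deg q)) - 1 %| top Phi.
  have : 'X^(gcdn (deg p) (deg q)) - 1 %| gcdp (top Phi * top P') (top Phi * top Q').
    rewrite dvdp_gcd -!topM -EP -EQ topP topQ.
    by rewrite !dvdpZr ?lead_coef_eq0 // !dvX ?dvdn_gcdl ?dvdn_gcdr.
  rewrite (eqp_dvdr _ (gcdp_mul2l _ _ _)) => h.
  have : top Phi * gcdp (top P') (top Q') %= top Phi.
    by rewrite -[X in _ %= X]mulr1; apply: eqp_mull; rewrite gcdp_eqp1.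
  by move=> /eqp_dvdr <-.
have tP0 := top_eq0 Phi0; have tP'0 := top_eq0 P'0.
have s1 : (size (top Phi) + size (top P') = (deg p).+2)%N.
  have : size (top P) = (deg p).+1.
    by rewrite topP size_scale ?lead_coef_eq0 // size_XnsubC.
  rewrite EP topM size_mul // => h.
  by rewrite -h prednK // addn_gt0 size_poly_gt0 tP0.
have s2 : (size Phi + size P' = (deg p).+2)%N.
  by rewrite -sP -/P EP size_mul // prednK // addn_gt0 size_poly_gt0 Phi0.
have le1 := size_top Phi; have le2 := size_top P'.
have [sz1 sz2] := add_squeeze le1 le2 s1 s2.
have tf0 U : U != 0 -> tform U != 0 by apply: contraNneq => /tform_eq0 ->.
have s3 : (size (tform Phi) + size (tform P') = (deg p).+2)%N.
  by rewrite -stP EP tformM size_mul ?tf0 // prednK // addn_gt0 size_poly_gt0 tf0.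
have le3 := size_tform_pos tP0 sz1; have le4 := size_tform_pos tP'0 sz2.
have [/esym sz3 _] := add_squeeze le3 le4 s2 s3.
split.
- move: uPhi; rewrite poly_unitE => /andP [/eqP s /[!unitfE] k0].
  by exists (lead_coef Phi)`_0 => //; apply: size1_polyC; rewrite s.
- rewrite -sz1; apply: leq_trans (dvdp_leq tP0 dvPhi).
  by rewrite size_XnsubC // gcdn_gt0 dp.
have k0 : (top Phi).[0] != 0.
  have : (top P).[0] != 0.
    rewrite topP hornerZ mulf_eq0 lead_coef_eq0 (negPf p0) /= !hornerE expr0n.
    by rewrite (gtn_eqF dp) sub0r oppr_eq0 oner_eq0.
  by rewrite EP topM hornerM; apply: contraNneq => ->; rewrite mul0r.
have sPhi : (0 < size Phi)%N by rewrite size_poly_gt0.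
rewrite -[RHS]prednK //; apply: (proj1 (@size_lead _ _ _ (top Phi).[0] _ _ k0)).
  apply/leq_sizeP => j; rewrite prednK // -sz3 => h.
  have := coef_tform Phi j 0%N; rewrite leq0n subn0 => <-.
  by rewrite (nth_default 0 h) coef0.
have := coef_tform Phi (size Phi).-1 0%N; rewrite leq0n subn0 => <-.
by rewrite -sz3 /top lead_coefE horner_coef0.
Qed.

(** A multiple root of a divisor of p - x would be a critical point in the
fibre. *)
Lemma uniq_fibre_factor p rs (x : K) : (0 < deg p)%N ->
  (forall y, p.[y] = x -> p^`().[y] != 0) ->
  \prod_(z <- rs) ('X - z%:P) %| p - x%:P -> uniq rs.
Proof.
move=> dp sep dv; apply/negPn/negP => nu.
have [y hy] : exists y, (1 < count_mem y rs)%N.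
  elim: rs nu {dv} => //= z rs IH; rewrite negb_and negbK => /orP [zin|/IH [y hy]].
    by exists z; rewrite eqxx add1n ltnS -has_count has_pred1.
  by exists y; apply: leq_trans hy (leq_addl _ _).
have Pn0 : \prod_(z <- rs) ('X - z%:P) != 0 by rewrite monic_neq0 // monic_prod_XsubC.
have : ('X - y%:P) ^+ 2 %| p - x%:P.
  by apply: dvdp_trans dv; rewrite -mup_geq // mu_prod_XsubC.
move=> /dvdpP [s Es].
have py : p.[y] = x.
  apply/eqP; rewrite -subr_eq0; have := congr1 (fun r => r.[y]) Es.
  rewrite hornerM horner_exp hornerXsubC subrr expr0n /= mulr0.
  by rewrite hornerD hornerN hornerC => ->.
have := sep _ py; have := congr1 (fun r => r^`().[y]) Es.
rewrite derivB derivC subr0 => ->.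
by rewrite expr2 mulrA derivM derivXsubC mulr1 hornerD !hornerM hornerXsubC subrr !mulr0 addr0 eqxx.
Qed.

(** Take h = Phi(x, 0). If y is a root of Phi(x, .) then p(y) = p(x) and q(y)
= q(x), hence Phi(y, .) = Phi(x, .) for generic x, and h(y) = h(x). So Phi(x,
.) divides h - h(x), and these have the same degree; therefore h - h(x)
divides p - p(x) and q - q(x), and right_factor_generic applies. *)
Theorem common_right_component f g p q : f \Po p = g \Po q -> (0 < deg f)%N ->
  (0 < deg p)%N -> (0 < deg q)%N ->
  exists h p1 q1, [/\ p = p1 \Po h, q = q1 \Po h &
    (gcdn (deg p) (deg q) <= deg h)%N].
Proof.
move=> e df dp dq.
have [Phi [P' [Q' [A [B [D [EP EQ D0 ED [[k k0 lPhi] sPhi s0]]]]]]]] := fibre_diff_gcd e df dp dq.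
set h := Phi`_0 in s0.
have d0 : (0 < gcdn (deg p) (deg q))%N by rewrite gcdn_gt0 dp.
have sh : (1 < size h)%N by rewrite s0; apply: leq_ltn_trans sPhi.
pose ev (x : K) := map_poly (horner_eval x).
have evEP x : p - (p.[x])%:P = ev x Phi * ev x P' by rewrite -eval_fibre_diff EP rmorphM.
have evEQ x : q - (q.[x])%:P = ev x Phi * ev x Q' by rewrite -eval_fibre_diff EQ rmorphM.
have evED x : D.[x] *: ev x Phi = ev x A * (p - (p.[x])%:P) + ev x B * (q - (q.[x])%:P).
  rewrite -!eval_fibre_diff -!rmorphM -rmorphD -ED /= -!mul_polyC rmorphM /= map_polyC.
  by [].
have ek x : horner_eval x (lead_coef Phi) = k by rewrite lPhi /horner_eval hornerC.
have sev x : size (ev x Phi) = size Phi by rewrite size_map_poly_id0 ?ek.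
have lev x : lead_coef (ev x Phi) = k by rewrite lead_coef_map_id0 ?ek // rmorph0.
have [rs Ers] := closed_field_poly_normal (D * p^`()).
have p'0 := deriv_neq0 char0 dp.
have Dp0 : lead_coef (D * p^`()) != 0 by rewrite lead_coef_eq0 mulf_neq0.
pose E := (\prod_(z <- rs) ('X - (p.[z])%:P)) \Po p.
have E0 : E != 0.
  by rewrite comp_poly_eq0 -?deg_gt0 // monic_neq0 // monic_prod_XsubC.
have good x y : ~~ root E x -> p.[y] = p.[x] -> D.[y] != 0 /\ p^`().[y] != 0.
  move=> xE pyx; apply/andP; rewrite -negb_or -mulf_eq0 -hornerM.
  apply: contra xE => /eqP yr; rewrite root_comp.
  have yin : y \in rs by rewrite -root_prod_XsubC -(rootZ _ _ Dp0) -Ers rootE yr.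
  rewrite rootE horner_prod prodf_seq_eq0; apply/hasP; exists y => //.
  by rewrite /= !hornerE pyx subrr.
have fibre x : ~~ root E x -> ev x Phi %| h - (h.[x])%:P.
  move=> xE; have [ts Ets] := closed_field_poly_normal (ev x Phi).
  rewrite Ets lev dvdpZl //.
  have dvp : \prod_(z <- ts) ('X - z%:P) %| p - (p.[x])%:P.
    by rewrite evEP Ets lev -scalerAl dvdpZr // dvdp_mulr.
  have uts : uniq ts.
    by apply: (uniq_fibre_factor dp _ dvp) => y /(good _ _ xE) [].
  apply: uniq_roots_dvdp; last by rewrite uniq_rootsE.
  apply/allP => y yin.
  have rPhi : (ev x Phi).[y] = 0.
    by apply/eqP; rewrite -rootE Ets rootZ ?lev // root_prod_XsubC.
  have pyx : p.[y] = p.[x].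
    apply/eqP; rewrite -subr_eq0; have := congr1 (fun r => r.[y]) (evEP x).
    by rewrite !hornerE rPhi mul0r => ->.
  have qyx : q.[y] = q.[x].
    apply/eqP; rewrite -subr_eq0; have := congr1 (fun r => r.[y]) (evEQ x).
    by rewrite !hornerE rPhi mul0r => ->.
  have [Dy _] := good _ _ xE pyx.
  have dvPhi : ev x Phi %| ev y Phi.
    rewrite -(dvdpZr _ _ Dy) evED pyx qyx evEP evEQ.
    by rewrite dvdp_add // dvdp_mull // dvdp_mulr.
  have /eqpP [[k1 k2] /= /andP [k10 k20] ek12] : ev x Phi %= ev y Phi.
    by rewrite -dvdp_size_eqp // !sev.
  have k12 : k1 = k2.
    have := congr1 lead_coef ek12; rewrite !lead_coefZ !lev.
    exact: mulIf.
  have Exy : ev x Phi = ev y Phi.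
    by move: ek12; rewrite k12 => /(congr1 (fun r => k2^-1 *: r)); rewrite !scalerA mulVf // !scale1r.
  rewrite rootE !hornerE subr_eq0 /h; apply/eqP.
  have hev (z : K) : (Phi`_0).[z] = (ev z Phi)`_0 by rewrite coef_map.
  by rewrite !hev Exy.
have fibre' x : ~~ root E x -> h - (h.[x])%:P %| ev x Phi.
  move=> /fibre dv; have : ev x Phi %= h - (h.[x])%:P.
    rewrite -dvdp_size_eqp // sev -s0 eq_sym; apply/eqP.
    by rewrite size_polyDl // size_polyN (leq_ltn_trans (size_polyC_leq1 _)).
  by rewrite eqp_sym => /eqp_dvdl ->.
have [p1 Ep1] : exists p1, p = p1 \Po h.
  apply: (right_factor_generic sh E0) => x xE.
  by rewrite evEP dvdp_mulr // fibre'.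
have [q1 Eq1] : exists q1, q = q1 \Po h.
  apply: (right_factor_generic sh E0) => x xE.
  by rewrite evEQ dvdp_mulr // fibre'.
exists h, p1, q1; split=> //.
by rewrite /deg s0; move: sPhi; case: (size Phi).
Qed.

End Luroth.

(** * Irreducible polynomials and Ritt's first theorem *)

Section Irreducible.
Variable K : closedFieldType.
Implicit Types (b c d f g h p q u v w : {poly K}) (s t B : seq {poly K}).

(** The intersection of K[p] and K[q] is K[c o p]: all degrees in it are
multiples of deg p * deg q, so a suitable multiple of a power of c o p lowers
the degree. *)
Lemma common_multiple_factor f g p q c d : f \Po p = g \Po q ->
  c \Po p = d \Po q -> (0 < deg p)%N -> (0 < deg q)%N ->
  coprime (deg p) (deg q) -> deg c = deg q -> deg d = deg p ->
  exists b, f = b \Po c /\ g = b \Po d.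
Proof.
move=> e ecd dp dq cop dc dd.
have [n] := ubnP (size f); elim: n => // n IH in f g e *; rewrite ltnS => sf.
have [df|df] := posnP (deg f).
  exists (f`_0)%:P; rewrite !comp_polyC; have fE := deg0_const df; split=> //.
  by apply: (comp_can_r dq); rewrite -e {1}fE !comp_polyC.
have dv : (deg q %| deg f)%N.
  have : (deg q %| deg f * deg p)%N by rewrite -deg_comp e deg_comp dvdn_mull.
  by rewrite Gauss_dvdl // coprime_sym.
have [k Ek] := dvdnP dv.
have c0 : c != 0 by apply: deg_neq0; rewrite dc.
have f0 := deg_neq0 df.
have lc0 : lead_coef c ^+ k != 0 by rewrite expf_neq0 // lead_coef_eq0.
pose l := lead_coef f / lead_coef c ^+ k.
have l0 : l != 0 by rewrite mulf_neq0 ?lead_coef_eq0 // invr_eq0.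
have lt : (size (f - l *: c ^+ k)%R < n)%N.
  apply: leq_trans sf; apply: size_sub_lead => //.
    by rewrite size_scale // !sizeE ?expf_neq0 // degX dc Ek mulnC.
  by rewrite lead_coefZ lead_coef_exp /l divfK.
have e' : (f - l *: c ^+ k) \Po p = (g - l *: d ^+ k) \Po q.
  by rewrite !comp_polyB !comp_polyZ !comp_poly_exp e ecd.
have [b [E1 E2]] := IH _ _ e' lt.
exists (b + l *: 'X^k); split.
  by rewrite comp_polyD comp_polyZ comp_poly_exp comp_polyX -E1 subrK.
by rewrite comp_polyD comp_polyZ comp_poly_exp comp_polyX -E2 subrK.
Qed.

Definition lequiv p q : Prop := exists2 u, compunit u & q = u \Po p.

Lemma irred_comp p b c : irred p -> p = b \Po c -> compunit b \/ compunit c.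
Proof.
move=> [dp ip] e; have dbc : (1 < deg b * deg c)%N by rewrite -deg_comp -e.
have [hb|hb] := ltnP 1 (deg b); last first.
  by left; rewrite /compunit; apply/eqP; rewrite eqn_leq hb /=; move: dbc; case: (deg b).
have [hc|hc] := ltnP 1 (deg c); first by case: ip; exists b, c.
right; rewrite /compunit; apply/eqP; rewrite eqn_leq hc /=; move: dbc.
by rewrite mulnC; case: (deg c).
Qed.

Lemma irred_unit_l p u : irred p -> compunit u -> irred (u \Po p).
Proof.
move=> [dp ip] cu; split; first by rewrite deg_unit_l.
move=> [b [c [db dc e]]]; apply: ip; exists (compinv u \Po b), c; split=> //.
  by rewrite deg_unit_l //; apply: unit_inv.
by rewrite -comp_polyA -e compVK.
Qed.

Lemma irred_unit_r p u : irred p -> compunit u -> irred (p \Po u).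
Proof.
move=> [dp ip] cu; split; first by rewrite deg_unit_r.
move=> [b [c [db dc e]]]; apply: ip; exists b, (c \Po compinv u); split=> //.
  by rewrite deg_unit_r //; apply: unit_inv.
by rewrite comp_polyA -e compKVr.
Qed.

Lemma lequiv_sym p q : lequiv p q -> lequiv q p.
Proof.
move=> [u cu ->]; exists (compinv u); first exact: unit_inv.
by rewrite compVK.
Qed.

Hypothesis char0 : [pchar K] =i pred0.

(** The common right component has degree > 1, so it is q up to a unit. *)
Lemma irred_right_factor f g p q : f \Po p = g \Po q -> (0 < deg f)%N ->
  (0 < deg p)%N -> irred q -> (1 < gcdn (deg p) (deg q))%N ->
  exists x, p = x \Po q.
Proof.
move=> e df dp iq g1; have dq : (0 < deg q)%N by case: iq => /ltnW.
have [h [p1 [q1 [Ep Eq dh]]]] := common_right_component char0 e df dp dq.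
have {}dh := leq_trans g1 dh.
have [cq1|] := irred_comp iq Eq; last by rewrite /compunit => E; rewrite E in dh.
exists (p1 \Po compinv q1).
by rewrite Eq -comp_polyA compVK.
Qed.

(** If c = c1 o c2 then c2 o p and q are right factors of one polynomial and
deg c2 divides the degrees of both. Hence c2 o p is a polynomial in q, so deg
q divides deg c2 by coprimality, which is impossible. *)
Lemma irred_left c p d q : irred q -> (0 < deg p)%N -> coprime (deg p) (deg q) ->
  c \Po p = d \Po q -> deg c = deg q -> irred c.
Proof.
move=> iq dp cop e dc; have [dq _] := iq; split; first by rewrite dc.
move=> [c1 [c2 [d1 d2 Ec]]].
have e2 : c1 \Po (c2 \Po p) = d \Po q by rewrite comp_polyA -Ec.
have dcc : deg q = (deg c1 * deg c2)%N by rewrite -dc Ec deg_comp.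
have [|||x Ex] := irred_right_factor e2 _ _ iq.
- exact: ltnW.
- by rewrite deg_comp muln_gt0 dp ltnW.
- apply: leq_trans d2 _; apply: dvdn_leq; first by rewrite gcdn_gt0 (ltnW dq) orbT.
  by rewrite dvdn_gcd deg_comp dcc dvdn_mulr // dvdn_mull.
have : (deg q %| deg c2 * deg p)%N by rewrite -deg_comp Ex deg_comp dvdn_mull.
rewrite Gauss_dvdl; last by rewrite coprime_sym.
move=> /dvdn_leq; rewrite (ltnW d2) => /(_ isT); rewrite dcc.
by rewrite -[X in (_ <= X)%N]mul1n leq_pmul2r ?(ltnW d2) // leqNgt d1.
Qed.

Lemma diamond f g p q : irred p -> irred q -> f \Po p = g \Po q ->
  (0 < deg f)%N -> ~ lequiv p q ->
  coprime (deg p) (deg q) /\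
  exists b c d, [/\ f = b \Po c, g = b \Po d, c \Po p = d \Po q &
    [/\ irred c, irred d, deg c = deg q & deg d = deg p]].
Proof.
move=> ip iq e df nl; have [dp _] := ip; have [dq _] := iq.
have cop : coprime (deg p) (deg q).
  have : (0 < gcdn (deg p) (deg q))%N by rewrite gcdn_gt0 (ltnW dp).
  rewrite leq_eqVlt => /predU1P [/esym/eqP //|g1].
  have [x Ex] := irred_right_factor e df (ltnW dp) iq g1.
  have [cx|] := irred_comp ip Ex; last by rewrite /compunit => E; rewrite E in dq.
  by case: nl; apply: lequiv_sym; exists x.
split=> //; have [c [d [ecd dc dd]]] := common_left_multiple char0 e df (ltnW dp) (ltnW dq) cop.
have [b [E1 E2]] := common_multiple_factor e ecd (ltnW dp) (ltnW dq) cop dc dd.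
exists b, c, d; split=> //; split=> //.
  exact: (irred_left iq (ltnW dp) cop ecd dc).
by apply: (irred_left ip (ltnW dq) _ (esym ecd) dd); rewrite coprime_sym.
Qed.

Lemma inA_unit_l u p : compunit u -> inA p -> inA (u \Po p).
Proof. by rewrite /inA deriv_comp hornerM => _ ->; rewrite mulr0. Qed.

Lemma inA_unit_r u p : compunit u -> inA (p \Po u) <-> root p^`() u`_0.
Proof.
move=> cu; have [uE u1] := compunitE cu.
rewrite /inA deriv_comp hornerM horner_comp horner_coef0.
have -> : u^`().[0] = u`_1 by rewrite horner_coef0 coef_deriv mulr1n.
split=> [/eqP|/eqP ->]; last by rewrite mul0r.
by rewrite mulf_eq0 (negPf u1) orbF.
Qed.

Lemma admissibleP p u : compunit u -> inA (p \Po u) -> admissible p u.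
Proof. by move=> cu h; split=> //; apply/inA_unit_r. Qed.

Lemma exists_admissible p : (1 < deg p)%N -> exists2 u, compunit u & inA (p \Po u).
Proof.
move=> dp; have /closed_rootP [x rx] : size p^`() != 1%N.
  by rewrite (size_deriv_char0 char0 (ltnW dp)).1 gtn_eqF.
exists ('X + x%:P); first exact: unit_XaddC.
apply/inA_unit_r; first exact: unit_XaddC.
by rewrite coefD coefX coefC add0r.
Qed.

(** The factors of maximal decompositions of regular elements. *)
Definition irrA p : Prop := irred p /\ inA p.

Lemma composite_cat s t : composite (s ++ t) = composite s \Po composite t.
Proof. by elim: s => [|p s IH] /=; rewrite ?comp_polyX // IH comp_polyA. Qed.

Lemma composite1 p : composite [:: p] = p.
Proof. by rewrite /= comp_polyXr. Qed.

Lemma composite_rcons s p : composite (rcons s p) = composite s \Po p.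
Proof. by rewrite -cats1 composite_cat composite1. Qed.

Lemma deg_composite_gt0 s : (forall p, p \in s -> irred p) -> (0 < deg (composite s))%N.
Proof.
elim: s => [|p s IH] H /=; first by rewrite /deg size_polyX.
rewrite deg_comp muln_gt0 IH ?andbT => [|q qs]; last by apply: H; rewrite inE qs orbT.
by have [/ltnW] := H p (mem_head _ _).
Qed.

Lemma composite_deg1 s : (forall p, p \in s -> irred p) -> deg (composite s) = 1%N ->
  s = [::].
Proof.
case: s => // p s H /=; rewrite deg_comp => /eqP; rewrite muln_eq1 => /andP [/eqP e _].
by have [] := H p (mem_head _ _); rewrite e.
Qed.

(** The unit v collects the corrections on the right that put each factor into
A. *)
Lemma exists_decomposition b : (0 < deg b)%N ->
  exists s v, [/\ compunit v, composite s = b \Po v & forall p, p \in s -> irrA p].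
Proof.
have [n] := ubnP (deg b); elim: n => // n IH in b *; rewrite ltnS => db b0.
have [d1|d1] := leqP (deg b) 1.
  have cb : compunit b by rewrite /compunit; apply/eqP; rewrite eqn_leq d1.
  exists [::], (compinv b); split=> //; first exact: unit_inv.
  by rewrite (compinvK cb).1.
have [ib|] := classic (irred b).
  have [v cv Av] := exists_admissible d1.
  exists [:: b \Po v], v; split=> //; first by rewrite composite1.
  by move=> p; rewrite inE => /eqP ->; split=> //; apply: irred_unit_r.
move=> nib; have [c [e [dc de E]]] :
    exists c e, [/\ (1 < deg c)%N, (1 < deg e)%N & b = c \Po e].
  by apply: NNPP => H; apply: nib; split.
have dE : deg b = (deg c * deg e)%N by rewrite E deg_comp.
have lt1 : (deg c < n)%N.
  by apply: leq_trans db; rewrite dE ltn_Pmulr // ltnW.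
have lt2 : (deg e < n)%N.
  by apply: leq_trans db; rewrite dE ltn_Pmull // ltnW.
have [s [v [cv Es Hs]]] := IH _ lt1 (ltnW dc).
have [||t [w [cw Et Ht]]] := IH (compinv v \Po e); rewrite ?deg_unit_l //; try exact: unit_inv.
  exact: ltnW.
exists (s ++ t), w; split=> //.
  by rewrite composite_cat Es Et !comp_polyA compKVr // -E.
by move=> p; rewrite mem_cat => /orP [/Hs|/Ht].
Qed.

(** The unit u makes the induction work: cancelling equivalent last factors
leaves one. If the last factors are inequivalent, both sides are compared with
a decomposition of b in the diamond. *)
Theorem ritt1 s t u : (forall p, p \in s -> irred p) -> (forall p, p \in t -> irred p) ->
  compunit u -> composite s \Po u = composite t -> size s = size t.
Proof.
have [n] := ubnP (deg (composite s)); elim: n => // n IH in s t u *.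
rewrite ltnS => ds Hs Ht cu e.
have det : deg (composite s) = deg (composite t) by rewrite -e deg_unit_r.
case: (lastP s) Hs ds e det => [|s' p] Hs ds e det.
  have -> // : t = [::] by apply: composite_deg1 => //; rewrite -det /deg size_polyX.
case: (lastP t) Ht e det => [|t' q] Ht e det.
  have E : rcons s' p = [::] by apply: composite_deg1 => //; rewrite det /deg size_polyX.
  by have := congr1 size E; rewrite size_rcons.
have ip : irred p by apply: Hs; rewrite mem_rcons mem_head.
have iq : irred q by apply: Ht; rewrite mem_rcons mem_head.
have Hs' x : x \in s' -> irred x by move=> xs; apply: Hs; rewrite mem_rcons inE xs orbT.
have Ht' x : x \in t' -> irred x by move=> xs; apply: Ht; rewrite mem_rcons inE xs orbT.
have ds' : (deg (composite s') < n)%N.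
  apply: leq_trans ds; rewrite composite_rcons deg_comp.
  by rewrite ltn_Pmulr ?deg_composite_gt0 //; case: ip.
have [dp _] := ip; have [dq _] := iq.
rewrite !composite_rcons -comp_polyA in e.
have ipu : irred (p \Po u) by apply: irred_unit_r.
rewrite !size_rcons; congr S.
have [[v cv Ev]|nl] := classic (lequiv (p \Po u) q).
  have e1 : composite s' = composite t' \Po v.
    apply: (@comp_can_r _ (p \Po u)); first by case: ipu => /ltnW.
    by rewrite e Ev comp_polyA.
  apply: (IH s' t' (compinv v)) => //; first exact: unit_inv.
  by rewrite e1 compKVr.
have [_ [b [c [d [Es Et Ecd [ic id _ _]]]]]] := diamond ipu iq e (deg_composite_gt0 Hs') nl.
have b0 : (0 < deg b)%N.
  by have := deg_composite_gt0 Hs'; rewrite Es deg_comp muln_gt0 => /andP [].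
have [B [v [cv EB HB]]] := exists_decomposition b0.
have cv' := unit_inv cv.
(* both sides have the length of B followed by one factor *)
have key (x : seq {poly K}) y : composite x = b \Po y -> (forall p, p \in x -> irred p) ->
    irred y -> (deg (composite x) < n)%N -> size x = (size B).+1.
  move=> Ex Hx iy dx; rewrite -(size_rcons B (compinv v \Po y)).
  apply: (IH x _ 'X) => //; last 2 first.
  - exact: unit_X.
  - by rewrite comp_polyXr composite_rcons EB -comp_polyA compKV.
  move=> z; rewrite mem_rcons inE => /predU1P [->|/HB []//].
  exact: irred_unit_l.
rewrite (key _ _ Es) // (key _ _ Et) //.
apply: leq_trans ds; rewrite det composite_rcons deg_comp.
by rewrite ltn_Pmulr ?deg_composite_gt0.
Qed.

End Irreducible.

(** * Ramification indices *)

Section Mult.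
Variable K : closedFieldType.
Implicit Types (a b c d f g h p q u v w P Q : {poly K}) (x y z : K).

Definition root_seq P : seq K := sval (closed_field_poly_normal P).

Lemma root_seqE P : P = lead_coef P *: \prod_(x <- root_seq P) ('X - x%:P).
Proof. by rewrite /root_seq; case: closed_field_poly_normal. Qed.

Lemma mupZ k P x : k != 0 -> mup x (k *: P) = mup x P.
Proof. by move=> k0; rewrite -mul_polyC mupMr // rootC. Qed.

Lemma mup_root_seq P x : P != 0 -> mup x P = count_mem x (root_seq P).
Proof. by move=> P0; rewrite {1}[P]root_seqE mupZ ?lead_coef_eq0 // mu_prod_XsubC. Qed.

Lemma size_root_seq P : P != 0 -> size (root_seq P) = deg P.
Proof.
by move=> P0; rewrite /deg {2}[P]root_seqE size_scale ?lead_coef_eq0 // size_prod_XsubC.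
Qed.

Lemma mem_root_seq P x : P != 0 -> (x \in root_seq P) = root P x.
Proof. by move=> P0; rewrite {2}[P]root_seqE rootZ ?lead_coef_eq0 // root_prod_XsubC. Qed.

Lemma mup_gt0 P x : P != 0 -> (0 < mup x P)%N = root P x.
Proof. by move=> P0; rewrite -XsubC_dvd // dvdp_XsubCl. Qed.

Lemma mup_exp P n x : P != 0 -> mup x (P ^+ n) = (n * mup x P)%N.
Proof.
move=> P0; elim: n => [|n IH]; first by rewrite expr0 mupNroot ?mul0n // root1.
by rewrite exprS mupM ?expf_neq0 // IH mulSn.
Qed.

Lemma sum_count_mem (T : eqType) (ts rs : seq T) : uniq ts ->
  (\sum_(x <- ts) count_mem x rs = count (mem ts) rs)%N.
Proof.
move=> u; elim: rs => [|r rs IH] /=; first by rewrite big1.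
rewrite big_split /= IH; congr (_ + _)%N.
have [rin|rnin] := boolP (r \in ts).
  rewrite (bigD1_seq r) //= eqxx big1 // => i ir.
  by rewrite eq_sym (negPf ir).
by rewrite big_seq big1 // => i iin; case: eqP rnin => // ->; rewrite iin.
Qed.

Lemma sum_mup_leq P ts : P != 0 -> uniq ts -> (\sum_(x <- ts) mup x P <= deg P)%N.
Proof.
move=> P0 u; under eq_bigr do rewrite mup_root_seq //.
by rewrite sum_count_mem // -size_root_seq // count_size.
Qed.

Lemma sum_mup_eq P ts : P != 0 -> uniq ts -> (forall x, root P x -> x \in ts) ->
  (\sum_(x <- ts) mup x P = deg P)%N.
Proof.
move=> P0 u H; under eq_bigr do rewrite mup_root_seq //.
rewrite sum_count_mem // -size_root_seq //; apply/eqP; rewrite -all_count.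
by apply/allP => x xin; apply: H; rewrite -mem_root_seq.
Qed.

Lemma nth_root_exists (e : nat) (k : K) : (0 < e)%N -> exists r, r ^+ e = k.
Proof.
move=> e0; have /closed_rootP [r] : size ('X^e - k%:P : {poly K}) != 1%N.
  by rewrite size_XnsubC //; case: e e0.
by rewrite rootE !hornerE subr_eq0 => /eqP <-; exists r.
Qed.

Lemma perfect_power P e : (0 < e)%N -> P != 0 -> (forall x, (e %| mup x P)%N) ->
  exists G, P = G ^+ e.
Proof.
move=> e0; have [n] := ubnP (size P); elim: n => // n IH in P *; rewrite ltnS.
move=> sP P0 H; have [/eqP/size_poly1P [k k0 ->]|sP1] := eqVneq (size P) 1%N.
  by have [r <-] := nth_root_exists k e0; exists r%:P; rewrite rmorphXn.
have /closed_rootP [x rx] := sP1.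
have : (e <= mup x P)%N by rewrite dvdn_leq // mup_gt0.
rewrite mup_geq // => /dvdpP [P1 EP].
have P10 : P1 != 0 by apply: contraNneq P0 => z; rewrite EP z mul0r.
have [||G EG] := IH P1 _ P10.
- apply: leq_trans sP; rewrite EP size_mul // ?expf_neq0 ?polyXsubC_eq0 //.
  by rewrite size_exp_XsubC addnS /= -[X in (X < _)%N]addn0 ltn_add2l.
- move=> y; have := H y; rewrite EP mupM // ?expf_neq0 ?polyXsubC_eq0 //.
  rewrite mup_XsubCX; case: eqP => _; last by rewrite addn0.
  by rewrite dvdn_addl.
by exists (G * ('X - x%:P)); rewrite exprMn -EG -EP.
Qed.

Lemma power_form P x0 e : (0 < e)%N -> P != 0 ->
  (forall x, x != x0 -> (e %| mup x P)%N) ->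
  exists G, P = ('X - x0%:P) ^+ (mup x0 P) * G ^+ e /\ G.[x0] != 0.
Proof.
move=> e0 P0 H; have [m [P1 nr1 EP]] := multiplicity_XsubC P x0.
rewrite P0 /= in nr1.
have P10 : P1 != 0 by apply: contraNneq P0 => z; rewrite EP z mul0r.
have [G EG] : exists G, P1 = G ^+ e.
  apply: perfect_power => // x; have [->|xx0] := eqVneq x x0.
    by rewrite mupNroot.
  have := H x xx0; rewrite EP mupM // ?expf_neq0 ?polyXsubC_eq0 //.
  by rewrite mup_XsubCX eq_sym (negPf xx0) addn0.
have -> : mup x0 P = m by rewrite EP mupMr // mup_XsubCX eqxx.
exists G; split; first by rewrite -EG mulrC.
by apply: contraNneq nr1 => Gx; rewrite EG rootE horner_exp Gx expr0n (gtn_eqF e0).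
Qed.

(** The ramification index of p at x, as a multiplicity in the fibre through
x. *)
Definition ramif p x : nat := mup x (p - (p.[x])%:P).

Lemma degC (k : K) : deg k%:P = 0%N.
Proof. by apply/eqP; rewrite -leqn0 /deg -subn1 leq_subLR addn0 size_polyC_leq1. Qed.

Lemma subC_neq0 p (k : K) : (0 < deg p)%N -> p - k%:P != 0.
Proof.
by move=> dp; rewrite subr_eq0; apply: contraTneq dp => ->; rewrite degC.
Qed.

Lemma deg_subC p (k : K) : deg (p - k%:P) = deg p.
Proof.
have [dp|dp] := posnP (deg p).
  by rewrite (deg0_const dp) -polyCB !degC.
rewrite /deg size_polyDl // size_polyN (leq_ltn_trans (size_polyC_leq1 _)) //.
by rewrite -deg_gt0.
Qed.

Lemma lead_subC p (k : K) : (0 < deg p)%N -> lead_coef (p - k%:P) = lead_coef p.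
Proof.
move=> dp; rewrite lead_coefDl // size_polyN (leq_ltn_trans (size_polyC_leq1 _)) //.
by rewrite -deg_gt0.
Qed.

Lemma root_subC p (k : K) x : root (p - k%:P) x = (p.[x] == k).
Proof. by rewrite rootE hornerD hornerN hornerC subr_eq0. Qed.

Lemma ramif_gt0 p x : (0 < deg p)%N -> (0 < ramif p x)%N.
Proof. by move=> dp; rewrite /ramif mup_gt0 ?subC_neq0 // root_subC. Qed.

Lemma mup_fibre p x (k : K) : p.[x] = k -> mup x (p - k%:P) = ramif p x.
Proof. by move=> <-. Qed.

Lemma mup_comp P b x : P != 0 -> (0 < deg b)%N ->
  mup x (P \Po b) = (mup b.[x] P * ramif b x)%N.
Proof.
move=> P0 db; set y := b.[x].
have [m [P1 nr1 EP]] := multiplicity_XsubC P y; rewrite P0 /= in nr1.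
have -> : mup y P = m by rewrite EP mupMr // mup_XsubCX eqxx.
rewrite EP comp_polyM comp_poly_exp comp_polyB comp_polyX comp_polyC mupMr; last first.
  by rewrite root_comp.
by rewrite mup_exp ?subC_neq0.
Qed.

Lemma ramif_comp a b x : (0 < deg a)%N -> (0 < deg b)%N ->
  ramif (a \Po b) x = (ramif a b.[x] * ramif b x)%N.
Proof.
move=> da db; rewrite {1 2}/ramif horner_comp -mup_comp ?subC_neq0 //.
by rewrite comp_polyB comp_polyC.
Qed.

Hypothesis char0 : [pchar K] =i pred0.

Lemma mup_deriv P x : P != 0 -> root P x -> mup x P^`() = (mup x P).-1.
Proof.
move=> P0; rewrite -mup_gt0 // => m0.
have [m [P1 nr1 EP]] := multiplicity_XsubC P x; rewrite P0 /= in nr1.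
have Em : mup x P = m by rewrite EP mupMr // mup_XsubCX eqxx.
rewrite Em in m0 *; case: m m0 EP {Em} => // m _ EP.
have -> : P^`() = (P1^`() * ('X - x%:P) + P1 *+ m.+1) * ('X - x%:P) ^+ m.
  rewrite EP derivM deriv_exp derivXsubC mul1r [_.+1.-1]/= exprS [RHS]mulrDl.
  by congr (_ + _); rewrite ?mulrnAr ?mulrnAl // -mulrA.
rewrite mupMr /= ?mup_XsubCX ?eqxx //.
rewrite rootE hornerD hornerM hornerXsubC subrr mulr0 add0r hornerMn.
by rewrite -mulr_natr mulf_neq0 // natK0.
Qed.

Lemma mup_deriv_ramif p x : (0 < deg p)%N -> mup x p^`() = (ramif p x).-1.
Proof.
move=> dp; rewrite /ramif -mup_deriv ?subC_neq0 ?root_subC //.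
by rewrite derivB derivC subr0.
Qed.

Lemma deg_deriv p : (0 < deg p)%N -> deg p^`() = (deg p).-1.
Proof. by move=> dp; rewrite /deg (size_deriv_char0 char0 dp).1. Qed.

Lemma root_deriv_ramif p x : (0 < deg p)%N -> root p^`() x = (1 < ramif p x)%N.
Proof.
move=> dp; rewrite -mup_gt0 ?deriv_neq0 // mup_deriv_ramif //.
by have := ramif_gt0 x dp; case: (ramif p x) => [|[]].
Qed.

End Mult.

(** * Ramification in a square of compositions *)

Section Fibres.
Variable K : closedFieldType.
Implicit Types (a b c d f g h p q u v w P Q : {poly K}) (x y z : K).
Hypothesis char0 : [pchar K] =i pred0.

(** The norm form of b over d vanishes at (d, b), and so does a(Y) - c(z), of
the same degree in Y; by uniqueness of the relation they are proportional. So
b maps the fibre of d over z to the fibre of a over c(z), with multiplicities. *)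
Lemma fibre_form a b c d z rs : a \Po b = c \Po d ->
  (0 < deg d)%N -> (0 < deg b)%N -> coprime (deg d) (deg b) -> deg a = deg d ->
  d - z%:P = lead_coef d *: \prod_(x <- rs) ('X - x%:P) ->
  a - (c.[z])%:P = lead_coef a *: \prod_(x <- rs) ('X - (b.[x])%:P).
Proof.
move=> e dd db cop da Ers.
have [M [mM sM M0 HM]] := norm_relation b dd.
pose G := a^:P - c%:P.
have G0 : bieval d b G = 0.
  rewrite /bieval /G rmorphB /= map_polyC hornerD hornerN hornerC /= -e.
  rewrite -map_poly_comp /= -[a \Po b]/((a^:P).[b]).
  by rewrite (@eq_map_poly _ _ _ polyC) ?subrr // => x; rewrite /= comp_polyC.
have [Q EQ] := relation_dvd dd db cop mM sM M0 G0.
have sC : (size ((c%:P)%R : {poly {poly K}}) < size (a^:P)%R)%N.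
  rewrite size_map_polyC (leq_ltn_trans (size_polyC_leq1 _)) //.
  by rewrite sizeE_deg da.
have sG : size G = (deg d).+1.
  by rewrite /G size_polyDl ?size_polyN // size_map_polyC sizeE_deg da.
have lG : lead_coef G = (lead_coef a)%:P.
  rewrite /G lead_coefDl ?size_polyN // lead_coef_map_inj //; exact: polyC_inj.
have Q0 : Q != 0 by apply: contra_eq_neq sG => Q0; rewrite EQ Q0 mul0r size_poly0.
have sQ : size Q = 1%N.
  move: sG; rewrite EQ size_Mmonic // sM addnS /= => /eqP.
  by rewrite -[X in _ == X]add1n eqn_add2r => /eqP.
have EQc : Q = (lead_coef a)%:P%:P.
  have /size_poly1P [k k0 Ek] : size Q == 1%N by rewrite sQ.
  by rewrite Ek; congr polyC; move: lG; rewrite EQ lead_coef_Mmonic // Ek lead_coefC.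
have := congr1 (map_poly (horner_eval z)) EQ.
rewrite rmorphM /= EQc map_polyC /= (HM _ _ Ers) /G rmorphB /= map_polyC /= -map_poly_comp.
rewrite map_poly_id; last by move=> x _; rewrite /= /horner_eval hornerC.
by rewrite /horner_eval hornerC mul_polyC.
Qed.

(** The points above the point (y, z) of the curve a(y) = c(z). *)
Definition common_fibre b d y z : seq K :=
  [seq x <- undup (root_seq (d - z%:P)) | b.[x] == y].

Lemma mem_fibre p (k : K) x : (0 < deg p)%N -> (x \in root_seq (p - k%:P)) = (p.[x] == k).
Proof. by move=> dp; rewrite mem_root_seq ?subC_neq0 // root_subC. Qed.

Lemma mem_common_fibre b d y z x : (0 < deg d)%N ->
  (x \in common_fibre b d y z) = (b.[x] == y) && (d.[x] == z).
Proof. by move=> dd; rewrite mem_filter mem_undup mem_fibre. Qed.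

Lemma uniq_common_fibre b d y z : uniq (common_fibre b d y z).
Proof. by rewrite filter_uniq // undup_uniq. Qed.

Section Square.
Variables a b c d : {poly K}.
Hypothesis e : a \Po b = c \Po d.
Hypotheses (da : (0 < deg a)%N) (db : (0 < deg b)%N).
Hypotheses (ead : deg a = deg d) (ebc : deg b = deg c).
Hypothesis cop : coprime (deg a) (deg b).

Let dd : (0 < deg d)%N. Proof. by rewrite -ead. Qed.
Let dc : (0 < deg c)%N. Proof. by rewrite -ebc. Qed.

Lemma sum_common_fibre y z : a.[y] = c.[z] ->
  (\sum_(x <- common_fibre b d y z) ramif d x = ramif a y)%N.
Proof.
move=> ayz; set rs := root_seq (d - z%:P).
have d0 : d - z%:P != 0 by rewrite subC_neq0.
have Ers : d - z%:P = lead_coef d *: \prod_(x <- rs) ('X - x%:P).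
  by rewrite {1}[d - z%:P]root_seqE lead_subC.
have cop' : coprime (deg d) (deg b) by rewrite -ead.
have EA := fibre_form e dd db cop' ead Ers.
have -> : ramif a y = count_mem y (map (fun x => b.[x]) rs).
  rewrite -(mup_fibre ayz) EA mupZ ?lead_coef_eq0 ?deg_neq0 //.
  by rewrite -(mu_prod_XsubC y) big_map.
rewrite count_map.
have -> : (\sum_(x <- common_fibre b d y z) ramif d x =
  \sum_(x <- common_fibre b d y z) count_mem x rs)%N.
  apply: eq_big_seq => x; rewrite mem_common_fibre // => /andP [_ /eqP dx].
  by rewrite -(mup_fibre dx) mup_root_seq.
rewrite sum_count_mem ?uniq_common_fibre //; apply: eq_in_count => x xin.
by rewrite /= mem_filter mem_undup xin andbT.
Qed.

Lemma ramif_square x : (ramif a b.[x] * ramif b x = ramif c d.[x] * ramif d x)%N.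
Proof. by rewrite -!ramif_comp // e. Qed.

(** Let e, f be the indices at y and z. At a point above (y, z) the index of d
is a multiple of e / gcd(e, f), because e times the index of b is f times the
index of d; and these indices sum to e. *)
Lemma size_common_fibre y z : a.[y] = c.[z] ->
  (size (common_fibre b d y z) <= gcdn (ramif a y) (ramif c z))%N.
Proof.
move=> ayz; set S := common_fibre b d y z.
set g := gcdn (ramif a y) (ramif c z).
(* k is the least possible index of d at a point above (y, z) *)
have g0 : (0 < g)%N by rewrite gcdn_gt0 ramif_gt0.
have [k Ek] : exists k, ramif a y = (k * g)%N by apply/dvdnP; apply: dvdn_gcdl.
have k0 : (0 < k)%N by have := ramif_gt0 y da; rewrite Ek muln_gt0 => /andP [].
have [l El] : exists l, ramif c z = (l * g)%N by apply/dvdnP; apply: dvdn_gcdr.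
have cop' : coprime k l.
  have : gcdn (k * g) (l * g) = g by rewrite -Ek -El.
  by rewrite -muln_gcdl => /eqP; rewrite -[X in _ == X]mul1n eqn_pmul2r.
have kS x : x \in S -> (k <= ramif d x)%N.
  rewrite mem_common_fibre // => /andP [/eqP bx /eqP dx].
  apply: dvdn_leq; first exact: ramif_gt0.
  have := ramif_square x; rewrite bx dx Ek El.
  rewrite -!mulnA ![(g * _)%N]mulnC !mulnA => /eqP; rewrite eqn_pmul2r // => /eqP h.
  have : (k %| l * ramif d x)%N by rewrite -h dvdn_mulr.
  by rewrite Gauss_dvdr.
have : (\sum_(x <- S) k <= k * g)%N.
  rewrite mulnC [(g * k)%N]mulnC -Ek -(sum_common_fibre ayz).
  by rewrite big_seq [X in (_ <= X)%N]big_seq; apply: leq_sum.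
by rewrite big_const_seq count_predT iter_addn_0 leq_pmul2l.
Qed.

(** The contribution of the points above y to the ramification of d;
sum_excess bounds the total by the degree of the derivative of d. *)
Definition excess y : nat := (\sum_(x <- undup (root_seq (b - y%:P))) (ramif d x).-1)%N.
Let zs y := undup (root_seq (c - (a.[y])%:P)).

Lemma excessE y :
  excess y = (\sum_(z <- zs y) (ramif a y - size (common_fibre b d y z)))%N.
Proof.
have memz z : (z \in zs y) = (c.[z] == a.[y]) by rewrite mem_undup mem_fibre.
have Ez z : z \in zs y ->
   (ramif a y - size (common_fibre b d y z) = \sum_(x <- undup (root_seq (b - y%:P)) | d.[x] == z) (ramif d x).-1)%N.
  rewrite memz => /eqP cz.
  rewrite -big_filter (perm_big (common_fibre b d y z)) /=; last first.
    apply: uniq_perm; rewrite ?filter_uniq ?undup_uniq //.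
    move=> x; rewrite mem_common_fibre // mem_filter mem_undup mem_fibre //.
    by rewrite andbC.
  rewrite -(sum_common_fibre (esym cz)) -sum1_size.
  apply/eqP; rewrite -(eqn_add2r (\sum_(x <- common_fibre b d y z) 1)%N) subnK.
    rewrite -big_split /=; apply/eqP; apply: eq_bigr => x _.
    by rewrite addn1 prednK // ramif_gt0.
  by apply: leq_sum => x _; apply: ramif_gt0.
rewrite (eq_big_seq _ Ez) (exchange_big_dep xpredT) //= /excess; apply: eq_big_seq => x.
rewrite mem_undup mem_fibre // => /eqP bx.
have dxin : d.[x] \in zs y by rewrite memz -horner_comp -e horner_comp bx.
rewrite big_mkcond (bigD1_seq d.[x]) ?undup_uniq //= eqxx big1 ?addn0 // => z nz.
by rewrite eq_sym (negPf nz).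
Qed.

Lemma sum_excess : (\sum_(y <- undup (root_seq a^`())) excess y <= (deg a).-1)%N.
Proof.
rewrite /excess -(big_map (fun y => undup (root_seq (b - y%:P))) xpredT
  (fun s => \sum_(x <- s) (ramif d x).-1)%N) -big_flatten /=.
set ts := flatten _.
have uts : uniq ts.
  rewrite /ts; have := undup_uniq (root_seq a^`()).
  elim: (undup _) => //= y ys IH /andP [ny /IH u].
  rewrite cat_uniq undup_uniq u andbT /=; apply/hasPn => x /flattenP [s /mapP [y' y'in ->]].
  rewrite mem_undup mem_fibre // => /eqP bx; apply/negP.
  by rewrite mem_undup mem_fibre // bx => /eqP Ey; rewrite -Ey y'in in ny.
under eq_bigr do rewrite -(mup_deriv_ramif char0) //.
by rewrite ead -(deg_deriv char0) // sum_mup_leq // deriv_neq0.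
Qed.

Lemma sum_crit : (\sum_(y <- undup (root_seq a^`())) (ramif a y).-1 = (deg a).-1)%N.
Proof.
under eq_bigr do rewrite -(mup_deriv_ramif char0) //.
rewrite -(deg_deriv char0) // sum_mup_eq ?undup_uniq ?deriv_neq0 // => y ry.
by rewrite mem_undup mem_root_seq // deriv_neq0.
Qed.

Hypothesis nc : forall (k : K) (g : nat), (1 < g)%N -> exists2 z, c.[z] = k & ~~ (g %| ramif c z)%N.

(** Let m be the index of a at y. Points z whose index is not a multiple of m
contribute at least m / 2 each, so two of them exceed m - 1. The hypothesis nc
excludes that there is none, and if there is exactly one, it forces its index
to be prime to m. *)
Lemma excess_geq y : (1 < ramif a y)%N ->
  ((ramif a y).-1 <= excess y)%N /\
  (excess y = (ramif a y).-1 -> exists z0, [/\ c.[z0] = a.[y], coprime (ramif a y) (ramif c z0)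
     & forall z, c.[z] = a.[y] -> z != z0 -> (ramif a y %| ramif c z)%N]).
Proof.
move=> e1; set m := ramif a y in e1 *.
have memz z : (z \in zs y) = (c.[z] == a.[y]) by rewrite mem_undup mem_fibre.
have uz : uniq (zs y) by apply: undup_uniq.
pose bad := [seq z <- zs y | ~~ (m %| ramif c z)%N].
have ubad : uniq bad by apply: filter_uniq.
have Hbad z : (z \in bad) = (c.[z] == a.[y]) && ~~ (m %| ramif c z)%N.
  by rewrite mem_filter memz andbC.
have le_ex : (\sum_(z <- bad) (m - size (common_fibre b d y z)) <= excess y)%N.
  rewrite excessE -/m /bad big_filter.
  by rewrite [X in (_ <= X)%N](bigID (fun z => ~~ (m %| ramif c z)%N)) /= leq_addr.
have Sle z : z \in bad -> (size (common_fibre b d y z) <= gcdn m (ramif c z))%N.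
  by rewrite Hbad => /andP [/eqP cz _]; apply: size_common_fibre.
case Eb : bad => [|z1 [|z2 bs]].
- have [z cz nz] := nc a.[y] e1.
  by have := Hbad z; rewrite Eb cz eqxx nz.
- have zin : z1 \in bad by rewrite Eb mem_head.
  have cz : c.[z1] = a.[y] by move: zin; rewrite Hbad => /andP [/eqP].
  have dvz z : c.[z] = a.[y] -> z != z1 -> (m %| ramif c z)%N.
    move=> cz' zz1; apply/negPn/negP => nz.
    have : z \in bad by rewrite Hbad cz' eqxx.
    by rewrite Eb inE (negPf zz1).
  have g1 : gcdn m (ramif c z1) = 1%N.
    apply/eqP; rewrite eqn_leq gcdn_gt0 (ltnW e1) andbT leqNgt; apply/negP => g1.
    have [z cz' /negP] := nc a.[y] g1; apply.
    have [->|zz1] := eqVneq z z1; first exact: dvdn_gcdr.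
    exact: dvdn_trans (dvdn_gcdl _ _) (dvz _ cz' zz1).
  split; last by move=> _; exists z1; split=> //; rewrite /coprime g1.
  apply: leq_trans le_ex; rewrite Eb big_seq1.
  by have := Sle _ zin; rewrite g1; lia.
have half z : z \in bad -> (2 * size (common_fibre b d y z) <= m)%N.
  move=> zin.
  have [k Ek] : exists k, m = (k * gcdn m (ramif c z))%N by apply/dvdnP; apply: dvdn_gcdl.
  have k1 : (1 < k)%N.
    have nz : ~~ (m %| ramif c z)%N by move: zin; rewrite Hbad => /andP [].
    rewrite ltnNge; apply: contra nz => k1.
    have Ek1 : k = 1%N.
      by apply/eqP; rewrite eqn_leq k1 /= lt0n; apply: contraTneq e1 => k0; rewrite Ek k0.
    by rewrite Ek Ek1 mul1n dvdn_gcdr.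
  rewrite [X in (_ <= X)%N]Ek; apply: leq_mul k1 (Sle _ zin).
have big : (m <= excess y)%N.
  apply: leq_trans le_ex; rewrite Eb !big_cons addnA.
  apply: leq_trans (leq_addr _ _).
  have z1in : z1 \in bad by rewrite Eb mem_head.
  have z2in : z2 \in bad by rewrite Eb !inE eqxx orbT.
  by have := half z1 z1in; have := half z2 z2in; lia.
split; first by lia.
by move=> E; move: big; rewrite E -ltnS prednK ?ltnn // ltnW.
Qed.

(** The excesses over the critical points of a sum to at most deg a - 1, while
the lower bounds of excess_geq sum to exactly deg a - 1. So equality holds
everywhere. *)
Theorem ramification y : (1 < ramif a y)%N ->
  exists z0, [/\ c.[z0] = a.[y], coprime (ramif a y) (ramif c z0)
     & forall z, c.[z] = a.[y] -> z != z0 -> (ramif a y %| ramif c z)%N].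
Proof.
move=> e1; have [ge] := excess_geq e1; apply.
have yin : y \in undup (root_seq a^`()).
  by rewrite mem_undup mem_root_seq ?deriv_neq0 // root_deriv_ramif.
apply/eqP; rewrite eqn_leq ge andbT leqNgt; apply/negP => lt.
have := sum_excess; rewrite -sum_crit leqNgt => /negP; apply.
rewrite (bigD1_seq y) ?undup_uniq //= [X in (_ < X)%N](bigD1_seq y) ?undup_uniq //=.
rewrite -addSn leq_add // big_seq_cond [X in (_ <= X)%N]big_seq_cond.
apply: leq_sum => x /andP []; rewrite mem_undup mem_root_seq ?deriv_neq0 // root_deriv_ramif //.
by move=> x1 _; have [] := excess_geq x1.
Qed.

End Square.
End Fibres.

(** * Cyclic polynomials *)

Section Cyclic.
Variable K : closedFieldType.
Implicit Types (a b c d f h p q u v w P Q G : {poly K}) (x y z : K).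
Hypothesis char0 : [pchar K] =i pred0.

(** Up to units, a power of prime exponent. *)
Definition cyclic p : Prop := exists l (m : nat) x0,
  [/\ compunit l, prime m & p = l \Po ('X^m \Po ('X - x0%:P))].

Lemma deg_Xn m : deg ('X^m : {poly K}) = m.
Proof. by rewrite /deg size_polyXn. Qed.

Lemma irred_prime_Xn m : (1 < m)%N -> irred ('X^m : {poly K}) -> prime m.
Proof.
move=> m1 [_ ni]; apply/primeP; split=> // k /dvdnP [l El].
apply/orP; have [->|k1] := eqVneq k 1%N; first by left.
right; have [l1|l1] := eqVneq l 1%N; first by rewrite El l1 mul1n.
case: ni; exists 'X^l, 'X^k; rewrite !deg_Xn; split.
- by move: m1 l1; rewrite El; case: (l) => [|[]].
- by move: m1 k1; rewrite El; case: (k) => [|[]] //; rewrite muln0.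
by rewrite comp_Xn_poly -exprM El mulnC.
Qed.

(** Here c = (x^g + k) o G, so G has degree 1. *)
Lemma irred_power_cyclic c (k : K) G (g : nat) : irred c -> (1 < g)%N ->
  c - k%:P = G ^+ g -> cyclic c.
Proof.
move=> ic g1 E; have Ec : c = ('X^g + k%:P) \Po G.
  by rewrite comp_polyD comp_Xn_poly comp_polyC -E subrK.
have dXk : deg ('X^g + k%:P) = g by rewrite -[k]opprK polyCN deg_subC deg_Xn.
have [|cG] := irred_comp ic Ec; first by rewrite /compunit dXk => g1'; rewrite g1' in g1.
have [GE G1] := compunitE cG; set r := G`_1 in GE G1; set s := G`_0 in GE.
have ul : compunit (r ^+ g *: 'X + k%:P) by apply: unit_lin; rewrite expf_neq0.
have EG : G = r *: ('X - (- s / r)%:P).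
  by rewrite scalerBr -[X in _ - X]mul_polyC -polyCM mulrC divfK // polyCN opprK -GE.
have Ecl : c = (r ^+ g *: 'X + k%:P) \Po ('X^g \Po ('X - (- s / r)%:P)).
  rewrite Ec comp_polyD comp_Xn_poly comp_polyC comp_polyD comp_polyZ comp_polyX comp_polyC.
  by rewrite comp_Xn_poly {1}EG exprZn.
exists (r ^+ g *: 'X + k%:P), g, (- s / r); split=> //.
apply: irred_prime_Xn => //.
rewrite Ecl in ic.
have := irred_unit_l ic (unit_inv ul); rewrite compVK // => h.
have := irred_unit_r h (unit_inv (unit_XsubC (- s / r))).
by rewrite compKVr //; apply: unit_XsubC.
Qed.

Lemma noncyclic_fibre c : irred c -> ~ cyclic c ->
  forall (k : K) (g : nat), (1 < g)%N -> exists2 z, c.[z] = k & ~~ (g %| ramif c z)%N.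
Proof.
move=> ic nc k g g1; apply: NNPP => H; apply: nc.
have dc : (0 < deg c)%N by case: ic => /ltnW.
have [G EG] : exists G, c - k%:P = G ^+ g.
  apply: perfect_power; rewrite ?subC_neq0 ?(ltnW g1) // => z.
  have [/eqP cz|nz] := boolP (c.[z] == k).
    by rewrite (mup_fibre cz); apply/negPn/negP => h; apply: H; exists z.
  by rewrite mupNroot ?dvdn0 // root_subC.
exact: irred_power_cyclic ic g1 EG.
Qed.

(** In P^n - Q^n = (P - Q) (P^(n-1) + .. + Q^(n-1)) the second factor has
leading coefficient n times a nonzero element. *)
Lemma eq_pow_lead P Q n : (0 < n)%N -> P != 0 -> lead_coef P = lead_coef Q ->
  P ^+ n = Q ^+ n -> P = Q.
Proof.
move=> n0 P0 lPQ e; apply/eqP; rewrite -subr_eq0.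
have Q0 : Q != 0 by rewrite -lead_coef_eq0 -lPQ lead_coef_eq0.
have sPQ : deg P = deg Q.
  by apply/eqP; rewrite -(eqn_pmul2r n0) -!degX e.
have := subrXX P Q n; rewrite e subrr => /esym/eqP; rewrite mulf_eq0 => /orP [//|/eqP s0].
have := congr1 (fun r : {poly K} => r`_(deg P * n.-1)) s0.
rewrite coef0 coef_sum.
have -> : \sum_(i < n) (P ^+ (n.-1 - i) * Q ^+ i)`_(deg P * n.-1) =
   \sum_(i < n) lead_coef P ^+ n.-1.
  apply: eq_bigr => i _.
  have Ei : (n.-1 - i + i = n.-1)%N by rewrite subnK // -ltnS prednK.
  have -> : (deg P * n.-1 = deg (P ^+ (n.-1 - i) * Q ^+ i))%N.
    by rewrite degM ?expf_neq0 // !degX -sPQ -mulnDr Ei.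
  by rewrite -lead_coefE lead_coefM !lead_coef_exp -lPQ -exprD Ei.
rewrite sumr_const card_ord => /eqP; rewrite -mulr_natl mulf_eq0 (negPf (natK0 char0 n0)) /=.
by rewrite expf_eq0 lead_coef_eq0 (negPf P0) andbF.
Qed.

(** Only one point in the fibre, hence a power of a linear polynomial. *)
Lemma total_ramif d x : ramif d x = deg d -> (0 < deg d)%N ->
  d - (d.[x])%:P = lead_coef d *: ('X - x%:P) ^+ deg d.
Proof.
move=> e dd; have d0 := subC_neq0 d.[x] dd.
have : ('X - x%:P) ^+ deg d %| d - (d.[x])%:P by rewrite -mup_geq // -/(ramif d x) e.
move=> /dvdpP [s Es].
have s0 : s != 0 by apply: contraNneq d0 => z; rewrite Es z mul0r.
have : deg (d - (d.[x])%:P) = (deg s + deg d)%N.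
  by rewrite Es degM ?expf_neq0 ?polyXsubC_eq0 // degX /(deg ('X - _)) size_XsubC mul1n.
rewrite deg_subC -[X in X = _]add0n => /eqP; rewrite eqn_add2r => /eqP /esym /deg0_const Ec.
rewrite Es Ec mul_polyC; congr (_ *: _).
have := congr1 lead_coef Es; rewrite lead_subC // lead_coefM lead_coef_exp.
rewrite lead_coefXsubC expr1n mulr1 => ->.
by rewrite [in RHS]Ec lead_coefC.
Qed.

(** With D = b - x0 and C = l^-1 o c one has D^m = C o d. Where C has a root z
of multiplicity prime to m, the polynomial d is totally ramified, as m is
prime and deg d = m. There is such a z since m does not divide deg C, and only
one since d cannot be totally ramified at two points. So d and C have the
required shapes, and extracting m-th roots gives b. *)
Theorem cyclic_square a b c d l m x0 : compunit l -> prime m ->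
  a = l \Po ('X^m \Po ('X - x0%:P)) -> a \Po b = c \Po d ->
  deg d = m -> (0 < deg c)%N -> coprime m (deg c) ->
  exists e (g nu : {poly K}) z0, [/\ g.[0] <> 0, compunit nu,
    b = ('X + x0%:P) \Po (xg_subst e g m \Po nu),
    c = l \Po (xg_pow e g m \Po ('X - z0%:P)) &
    d = ('X + z0%:P) \Po ('X^m \Po nu)].
Proof.
move=> cl pm Ea E dm dc cop; have m1 := prime_gt1 pm; have m0 := ltnW m1.
have dd : (0 < deg d)%N by rewrite dm.
pose D := b - x0%:P; pose C := compinv l \Po c.
have dC : deg C = deg c by rewrite deg_unit_l //; apply: unit_inv.
have C0 : C != 0 by rewrite deg_neq0 // dC.
have ED : D ^+ m = C \Po d.
  rewrite /C -comp_polyA -E Ea -comp_polyA compVK // -comp_polyA comp_Xn_poly.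
  by rewrite comp_polyB comp_polyX comp_polyC.
have D0 : D != 0.
  apply/eqP => z; move: ED; rewrite z expr0n (gtn_eqF m0) => /esym/eqP.
  by rewrite comp_poly_eq0 ?(negPf C0) // -deg_gt0.
have full x : ~~ (m %| mup d.[x] C)%N -> ramif d x = m.
  move=> nd; have : (m %| mup d.[x] C * ramif d x)%N.
    by rewrite -mup_comp // -ED mup_exp // dvdn_mulr.
  rewrite Euclid_dvdM // (negPf nd) /= => /dvdn_leq; rewrite ramif_gt0 // => /(_ isT) le.
  apply/eqP; rewrite eqn_leq le andbT -dm -(deg_subC d d.[x]).
  have := @sum_mup_leq _ (d - (d.[x])%:P) [:: x] (subC_neq0 _ dd) isT.
  by rewrite big_seq1.
have surj z : exists x, d.[x] = z.
  have /closed_rootP [x] : size (d - z%:P) != 1%N.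
    by rewrite sizeE ?subC_neq0 // deg_subC dm; case: (m) m0.
  by rewrite root_subC => /eqP; exists x.
have [x1 nd1] : exists x1, ~~ (m %| mup d.[x1] C)%N.
  apply: NNPP => H; have [G EG] : exists G, C = G ^+ m.
    apply: perfect_power => // z; have [x <-] := surj z.
    by apply/negPn/negP => h; apply: H; exists x.
  have : (m %| deg c)%N by rewrite -dC EG degX dvdn_mull.
  by move=> h; move: cop; rewrite prime_coprime // h.
set z0 := d.[x1] in nd1.
have mu1 := full _ nd1.
have oth z : z != z0 -> (m %| mup z C)%N.
  move=> zz0; apply/negPn/negP; have [x2 Ex2] := surj z; rewrite -Ex2 => /full mu2.
  have x12 : x1 != x2 by apply: contraNneq zz0 => h; rewrite -Ex2 -h.
  have := @sum_mup_leq _ d^`() [:: x1; x2] (deriv_neq0 char0 dd).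
  rewrite /= inE x12 => /(_ isT); rewrite big_cons big_seq1 !(mup_deriv_ramif char0) // mu1 mu2.
  by rewrite deg_deriv // dm; move: m1; clear; lia.
have [G [EC Gz0]] := power_form m0 C0 oth.
set s := mup z0 C in EC.
pose g := G \Po ('X + z0%:P).
have XX k : ('X - k%:P) \Po ('X + k%:P) = 'X :> {poly K}.
  by rewrite comp_polyB comp_polyX comp_polyC addrK.
have XX' k : ('X + k%:P) \Po ('X - k%:P) = 'X :> {poly K}.
  by rewrite comp_polyD comp_polyX comp_polyC subrK.
have ECg : C = xg_pow s g m \Po ('X - z0%:P).
  rewrite /xg_pow comp_polyM comp_Xn_poly comp_poly_exp /g -comp_polyA XX' comp_polyXr.
  exact: EC.
have lcd : lead_coef d != 0 by rewrite lead_coef_eq0 deg_neq0.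
have [r Er] := nth_root_exists (lead_coef d) m0.
have r0 : r != 0 by apply: contraNneq lcd => z; rewrite -Er z expr0n (gtn_eqF m0).
pose nu := r *: ('X - x1%:P).
have cnu : compunit nu.
  rewrite /nu scalerBr -[X in _ - X]mul_polyC -polyCM -polyCN.
  exact: unit_lin.
have Ed : d = ('X + z0%:P) \Po ('X^m \Po nu).
  rewrite comp_polyD comp_polyX comp_polyC comp_Xn_poly /nu exprZn Er -dm.
  by rewrite -total_ramif ?subrK // mu1 dm.
pose E0 := xg_subst s g m \Po nu.
have EE : D ^+ m = E0 ^+ m.
  rewrite ED ECg -comp_polyA Ed.
  rewrite [('X - _) \Po _]comp_polyA XX comp_polyX comp_polyA /E0 -comp_poly_exp.
  congr (_ \Po _); rewrite /xg_pow /xg_subst comp_polyM comp_Xn_poly comp_poly_exp.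
  by rewrite exprMn -!exprM mulnC.
have E00 : E0 != 0.
  apply: contraNneq D0 => z; have : D ^+ m == 0 by rewrite EE z expr0n (gtn_eqF m0).
  by rewrite expf_eq0 m0.
have l0 : lead_coef E0 != 0 by rewrite lead_coef_eq0.
(* D and E0 differ by an m-th root of unity, which is absorbed in g *)
pose k := lead_coef D / lead_coef E0.
have km : k ^+ m = 1.
  by rewrite /k expr_div_n -!lead_coef_exp EE divff // lead_coef_exp expf_neq0.
have EDk : D = k *: E0.
  apply: (eq_pow_lead m0 D0); first by rewrite lead_coefZ /k divfK.
  by rewrite exprZn km scale1r.
have k0 : k != 0.
  by apply/eqP => z; move: km; rewrite z expr0n (gtn_eqF m0) => /esym/eqP; rewrite oner_eq0.
exists s, (k *: g), nu, z0; split=> //.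
- rewrite hornerZ /g horner_comp hornerD hornerX hornerC add0r.
  by apply/eqP; rewrite mulf_neq0.
- rewrite comp_polyD comp_polyX comp_polyC /xg_subst comp_polyZ -scalerAr comp_polyZ.
  by rewrite -/(xg_subst s g m) -/E0 -EDk subrK.
by rewrite /xg_pow exprZn km scale1r -/(xg_pow s g m) -ECg /C compKV.
Qed.

End Cyclic.

(** * Fibres of non-cyclic squares *)

Section Comb.
Variable K : closedFieldType.
Implicit Types (a b c d f h p q u v w P Q : {poly K}) (x y z : K).
Hypothesis char0 : [pchar K] =i pred0.

(** The conclusion of the theorem ramification, as a relation between the
fibres of a and c. *)
Definition ramif_dvd a c : Prop := forall y, (1 < ramif a y)%N ->
  exists z0, [/\ c.[z0] = a.[y], coprime (ramif a y) (ramif c z0)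
     & forall z, c.[z] = a.[y] -> z != z0 -> (ramif a y %| ramif c z)%N].

Definition nontriv_fibres a : Prop := forall y, exists2 y', a.[y'] = a.[y] & y' != y.

Lemma noncyclic_nontriv a : irred a -> ~ cyclic a -> nontriv_fibres a.
Proof.
move=> ia nc y; apply: NNPP => H; have [da _] := ia.
have [z az] := noncyclic_fibre ia nc a.[y] da.
have uniqy z' : a.[z'] = a.[y] -> z' = y.
  by move=> az'; apply/eqP/negPn/negP => h; apply: H; exists z'.
rewrite (uniqy _ az); have := @sum_mup_eq _ (a - (a.[y])%:P) [:: y].
rewrite subC_neq0 ?(ltnW da) // big_seq1 deg_subC -/(ramif a y) => -> //.
  by rewrite dvdnn.
by move=> x; rewrite root_subC => /eqP /uniqy ->; rewrite mem_head.
Qed.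

(** Applying the divisibility in both directions turns it into an equality of
indices. *)
Lemma ramif_eq a c y : (0 < deg a)%N -> (0 < deg c)%N ->
  ramif_dvd a c -> ramif_dvd c a -> (1 < ramif a y)%N ->
  exists z0, [/\ c.[z0] = a.[y], coprime (ramif a y) (ramif c z0)
     & forall z, c.[z] = a.[y] -> z != z0 -> ramif c z = ramif a y].
Proof.
move=> da dc RA RC e1; have [z0 [cz0 cop dv]] := RA _ e1.
exists z0; split=> // z cz zz0.
have dvz := dv _ cz zz0.
have f1 : (1 < ramif c z)%N by apply: leq_trans e1 (dvdn_leq (ramif_gt0 _ dc) dvz).
have [y0 [ay0 cop' dv']] := RC _ f1.
have [yy0|yy0] := eqVneq y y0.
  move: cop'; rewrite -yy0 => /(coprime_dvdl dvz).
  by rewrite /coprime gcdnn => /eqP e1'; rewrite e1' in e1.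
by apply/eqP; rewrite eqn_dvd dvz dv' // cz.
Qed.

Lemma fibre2_deg a y y' : (0 < deg a)%N -> a.[y'] = a.[y] -> y' != y ->
  (forall x, a.[x] = a.[y] -> x = y \/ x = y') -> deg a = (ramif a y + ramif a y')%N.
Proof.
move=> da ay' ny H.
have := @sum_mup_eq _ (a - (a.[y])%:P) [:: y; y'] (subC_neq0 _ da).
rewrite big_cons big_seq1 deg_subC /= inE eq_sym ny (mup_fibre ay') => <- //.
move=> x; rewrite root_subC => /eqP /H [] ->; by rewrite !inE eqxx ?orbT.
Qed.

Section Pair.
Variables a c : {poly K}.
Hypotheses (da : (0 < deg a)%N) (dc : (0 < deg c)%N) (dac : deg a <> deg c).
Hypotheses (RA : ramif_dvd a c) (RC : ramif_dvd c a).
Hypotheses (nA : nontriv_fibres a) (nC : nontriv_fibres c).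

(** Otherwise the exceptional points of both fibres are ramified with the
other's index, so both fibres consist of two points with the same pair of
indices, and deg a = deg c. *)
Lemma exceptional_unramified y1 z0 : (1 < ramif a y1)%N ->
  c.[z0] = a.[y1] -> coprime (ramif a y1) (ramif c z0) ->
  (forall z, c.[z] = a.[y1] -> z != z0 -> ramif c z = ramif a y1) -> ramif c z0 = 1%N.
Proof.
move=> e1 cz0 cop oth; apply/eqP; rewrite eqn_leq ramif_gt0 // andbT leqNgt.
apply/negP => f1.
have nef : ramif a y1 <> ramif c z0.
  by move=> E; move: cop; rewrite E /coprime gcdnn => /eqP E1; rewrite E1 in f1.
have [z1 cz1 z10] := nC z0; rewrite cz0 in cz1.
have mz1 := oth _ cz1 z10.
have [y0'' [ay0'' _ oth'']] := ramif_eq dc da RC RA f1; rewrite cz0 in ay0'' oth''.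
have f1' : (1 < ramif c z1)%N by rewrite mz1.
have [y0 [ay0 _ oth']] := ramif_eq dc da RC RA f1'; rewrite cz1 mz1 in ay0 oth'.
have fib y : a.[y] = a.[y1] -> y = y0 \/ y = y0''.
  move=> ay; have [->|n1] := eqVneq y y0; first by left.
  have [->|n2] := eqVneq y y0''; first by right.
  by case: nef; rewrite -(oth' _ ay n1) -(oth'' _ ay n2).
have n0 : y0'' != y0.
  apply/eqP => E; have [y' ay' ny'] := nA y0; rewrite ay0 in ay'.
  by case: (fib _ ay') => E'; move: ny'; rewrite E' ?E eqxx.
have m0 : ramif a y0 = ramif c z0 by apply: oth'' => //; rewrite eq_sym.
have m0'' : ramif a y0'' = ramif a y1 by apply: oth'.
have Ea : deg a = (ramif c z0 + ramif a y1)%N.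
  rewrite -m0 -m0''; apply: fibre2_deg => //; first by rewrite ay0'' ay0.
  by move=> x; rewrite ay0 => /fib.
have e0 : (1 < ramif a y0)%N by rewrite m0.
have [z0' [cz0' _ othz]] := ramif_eq da dc RA RC e0; rewrite ay0 m0 in cz0' othz.
have Ez1 : z1 = z0'.
  by apply/eqP/negPn/negP => h; case: nef; rewrite -mz1; apply: othz.
apply: dac; rewrite Ea -mz1; symmetry; apply: fibre2_deg => //; first by rewrite cz1 cz0.
move=> x; rewrite cz0 => cx; have [->|n1] := eqVneq x z0; first by left.
have [->|n2] := eqVneq x z1; first by right.
by case: nef; rewrite -(oth _ cx n1); apply: othz; rewrite // -Ez1.
Qed.

End Pair.

Definition fibre_type a (k : K) (e : nat) y0 : Prop :=
  [/\ a.[y0] = k, ramif a y0 = 1%N & forall y, a.[y] = k -> y != y0 -> ramif a y = e].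

Lemma fibre_types a c y1 : (0 < deg a)%N -> (0 < deg c)%N -> deg a <> deg c ->
  ramif_dvd a c -> ramif_dvd c a -> nontriv_fibres a -> nontriv_fibres c ->
  (1 < ramif a y1)%N ->
  exists y0 z0, fibre_type a a.[y1] (ramif a y1) y0 /\ fibre_type c a.[y1] (ramif a y1) z0.
Proof.
move=> da dc dac RA RC nA nC e1.
have [z0 [cz0 cop oth]] := ramif_eq da dc RA RC e1.
have mz0 := exceptional_unramified da dc dac RA RC nA nC e1 cz0 cop oth.
have [z1 cz1 z10] := nC z0; rewrite cz0 in cz1.
have mz1 := oth _ cz1 z10.
have f1 : (1 < ramif c z1)%N by rewrite mz1.
have [y0 [ay0 cop' oth']] := ramif_eq dc da RC RA f1.
have my0 := exceptional_unramified dc da (fun E => dac (esym E)) RC RA nC nA f1 ay0 cop' oth'.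
rewrite cz1 mz1 in ay0 oth'.
by exists y0, z0.
Qed.

Lemma fibre_count a k e y0 : (0 < deg a)%N -> fibre_type a k e y0 ->
  exists n, deg a = (1 + e * n)%N /\
    (\sum_(y <- undup (root_seq (a - k%:P))) mup y a^`() = e.-1 * n)%N.
Proof.
move=> da [ay0 my0 oth]; set ts := undup _.
have memt y : (y \in ts) = (a.[y] == k) by rewrite mem_undup mem_fibre.
have ut : uniq ts by apply: undup_uniq.
have y0in : y0 \in ts by rewrite memt ay0.
exists (size (rem y0 ts)).
have E (F : nat -> nat) : (\sum_(y <- rem y0 ts) F (ramif a y) = F e * size (rem y0 ts))%N.
  rewrite -sum1_size big_distrr /=; apply: eq_big_seq => y.
  by rewrite mem_rem_uniq // inE memt => /andP [ny /eqP ay]; rewrite oth // muln1.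
split.
  have <- : (\sum_(y <- ts) ramif a y = 1 + e * size (rem y0 ts))%N.
    by rewrite (big_rem y0) //= my0 (E id).
  rewrite -(deg_subC a k) -(@sum_mup_eq _ (a - k%:P) ts) ?subC_neq0 //.
    by apply: eq_big_seq => y; rewrite memt => /eqP /mup_fibre ->.
  by move=> y; rewrite root_subC memt.
under eq_bigr do rewrite (mup_deriv_ramif char0) //.
by rewrite (big_rem y0) //= my0 add0n (E predn).
Qed.

(** By fibre_types, over a critical value the fibre has n points of index e
and one of index 1, with e * n = deg a - 1, and takes (e - 1) * n of the deg a
- 1 critical points. One critical value is not enough, and two of them are
possible only if e = 2 for both. *)
Theorem dihedral_fibres a c : (1 < deg a)%N -> (1 < deg c)%N -> deg a <> deg c ->
  ramif_dvd a c -> ramif_dvd c a -> nontriv_fibres a -> nontriv_fibres c ->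
  exists k1 k2, k1 != k2 /\
   forall k, k \in [:: k1; k2] -> exists y0 z0, fibre_type a k 2 y0 /\ fibre_type c k 2 z0.
Proof.
move=> da dc dac RA RC nA nC; have da0 := ltnW da; have dc0 := ltnW dc.
have ft y1 := fibre_types (y1 := y1) da0 dc0 dac RA RC nA nC.
have a'0 := deriv_neq0 char0 da0.
have [y1 e1] : exists y1, (1 < ramif a y1)%N.
  have /closed_rootP [y1] : size a^`() != 1%N.
    by rewrite (size_deriv_char0 char0 da0).1 gtn_eqF.
  by rewrite root_deriv_ramif //; exists y1.
have [y0 [z0 [fa fc]]] := ft _ e1.
have [n1 [En1 S1]] := fibre_count da0 fa.
have [y2 [e2 ny]] : exists y2, (1 < ramif a y2)%N /\ a.[y2] != a.[y1].
  apply: NNPP => H.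
  have : (\sum_(y <- undup (root_seq (a - (a.[y1])%:P))) mup y a^`() = deg a^`())%N.
    apply: sum_mup_eq => //; first exact: undup_uniq.
    move=> x rx; rewrite mem_undup mem_fibre //; apply/negPn/negP => h.
    by apply: H; exists x; rewrite -root_deriv_ramif.
  rewrite S1 deg_deriv // En1; have : (1 + ramif a y1 * n1 > 1)%N by rewrite -En1.
  move: e1; clear; case: (ramif a y1) => // e _; rewrite add1n /= mulSn; lia.
have [y0' [z0' [fa' fc']]] := ft _ e2.
have [n2 [En2 S2]] := fibre_count da0 fa'.
have le : (\sum_(y <- undup (root_seq (a - (a.[y1])%:P)) ++ undup (root_seq (a - (a.[y2])%:P)))
    mup y a^`() <= deg a^`())%N.
  apply: sum_mup_leq => //; rewrite cat_uniq !undup_uniq /= andbT.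
  apply/hasPn => x; rewrite !mem_undup !mem_fibre // => /eqP ->.
  by [].
rewrite big_cat /= S1 S2 deg_deriv // in le.
(* with N = deg a - 1 this is (N - n1) + (N - n2) <= N, and 2 n1, 2 n2 <= N *)
have [E1 E2] : ramif a y1 = 2%N /\ ramif a y2 = 2%N.
  move: le e1 e2 da En1 En2; move: (ramif a y1) (ramif a y2) (deg a); clear.
  move=> e1 e2 m le h1 h2 m1 Em1 Em2; have [n10 n20] : (0 < n1)%N /\ (0 < n2)%N.
    by split; [case: n1 Em1 {le} => // | case: n2 Em2 {le} => //]; rewrite muln0 => E; rewrite E in m1.
  have : (e1 * n1 = m.-1)%N by lia.
  have : (e2 * n2 = m.-1)%N by lia.
  move: le; case: e1 h1 {Em1} => // e1 h1; case: e2 h2 {Em2} => // e2 h2 /=.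
  rewrite !mulSn => le q2 q1.
  have l1 : (n1 <= e1 * n1)%N by rewrite leq_pmull.
  have l2 : (n2 <= e2 * n2)%N by rewrite leq_pmull.
  have r1 : (e1 * n1 = 1 * n1)%N by lia.
  have r2 : (e2 * n2 = 1 * n2)%N by lia.
  by move: r1 r2 => /eqP; rewrite eqn_pmul2r // => /eqP -> /eqP; rewrite eqn_pmul2r // => /eqP ->.
exists a.[y1], a.[y2]; split; first by rewrite eq_sym.
move=> k; rewrite !inE => /orP [] /eqP ->.
  by exists y0, z0; rewrite E1 in fa fc.
by exists y0', z0'; rewrite E2 in fa' fc'.
Qed.

End Comb.

(** * Chebyshev polynomials *)

Section Cheb.
Variable K : closedFieldType.
Implicit Types (a b c d f h p q u v w P Q : {poly K}) (x y z : K).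
Hypothesis char0 : [pchar K] =i pred0.

Notation T := (cheb K).

Lemma chebSS n : T n.+2 = ('X * T n.+1) *+ 2 - T n.
Proof. by []. Qed.

Lemma cheb_ind2 (R : nat -> Prop) : R 0%N -> R 1%N ->
  (forall n, R n -> R n.+1 -> R n.+2) -> forall n, R n.
Proof.
move=> R0 R1 RS n; suff [] : R n /\ R n.+1 by [].
by elim: n => // n [h1 h2]; split=> //; apply: RS.
Qed.

Lemma cheb_at1 n : (T n).[1] = 1.
Proof.
elim/cheb_ind2: n => [||n h1 h2]; rewrite ?hornerC ?hornerX // chebSS.
by rewrite hornerD hornerN hornerMn hornerM hornerX h1 h2 mul1r mulr2n addrK.
Qed.

Lemma cheb_atN1 n : (T n).[-1] = (-1) ^+ n.
Proof.
elim/cheb_ind2: n => [||n h1 h2]; rewrite ?hornerC ?hornerX ?expr1 // chebSS.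
rewrite hornerD hornerN hornerMn hornerM hornerX h1 h2 !exprS; ring.
Qed.

Let two0 : 2%:R != 0 :> K. Proof. exact: natK0. Qed.

Lemma size_cheb n : size (T n) = n.+1.
Proof.
elim/cheb_ind2: n => [||n h1 h2]; rewrite ?size_polyC ?oner_neq0 ?size_polyX // chebSS.
have n0 : T n.+1 != 0 by rewrite -size_poly_eq0 h2.
have s2 : size (('X * T n.+1) *+ 2) = n.+3.
  by rewrite -mulr_natl -polyC_natr mul_polyC size_scale // mulrC size_mulX // h2.
by rewrite size_polyDl ?s2 // size_polyN h1.
Qed.

Lemma deg_cheb n : deg (T n) = n.
Proof. by rewrite /deg size_cheb. Qed.

Lemma cheb_neq0 n : T n != 0.
Proof. by rewrite -size_poly_eq0 size_cheb. Qed.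

(** The identities for sin t * sin(nt) in terms of cosines, proved together by
induction. *)
Lemma cheb_deriv n :
  ('X^2 - 1) * (T n.+1)^`() = ('X * T n.+1 - T n) *+ n.+1 /\
  ('X^2 - 1) * (T n)^`() = (T n.+1 - 'X * T n) *+ n.
Proof.
elim: n => [|n [h1 h2]]; first by rewrite /= derivX -/(1%:P) derivC; split; ring.
split; last by rewrite h1 chebSS; congr (_ *+ _); ring.
rewrite chebSS derivB derivMn derivM derivX.
have -> : ('X^2 - 1) * ((1 * T n.+1 + 'X * (T n.+1)^`()) *+ 2 - (T n)^`()) =
  (('X^2 - 1) * T n.+1) *+ 2 + 'X * (('X^2 - 1) * (T n.+1)^`()) *+ 2 - ('X^2 - 1) * (T n)^`().
  ring.
rewrite h1 h2; move: (T n) (T n.+1) => U V; ring.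
Qed.

Lemma X2sub1_neq0 : ('X^2 - 1 : {poly K}) != 0.
Proof. by rewrite -size_poly_eq0 size_XnsubC. Qed.

(** The differential equation satisfied by T_m. *)
Definition cheb_ode (m : nat) P : Prop :=
  ('X^2 - 1) * P^`()^`() + 'X * P^`() = P *+ m ^ 2.

Lemma cheb_odeP n : cheb_ode n (T n).
Proof.
have [h1 h2] := cheb_deriv n.
apply: (mulfI X2sub1_neq0).
have := congr1 (fun r => ('X^2 - 1) * r^`()) h2.
rewrite /= derivM derivB derivXn derivC subr0 derivMn derivB derivM derivX mul1r.
have -> : ('X^2 - 1) * (((T n.+1)^`() - (T n + 'X * (T n)^`())) *+ n) =
 (('X^2 - 1) * (T n.+1)^`() - ('X^2 - 1) * T n - 'X * (('X^2 - 1) * (T n)^`())) *+ n by ring.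
rewrite h1 => E.
have -> : ('X^2 - 1) * (('X^2 - 1) * (T n)^`()^`() + 'X * (T n)^`()) =
  ('X^2 - 1) * (('X *+ 2) * (T n)^`() + ('X^2 - 1) * (T n)^`()^`()) - 'X * (('X^2 - 1) * (T n)^`()).
  ring.
rewrite expr1 in E; rewrite E h2.
move: (T n) (T n.+1) => U V; ring.
Qed.

(** In degree k the leading coefficient is multiplied by k^2 on the left and
by m^2 on the right, so a nonzero solution has degree m. *)
Lemma ode_small m P : (size P <= m)%N -> cheb_ode m P -> P = 0.
Proof.
move=> sP ode; apply/eqP/negPn/negP => P0.
have := congr1 (fun r : {poly K} => r`_(deg P)) ode.
rewrite mulrBl mul1r coefD coefB coefXnM coefXM coefMn !coef_deriv.
have sPd : size P = (deg P).+1 by apply: sizeE.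
have z j : (deg P < j)%N -> P`_j = 0 by move=> h; rewrite nth_default // sPd.
have lP : P`_(deg P) != 0 by rewrite -lead_coefE lead_coef_eq0.
move=> E.
have {}E : P`_(deg P) *+ deg P ^ 2 = P`_(deg P) *+ m ^ 2.
  rewrite -E; move: z {E}; case: (deg P) => [|[|k]] z; rewrite ?(z _ (leqnSn _)) ?mul0rn.
  - by rewrite /= subr0 addr0.
  - by rewrite /= subr0 add0r exp1n.
  rewrite /= !subn2 /= subr0 -!mulrnA -mulrnDr; congr (_ *+ _); lia.
move: E => /esym/eqP; rewrite -subr_eq0 -mulrnBr; last first.
  by rewrite leq_exp2r //; rewrite sPd in sP; apply: ltnW.
rewrite -mulr_natl mulf_eq0 (negPf lP) orbF; apply/negP; rewrite natK0 //.
by rewrite subn_gt0 ltn_exp2r // -sPd.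
Qed.

Lemma ode_unique m P : size P = m.+1 -> cheb_ode m P -> P.[1] = 1 -> P = T m.
Proof.
move=> sP ode P1; set k := lead_coef (T m); set l := lead_coef P.
have P0 : P != 0 by rewrite -size_poly_eq0 sP.
have k0 : k != 0 by rewrite lead_coef_eq0 cheb_neq0.
have l0 : l != 0 by rewrite lead_coef_eq0.
have D0 : k *: P - l *: T m = 0.
  apply: (@ode_small m).
    rewrite -ltnS; have <- : size (k *: P) = m.+1 by rewrite size_scale.
    apply: size_sub_lead; first by rewrite scaler_eq0 negb_or k0.
      by rewrite !size_scale // sP size_cheb.
    by rewrite !lead_coefZ mulrC.
  have := cheb_odeP m; rewrite /cheb_ode in ode * => odeT.
  rewrite !derivB !derivZ !mulrBr -!scalerAr.
  have -> : k *: (('X^2 - 1) * P^`()^`()) - l *: (('X^2 - 1) * (T m)^`()^`()) +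
     (k *: ('X * P^`()) - l *: ('X * (T m)^`())) =
     k *: (('X^2 - 1) * P^`()^`() + 'X * P^`()) - l *: (('X^2 - 1) * (T m)^`()^`() + 'X * (T m)^`()).
    by rewrite !scalerDr opprD addrACA.
  by rewrite ode odeT mulrnBl !scalerMnr.
have kl : k = l.
  have := congr1 (fun r => r.[1]) D0.
  rewrite hornerD hornerN !hornerZ P1 cheb_at1 !mulr1 horner0 => /eqP.
  by rewrite subr_eq0 => /eqP.
move/eqP: D0; rewrite kl -scalerBr scaler_eq0 (negPf l0) subr_eq0 => /eqP.
by [].
Qed.

(** The affine map with values x at 1 and y at -1, the critical values of the
Chebyshev polynomials. *)
Definition pm_affine x y : {poly K} := ((x - y) / 2%:R) *: 'X + ((x + y) / 2%:R)%:P.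

Lemma unit_pm_affine x y : x != y -> compunit (pm_affine x y).
Proof. by move=> xy; apply: unit_lin; rewrite mulf_neq0 ?invr_eq0 // subr_eq0. Qed.

Lemma pm_affine_at1 x y : (pm_affine x y).[1] = x.
Proof. by rewrite /pm_affine hornerD hornerZ hornerX hornerC; field. Qed.

Lemma pm_affine_atN1 x y : (pm_affine x y).[-1] = y.
Proof. by rewrite /pm_affine hornerD hornerZ hornerX hornerC; field. Qed.

Lemma unit_eq_two_points u v x y : compunit u -> compunit v -> x != y ->
  u.[x] = v.[x] -> u.[y] = v.[y] -> u = v.
Proof.
move=> cu cv xy ex ey; apply/eqP; rewrite -subr_eq0.
apply/eqP; apply: (@roots_geq_poly_eq0 _ _ [:: x; y]).
- by rewrite /= !rootE !hornerE ex ey !subrr eqxx.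
- by rewrite /= inE xy.
apply: leq_trans (size_polyD _ _) _; rewrite size_polyN !sizeE_deg ?unit_gt0 //.
by rewrite cu cv.
Qed.

Lemma square_deriv_dvd Q (k k' x : K) P : Q - k%:P = k' *: (('X - x%:P) * P ^+ 2) ->
  P %| Q^`().
Proof.
move=> E; have := congr1 (fun r => r^`()) E; rewrite derivB derivC subr0 => ->.
rewrite derivZ derivM expr2 derivM -mul_polyC dvdp_mull // dvdp_add //.
  exact/dvdp_mull/dvdp_mulr.
by apply: dvdp_mull; apply: dvdp_add; [apply: dvdp_mull | apply: dvdp_mulr].
Qed.

(** P1 * P2 divides the derivative Q', of the same degree. Hence (X^2 - 1)
Q'^2 = m^2 (Q^2 - 1), and differentiating gives the equation of T_m; the value
at 1 fixes the constant. *)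
Lemma cheb_normal_form Q (k1 k2 : K) P1 P2 : (0 < deg Q)%N -> k1 != 0 -> k2 != 0 ->
  Q - 1%:P = k1 *: (('X - 1%:P) * P1 ^+ 2) ->
  Q + 1%:P = k2 *: (('X + 1%:P) * P2 ^+ 2) -> Q = T (deg Q).
Proof.
move=> dQ k10 k20 E1 E2; set m := deg Q in dQ *.
have E2' : Q - (-1)%:P = k2 *: (('X - (-1)%:P) * P2 ^+ 2) by rewrite !polyCN !opprK.
have P10 : P1 != 0.
  by apply: contraNneq (subC_neq0 1 dQ) => z; rewrite E1 z expr0n /= mulr0 scaler0.
have P20 : P2 != 0.
  by apply: contraNneq (subC_neq0 (-1) dQ) => z; rewrite E2' z expr0n /= mulr0 scaler0.
have d1 : m = (1 + deg P1 * 2)%N.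
  rewrite /m -(deg_subC Q 1) E1 -mul_polyC degM ?polyC_eq0 ?mulf_neq0 ?expf_neq0 ?polyXsubC_eq0 //.
  by rewrite degC add0n degM ?expf_neq0 ?polyXsubC_eq0 // degX (unit_XsubC 1).
have d2 : m = (1 + deg P2 * 2)%N.
  rewrite /m -(deg_subC Q (-1)) E2' -mul_polyC degM ?polyC_eq0 ?mulf_neq0 ?expf_neq0 ?polyXsubC_eq0 //.
  by rewrite degC add0n degM ?expf_neq0 ?polyXsubC_eq0 // degX (unit_XsubC (-1)).
have cop : coprimep P1 P2.
  apply/Pdiv.ClosedField.coprimepP => x /eqP P1x; apply/eqP => P2x.
  have h1 : Q.[x] - 1 = 0.
    have := congr1 (fun r => r.[x]) E1.
    by rewrite /= expr2 hornerZ !hornerM P1x !mulr0 hornerD hornerN hornerC.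
  have h2 : Q.[x] + 1 = 0.
    have := congr1 (fun r => r.[x]) E2.
    by rewrite /= expr2 hornerZ !hornerM P2x !mulr0 hornerD hornerC.
  have : (Q.[x] + 1) - (Q.[x] - 1) = 2%:R :> K by ring.
  by rewrite h1 h2 subr0 => /esym/eqP; rewrite (negPf two0).
have Q'0 : Q^`() != 0 by apply: deriv_neq0.
have : P1 * P2 %| Q^`().
  by rewrite Gauss_dvdp // (square_deriv_dvd E1) (square_deriv_dvd E2').
move=> /dvdpP [W EW].
have W0 : W != 0 by apply: contraNneq Q'0 => z; rewrite EW z mul0r.
have dW : deg W = 0%N.
  have := deg_deriv char0 dQ; rewrite EW !degM ?mulf_neq0 // -/m.
  have aux (i j k l : nat) : l = (1 + j * 2)%N -> l = (1 + k * 2)%N ->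
    (i + (j + k) = l.-1)%N -> i = 0%N by clear; lia.
  exact: aux d1 d2.
have EWc := deg0_const dW; set w := W`_0 in EWc.
have w0 : w != 0 by apply: contraNneq W0 => z; rewrite EWc z.
(* the constant of the Pell equation, found to be m ^ 2 from the leading
   coefficients *)
pose kk := w ^+ 2 / (k1 * k2).
have k120 : k1 * k2 != 0 by rewrite mulf_neq0.
have pell : ('X^2 - 1) * Q^`() ^+ 2 = kk *: (Q ^+ 2 - 1).
  have -> : Q ^+ 2 - 1 = (Q - 1%:P) * (Q + 1%:P) by rewrite polyC1; ring.
  rewrite E1 E2 EW EWc -!mul_polyC.
  have -> : w%:P * (P1 * P2) = w%:P * P1 * P2 by rewrite mulrA.
  have -> : kk%:P * (k1%:P * (('X - 1%:P) * P1 ^+ 2) * (k2%:P * (('X + 1%:P) * P2 ^+ 2))) =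
     (kk * (k1 * k2))%:P * (('X - 1%:P) * ('X + 1%:P) * (P1 ^+ 2 * P2 ^+ 2)).
    by rewrite !polyCM; ring.
  rewrite /kk divfK // rmorphXn /= polyC1; ring.
have lkk : kk = (m ^ 2)%:R.
  have := congr1 lead_coef pell.
  have Q20 : Q ^+ 2 != 0 by rewrite expf_neq0 // deg_neq0.
  rewrite lead_coefZ lead_coefM lead_coef_exp (size_deriv_char0 char0 dQ).2.
  have -> : lead_coef ('X^2 - 1 : {poly K}) = 1 by rewrite -polyC1 lead_coefXnsubC.
  have -> : lead_coef (Q ^+ 2 - 1) = lead_coef Q ^+ 2.
    by rewrite -polyC1 lead_subC ?lead_coef_exp // degX muln_gt0 dQ.
  rewrite -/m mul1r -[lead_coef Q *+ m]mulr_natl exprMn => /mulIf h; rewrite -h ?natrX //.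
  by rewrite expf_eq0 lead_coef_eq0 deg_neq0.
have ode : cheb_ode m Q.
  have := congr1 (fun r => r^`()) pell.
  rewrite derivZ derivM !derivB derivXn derivC !subr0 !expr2 !derivM expr1 lkk scaler_nat => E.
  have : (Q^`() *+ 2) * (('X^2 - 1) * Q^`()^`() + 'X * Q^`()) = (Q^`() *+ 2) * (Q *+ m ^ 2).
    transitivity ((Q^`() * Q + Q * Q^`()) *+ m ^ 2); last by ring.
    by rewrite -E expr2; ring.
  apply: mulfI; rewrite -mulr_natl -polyC_natr mulf_neq0 // polyC_eq0.
  exact: two0.
apply: ode_unique => //; first by apply: sizeE; apply: deg_neq0.
have := congr1 (fun r => r.[1]) E1.
rewrite hornerD hornerN hornerC hornerZ hornerM hornerXsubC subrr mul0r mulr0 => /eqP.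
by rewrite subr_eq0 => /eqP.
Qed.

Theorem cheb_char P k1 k2 x1 x2 P1 P2 : (0 < deg P)%N -> k1 != k2 ->
  P - k1%:P = ('X - x1%:P) * P1 ^+ 2 -> P - k2%:P = ('X - x2%:P) * P2 ^+ 2 ->
  x1 != x2 /\ P = pm_affine k1 k2 \Po (T (deg P) \Po compinv (pm_affine x1 x2)).
Proof.
move=> dP k12 E1 E2.
have Px1 : P.[x1] = k1.
  have := congr1 (fun r => r.[x1]) E1.
  by rewrite hornerM hornerXsubC subrr mul0r hornerD hornerN hornerC => /eqP; rewrite subr_eq0 => /eqP.
have Px2 : P.[x2] = k2.
  have := congr1 (fun r => r.[x2]) E2.
  by rewrite hornerM hornerXsubC subrr mul0r hornerD hornerN hornerC => /eqP; rewrite subr_eq0 => /eqP.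
have x12 : x1 != x2 by apply: contraNneq k12 => e; rewrite -Px1 -Px2 e.
split=> //; have cl := unit_pm_affine k12; have cx := unit_pm_affine x12.
set L := pm_affine x1 x2 in cx *; set M := pm_affine k1 k2 in cl *.
pose Q := compinv M \Po (P \Po L).
have dQ : deg Q = deg P by rewrite deg_unit_l ?deg_unit_r //; apply: unit_inv.
suff EQ : Q = T (deg Q).
  rewrite -dQ -EQ /Q -[(compinv M \Po _) \Po _]comp_polyA compKV //.
  by rewrite compKVr.
pose s := (k1 - k2) / 2%:R; pose t := (x1 - x2) / 2%:R.
have s0 : s != 0 by rewrite mulf_neq0 ?invr_eq0 // subr_eq0.
have t0 : t != 0 by rewrite mulf_neq0 ?invr_eq0 // subr_eq0.
have PE : P \Po L = s *: Q + ((k1 + k2) / 2%:R)%:P.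
  have : M \Po Q = P \Po L by rewrite /Q compKV.
  by rewrite /M /pm_affine comp_polyD comp_polyZ comp_polyX comp_polyC => <-.
have EL1 : ('X - x1%:P) \Po L = t *: ('X - 1%:P).
  rewrite comp_polyB comp_polyX comp_polyC /L /pm_affine -/t scalerBr -addrA; congr (_ + _).
  rewrite -[t *: 1%:P]mul_polyC -polyCM -polyCB -polyCN; congr polyC; rewrite /t; field.
  exact: two0.
have EL2 : ('X - x2%:P) \Po L = t *: ('X + 1%:P).
  rewrite comp_polyB comp_polyX comp_polyC /L /pm_affine -/t scalerDr -addrA; congr (_ + _).
  rewrite -[t *: 1%:P]mul_polyC -polyCM -polyCB; congr polyC; rewrite /t; field.
  exact: two0.
have ts0 : t / s != 0 by rewrite mulf_neq0 ?invr_eq0.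
apply: (@cheb_normal_form Q (t / s) (t / s) (P1 \Po L) (P2 \Po L)); rewrite ?dQ //.
- have := congr1 (fun r => s^-1 *: (r \Po L)) E1.
  rewrite comp_polyM comp_poly_exp EL1 comp_polyB comp_polyC PE -scalerAl scalerA.
  rewrite [s^-1 * t]mulrC => <-; rewrite -addrA scalerDr scalerA mulVf // scale1r; congr (_ + _).
  rewrite -polyCB -mul_polyC -polyCM -polyCN; congr polyC; rewrite /s; field.
  by rewrite subr_eq0 k12 two0.
have := congr1 (fun r => s^-1 *: (r \Po L)) E2.
rewrite comp_polyM comp_poly_exp EL2 comp_polyB comp_polyC PE -scalerAl scalerA.
rewrite [s^-1 * t]mulrC => <-; rewrite -addrA scalerDr scalerA mulVf // scale1r; congr (_ + _).
rewrite -polyCB -mul_polyC -polyCM; congr polyC; rewrite /s; field.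
by rewrite subr_eq0 k12 two0.
Qed.

(** Every point is of the form cos t, with z = exp(i t). *)
Lemma exists_joukowski x : exists2 z : K, z != 0 & x = (z + z^-1) / 2%:R.
Proof.
have /closed_rootP [z] : size ('X^2 - (2%:R * x) *: 'X + 1 : {poly K}) != 1%N.
  rewrite -addrA size_polyDl ?size_polyXn //.
  apply: leq_ltn_trans (size_polyD _ _) _; rewrite size_polyN size_poly1 gtn_max andbT.
  by apply: leq_ltn_trans (size_scale_leq _ _) _; rewrite size_polyX.
rewrite rootE !hornerD hornerN hornerZ hornerXn hornerX hornerC => /eqP E.
have z0 : z != 0.
  apply/eqP => z0; move: E; rewrite z0 expr0n mulr0 subr0 add0r => /eqP.
  by rewrite oner_eq0.
exists z => //; have {}E : 2%:R * x * z = z ^+ 2 + 1.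
  by apply/eqP; rewrite -subr_eq0 -oppr_eq0 -E; apply/eqP; ring.
apply: (mulfI two0); apply: (mulIf z0); rewrite E; field.
by rewrite z0 two0.
Qed.

Lemma cheb_comp k l : T k \Po T l = T (k * l).
Proof.
apply: poly_eq_horner => x; have [z z0 ->] := exists_joukowski x.
by rewrite horner_comp !chebE ?expf_neq0 // -!exprVn -!exprM mulnC ?exprVn.
Qed.

Lemma cheb_compC k l : T k \Po T l = T l \Po T k.
Proof. by rewrite !cheb_comp mulnC. Qed.

Lemma pow_coprime_eq1 (w : K) k l : (0 < k)%N -> coprime k l ->
  w ^+ k = 1 -> w ^+ l = 1 -> w = 1.
Proof.
move=> k0 /(coprimeP l k0) [[u v] /= E] wk wl.
have h : (u * k = v * l + 1)%N by lia.
have := congr1 (fun n => w ^+ n) h.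
by rewrite /= exprD expr1 ![(_ * k)%N]mulnC ![(_ * l)%N]mulnC !exprM wk wl !expr1n mul1r => <-.
Qed.

(** Critical points cos t of T_n satisfy sin(nt) = 0 or sin t = 0. *)
Lemma cheb_deriv_root n (z : K) : (0 < n)%N -> z != 0 ->
  root (T n)^`() ((z + z^-1) / 2%:R) -> (z ^+ 2) ^+ n = 1.
Proof.
move=> n0 z0 /eqP r; have [_ h] := cheb_deriv n.
have := congr1 (fun q => q.[(z + z^-1) / 2%:R]) h.
rewrite hornerM r mulr0 hornerMn => /esym/eqP; rewrite -mulr_natl mulf_eq0.
rewrite (negPf (natK0 char0 n0)) /= hornerD hornerN hornerM hornerX.
rewrite (chebE n.+1 two0 z0) (chebE n two0 z0) subr_eq0 => /eqP.
have zn0 : z ^+ n != 0 by rewrite expf_neq0.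
rewrite exprS => E.
have {}E : (z ^+ 2 - 1) * ((z ^+ n) ^+ 2 - 1) = 0.
  apply/eqP; rewrite -subr_eq0 subr0; apply/eqP.
  move: (z ^+ n) zn0 E => y y0 E.
  have : 4%:R * (z * y * (z * y)) * ((z * y + (z * y)^-1) / 2%:R) * 1 =
    4%:R * (z * y * (z * y)) * ((z + z^-1) / 2%:R * ((y + y^-1) / 2%:R)) by rewrite E mulr1.
  have -> : 4%:R * (z * y * (z * y)) * ((z * y + (z * y)^-1) / 2%:R) * 1 =
    2%:R * ((z * y) ^+ 3 + z * y) by field; rewrite z0 y0 two0.
  have -> : 4%:R * (z * y * (z * y)) * ((z + z^-1) / 2%:R * ((y + y^-1) / 2%:R)) =
    z * y * (z ^+ 2 + 1) * (y ^+ 2 + 1) by field; rewrite z0 y0 two0.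
  move=> E'; apply: (mulfI (mulf_neq0 z0 y0)); rewrite mulr0.
  have -> : z * y * ((z ^+ 2 - 1) * (y ^+ 2 - 1)) =
     2%:R * ((z * y) ^+ 3 + z * y) - z * y * (z ^+ 2 + 1) * (y ^+ 2 + 1) by ring.
  by rewrite E' subrr.
move/eqP: E; rewrite mulf_eq0 !subr_eq0 => /orP [] /eqP E; last by rewrite -exprM mulnC exprM.
by rewrite E expr1n.
Qed.

(** This excludes an exchange of Chebyshev factors at the right end of a
decomposition, where both last factors would have a critical point at 0. *)
Lemma cheb_deriv_coprime k l x : (0 < k)%N -> (0 < l)%N -> coprime k l ->
  root (T k)^`() x -> root (T l)^`() x -> False.
Proof.
move=> k0 l0 cop; have [z z0 Ex] := exists_joukowski x; rewrite {1 2}Ex => rk rl.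
have z2 : z ^+ 2 = 1 := pow_coprime_eq1 k0 cop (cheb_deriv_root k0 z0 rk) (cheb_deriv_root l0 z0 rl).
have zV : z^-1 = z by apply: (mulfI z0); rewrite mulfV // -expr2 z2.
(* now x is 1 or -1, where the differential equation reduces to x T_k' = k^2
   T_k *)
have Exz : (z + z^-1) / 2%:R = z by rewrite zV; field.
have := congr1 (fun q => q.[z]) (cheb_odeP k).
rewrite Exz in rk; rewrite hornerD !hornerM (eqP rk) hornerD hornerN hornerXn hornerC z2 subrr.
rewrite mul0r mulr0 addr0 hornerMn => /esym/eqP; rewrite -mulr_natl mulf_eq0.
rewrite (negPf (natK0 char0 _)) ?expn_gt0 ?k0 //= -Exz chebE // -exprVn zV => /eqP E.
have : z ^+ k = 0 by rewrite -E; field.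
by move/eqP; rewrite expf_eq0 (negPf z0) andbF.
Qed.
End Cheb.

(** * Ritt's second theorem *)

Section RittTwo.
Variable K : closedFieldType.
Implicit Types (a b c d f h p q u v w P Q : {poly K}) (x y z k : K).
Hypothesis char0 : [pchar K] =i pred0.

Notation T := (cheb K).

(** One pattern for both exchanges involving x^m. As power_square a b c d it
is the exchange (Cb), as power_square c d a b it is (Cc). *)
Definition power_square a b c d : Prop :=
  exists (m e : nat) (g l nu : {poly K}) x0 z0,
  [/\ prime m, g.[0] <> 0, compunit l, compunit nu &
  [/\ a = l \Po ('X^m \Po ('X - x0%:P)),
      b = ('X + x0%:P) \Po (xg_subst e g m \Po nu),
      c = l \Po (xg_pow e g m \Po ('X - z0%:P)) &
      d = ('X + z0%:P) \Po ('X^m \Po nu)]].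

Definition cheb_square a b c d : Prop :=
  exists (m n : nat) l mu1 mu2 nu,
  [/\ [/\ prime m, odd m, prime n, odd n & m <> n],
      [/\ compunit l, compunit mu1, compunit mu2 & compunit nu] &
  [/\ a = l \Po (T m \Po mu1), b = compinv mu1 \Po (T n \Po nu),
      c = l \Po (T n \Po mu2) & d = compinv mu2 \Po (T m \Po nu)]].

Lemma fibre_type_form p k y0 : (0 < deg p)%N -> fibre_type p k 2 y0 ->
  exists P, p - k%:P = ('X - y0%:P) * P ^+ 2.
Proof.
move=> dp [py0 my0 oth].
have [x xy0|G [EG _]] := @power_form _ (p - k%:P) y0 2 isT (subC_neq0 _ dp).
  have [/eqP px|nx] := boolP (p.[x] == k); first by rewrite (mup_fibre px) oth.
  by rewrite mupNroot // root_subC.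
by exists G; rewrite EG (mup_fibre py0) my0 expr1.
Qed.

(** As y0 is unramified, the index of b at a point above (y0, z) equals the
index of c at z. *)
Lemma pullback_fibre_type a b c d k y0 z0 : a \Po b = c \Po d ->
  (0 < deg a)%N -> (0 < deg b)%N -> deg a = deg d -> deg b = deg c ->
  coprime (deg a) (deg b) ->
  fibre_type a k 2 y0 -> fibre_type c k 2 z0 ->
  exists x0, d.[x0] = z0 /\ fibre_type b y0 2 x0.
Proof.
move=> e da db ead ebc cop [ay0 my0 _] [cz0 mz0 othz].
have dd : (0 < deg d)%N by rewrite -ead.
have S z : c.[z] = k -> exists2 x, (b.[x] = y0 /\ d.[x] = z) /\ ramif d x = 1%N &
    forall x', b.[x'] = y0 -> d.[x'] = z -> x' = x.
  move=> cz; have acz : a.[y0] = c.[z] by rewrite ay0.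
  have := size_common_fibre e da db ead ebc cop acz.
  have := sum_common_fibre e da db ead cop acz.
  rewrite my0 gcd1n; have memS x := mem_common_fibre b y0 z x dd.
  case: (common_fibre b d y0 z) memS => [|x [|]] //; first by rewrite big_nil.
  move=> memS; rewrite big_seq1 => mux _; exists x.
    by have := memS x; rewrite mem_head => /esym/andP [/eqP -> /eqP ->].
  move=> x' bx' dx'; have := memS x'; rewrite bx' dx' !eqxx inE => /eqP.
  by [].
have [x0 [[bx0 dx0] mx0] uniq0] := S _ cz0.
have sq x : b.[x] = y0 -> ramif b x = (ramif c d.[x] * ramif d x)%N.
  by move=> bx; have := ramif_square e da db ead ebc x; rewrite bx my0 mul1n.
exists x0; split=> //; split=> //; first by rewrite sq // dx0 mz0 mx0.
move=> x bx xx0; have cdx : c.[d.[x]] = k by rewrite -horner_comp -e horner_comp bx.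
have [x' [_ mx'] /(_ x bx erefl) Ex] := S _ cdx.
rewrite sq // othz // ?Ex ?mx' //.
by rewrite -Ex; apply: contraNneq xx0 => dxz; apply/eqP; apply: uniq0.
Qed.

Lemma irred_cheb_prime m : irred (T m) -> prime m.
Proof.
move=> [m1 ni]; rewrite deg_cheb // in m1; apply/primeP; split=> // k /dvdnP [l El].
apply/orP; have [->|k1] := eqVneq k 1%N; first by left.
right; have [l1|l1] := eqVneq l 1%N; first by rewrite El l1 mul1n.
case: ni; exists (T l), (T k); rewrite !deg_cheb // cheb_comp // El; split=> //.
- by move: m1 l1; rewrite El; case: (l) => [|[]].
- by move: m1 k1; rewrite El; case: (k) => [|[]] //; rewrite muln0.
Qed.

Lemma cheb_odd_prime a l ramif : irred a -> compunit l -> compunit ramif ->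
  a = l \Po (T (deg a) \Po ramif) -> prime (deg a).
Proof.
move=> ia cl cm E; apply: irred_cheb_prime.
rewrite E in ia; have := irred_unit_l ia (unit_inv cl); rewrite compVK // => h.
by have := irred_unit_r h (unit_inv cm); rewrite compKVr.
Qed.

(** If a or c is cyclic, cyclic_square applies. Otherwise a, b and c are
Chebyshev polynomials up to units by cheb_char, with matching units since the
critical values agree. For d, the equation T_n o D = T_n o E with D, E of the
same degree gives E = u o D with u of degree 1, and u is the identity since it
fixes 1 and -1. *)
Theorem ritt2 a b c d : irred a -> irred b -> irred c -> irred d ->
  a \Po b = c \Po d -> deg a = deg d -> deg b = deg c -> coprime (deg a) (deg b) ->
  [\/ power_square a b c d, power_square c d a b | cheb_square a b c d].
Proof.
move=> ia ib ic id e ead ebc cop.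
have [da1 _] := ia; have [db1 _] := ib.
have da := ltnW da1; have db := ltnW db1.
have dc : (0 < deg c)%N by rewrite -ebc.
have dd : (0 < deg d)%N by rewrite -ead.
have [[l [m [x0 [cl pm Ea]]]]|nca] := classic (cyclic a).
  have dam : deg a = m by rewrite Ea deg_unit_l // deg_unit_r ?deg_Xn //; apply: unit_XsubC.
  have [||e0 [g [nu [z0 [g0 cnu Eb Ec Ed]]]]] := cyclic_square char0 cl pm Ea e _ dc.
  - by rewrite -ead.
  - by rewrite -dam -ebc.
  by apply: Or31; exists m, e0, g, l, nu, x0, z0.
have [[l [m [x0 [cl pm Ec]]]]|ncc] := classic (cyclic c).
  have dcm : deg c = m by rewrite Ec deg_unit_l // deg_unit_r ?deg_Xn //; apply: unit_XsubC.
  have [||e0 [g [nu [z0 [g0 cnu Ed Ea Eb]]]]] := cyclic_square char0 cl pm Ec (esym e) _ da.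
  - by rewrite ebc.
  - by rewrite -dcm -ebc coprime_sym.
  by apply: Or32; exists m, e0, g, l, nu, x0, z0.
have RA : ramif_dvd a c.
  by move=> y; apply: (ramification char0 e da db ead ebc cop (noncyclic_fibre ic ncc)).
have cop' : coprime (deg c) (deg d) by rewrite -ebc -ead coprime_sym.
have RC : ramif_dvd c a.
  move=> y; apply: (ramification char0 (esym e) dc dd (esym ebc) (esym ead) cop').
  exact: noncyclic_fibre.
have dac : deg a <> deg c.
  by move=> E; move: cop; rewrite ebc -E /coprime gcdnn => /eqP E1; rewrite E1 in da1.
have dc1 : (1 < deg c)%N by rewrite -ebc.
have [k1 [k2 [k12 H]]] := dihedral_fibres char0 da1 dc1 dac RA RC
  (noncyclic_nontriv ia nca) (noncyclic_nontriv ic ncc).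
have [y1 [z1 [fa1 fc1]]] := H k1 (mem_head _ _).
have [y2 [z2 [fa2 fc2]]] : exists y0 z0, fibre_type a k2 2 y0 /\ fibre_type c k2 2 z0.
  by apply: H; rewrite !inE eqxx orbT.
have [A1 EA1] := fibre_type_form da fa1; have [A2 EA2] := fibre_type_form da fa2.
have [C1 EC1] := fibre_type_form dc fc1; have [C2 EC2] := fibre_type_form dc fc2.
have [x1 [dx1 fb1]] := pullback_fibre_type e da db ead ebc cop fa1 fc1.
have [x2 [dx2 fb2]] := pullback_fibre_type e da db ead ebc cop fa2 fc2.
have [B1 EB1] := fibre_type_form db fb1; have [B2 EB2] := fibre_type_form db fb2.
have [y12 Ea] := cheb_char char0 da k12 EA1 EA2.
have [z12 Ec] := cheb_char char0 dc k12 EC1 EC2.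
have [x12 Eb] := cheb_char char0 db y12 EB1 EB2.
have odd_deg p k x P : (0 < deg p)%N -> p - k%:P = ('X - x%:P) * P ^+ 2 -> odd (deg p).
  move=> dp E; have P0 : P != 0.
    by apply: contraNneq (subC_neq0 k dp) => z; rewrite E z expr0n /= mulr0.
  rewrite -(deg_subC p k) E degM ?expf_neq0 ?polyXsubC_eq0 // degX (unit_XsubC x).
  by rewrite oddD oddM andbF.
set l := pm_affine k1 k2 in Ea Ec; have cl : compunit l := unit_pm_affine char0 k12.
set L := pm_affine y1 y2 in Ea Eb; have cL : compunit L := unit_pm_affine char0 y12.
set M := pm_affine z1 z2 in Ec; have cM : compunit M := unit_pm_affine char0 z12.
set N := pm_affine x1 x2 in Eb; have cN : compunit N := unit_pm_affine char0 x12.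
have at1 x y : (pm_affine x y).[1] = x := pm_affine_at1 char0 x y.
have atN1 x y : (pm_affine x y).[-1] = y := pm_affine_atN1 char0 x y.
have v1 x y : x != y -> (compinv (pm_affine x y)).[x] = 1.
  by move=> xy; rewrite -{2}(at1 x y) inv_horner //; apply: unit_pm_affine.
have v2 x y : x != y -> (compinv (pm_affine x y)).[y] = -1.
  by move=> xy; rewrite -{2}(atN1 x y) inv_horner //; apply: unit_pm_affine.
have om := odd_deg _ _ _ _ da EA1; have on := odd_deg _ _ _ _ db EB1.
(* d and its expected value, normalised on the left by the unit of c *)
pose D := compinv M \Po d; pose E := T (deg a) \Po compinv N.
have dD : deg D = deg a by rewrite deg_unit_l ?ead //; apply: unit_inv.
have dE : deg E = deg a by rewrite deg_unit_r ?deg_cheb //; apply: unit_inv.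
have eDE : T (deg c) \Po D = T (deg c) \Po E.
  rewrite -[LHS](compVK _ cl) -[RHS](compVK _ cl); congr (_ \Po _).
  rewrite /D /E ![l \Po _]comp_polyA ![_ \Po (_ \Po _)]comp_polyA.
  rewrite -[(l \Po _) \Po compinv M]comp_polyA -Ec -e {1}Ea {1}Eb.
  rewrite -!comp_polyA compVK // [T (deg a) \Po _]comp_polyA cheb_compC // -comp_polyA ebc.
  by rewrite !comp_polyA.
have [|||h [p1 [q1 [ED EE]]]] := common_right_component char0 eDE.
- by rewrite deg_cheb.
- by rewrite dD.
- by rewrite dE.
rewrite dD dE gcdnn => dh.
have h0 : (0 < deg h)%N := leq_trans da dh.
have up r R : R = r \Po h -> deg R = deg a -> compunit r.
  move=> ER dR; have Em : (deg r * deg h = deg a)%N by rewrite -deg_comp -ER.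
  have r0 : (0 < deg r)%N by move: da; rewrite -Em muln_gt0 => /andP [].
  apply/eqP; rewrite eqn_leq r0 andbT -(leq_pmul2r h0) mul1n Em.
  exact: dh.
have cp1 := up _ _ ED dD; have cq1 := up _ _ EE dE.
pose u := q1 \Po compinv p1.
have cu : compunit u by apply: unit_comp => //; apply: unit_inv.
have EuD : E = u \Po D by rewrite EE /u ED -comp_polyA compVK.
have u1 : u = 'X.
  have n11 : (1 : K) != -1.
    by rewrite -subr_eq0 opprK -[1 + 1]/(2%:R) natK0.
  apply: (unit_eq_two_points cu (unit_X _) n11); rewrite hornerX.
    have <- : D.[x1] = 1 by rewrite /D horner_comp dx1 v1.
    by rewrite -horner_comp -EuD /E horner_comp v1 // cheb_at1 /D horner_comp dx1 v1.
  have <- : D.[x2] = -1 by rewrite /D horner_comp dx2 v2.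
  rewrite -horner_comp -EuD /E horner_comp v2 // cheb_atN1 /D horner_comp dx2 v2 //.
  by rewrite -signr_odd om expr1.
have Ed : d = M \Po (T (deg a) \Po compinv N).
  by rewrite -/E EuD u1 comp_polyX /D compKV.
apply: Or33; exists (deg a), (deg b), l, (compinv L), (compinv M), (compinv N).
have cLi := unit_inv cL; have cMi := unit_inv cM; have cNi := unit_inv cN.
split.
- split=> //; last by rewrite ebc.
    exact: cheb_odd_prime ia cl cLi Ea.
  exact: cheb_odd_prime ib cL cNi Eb.
- by split.
by rewrite !compinv_inv // {2}ebc; split.
Qed.

End RittTwo.

(** * Moves between decompositions over the subalgebra *)

Section Main.
Variable K : closedFieldType.
Hypothesis char0 : [pchar K] =i pred0.
Implicit Types (a b c d f g h p q u v l nu : {poly K}) (s t P Q Z B : seq {poly K}).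

Definition all_irrA Z : Prop := forall p, p \in Z -> irrA p.

Lemma all_irrA_cat s t : all_irrA (s ++ t) <-> all_irrA s /\ all_irrA t.
Proof.
split=> [H|[Hs Ht] p]; last by rewrite mem_cat => /orP [/Hs|/Ht].
by split=> p ps; apply: H; rewrite mem_cat ps ?orbT.
Qed.

Lemma all_irrA_cons p t : all_irrA (p :: t) <-> irrA p /\ all_irrA t.
Proof.
split=> [H|[Hp Ht] q]; last by rewrite inE => /predU1P [->|/Ht].
by split=> [|q qt]; apply: H; rewrite inE ?eqxx ?qt ?orbT.
Qed.

Lemma all_irrA_rcons s p : all_irrA (rcons s p) <-> all_irrA s /\ irrA p.
Proof.
rewrite -cats1; split=> [/all_irrA_cat [Hs /all_irrA_cons []]|[Hs Hp]] //.
by apply/all_irrA_cat; split=> //; apply/all_irrA_cons.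
Qed.

Lemma all_irrA_irred s : all_irrA s -> forall p, p \in s -> irred p.
Proof. by move=> H p /H []. Qed.

Lemma irrA_unit_l p u : irrA p -> compunit u -> irrA (u \Po p).
Proof. by move=> [ip Ap] cu; split; [apply: irred_unit_l | apply: inA_unit_l]. Qed.

Lemma inA_unit_cancel l p : compunit l -> inA (l \Po p) -> inA p.
Proof. by move=> cl /(inA_unit_l (unit_inv cl)); rewrite compVK. Qed.

Lemma compinv_XsubC (k : K) : compinv ('X - k%:P) = 'X + k%:P.
Proof.
apply: (comp_can_r (unit_gt0 (unit_XsubC k))).
rewrite (compinvK (unit_XsubC k)).2.
by rewrite comp_polyD comp_polyX comp_polyC subrK.
Qed.

Lemma inA_Xn_unit m u : prime m -> compunit u -> inA ('X^m \Po u) -> u`_0 = 0.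
Proof.
move=> pm cu /(inA_unit_r _ cu); have m1 := prime_gt1 pm.
rewrite derivXn rootE hornerMn hornerXn -mulr_natl mulf_eq0.
rewrite (negPf (natK0 char0 (ltnW m1))) /= expf_eq0 => /andP [_ /eqP].
by [].
Qed.

(** A power in A is centred at 0; this is why no unit separates l and x^m in
(Cb) and (Cc). *)
Lemma inA_Xn_shift m l (x0 : K) p : prime m -> compunit l -> inA p ->
  p = l \Po ('X^m \Po ('X - x0%:P)) -> x0 = 0.
Proof.
move=> pm cl Ap Ep; rewrite Ep in Ap.
have := inA_Xn_unit pm (unit_XsubC x0) (inA_unit_cancel cl Ap).
by rewrite coefB coefX coefC /= sub0r => /eqP; rewrite oppr_eq0 => /eqP.
Qed.

(** The exponent 0 contradicts coprimality of the degrees, and for exponent 1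
the derivative at 0 is g(0). *)
Lemma xg_exponent m e g nu : prime m -> g.[0] <> 0 -> compunit nu -> nu`_0 = 0 ->
  inA (xg_subst e g m \Po nu) -> coprime m (deg (xg_subst e g m)) -> (2 <= e)%N.
Proof.
move=> pm g0 cnu nu0 /(inA_unit_r _ cnu); rewrite nu0 => r cop.
have m1 := prime_gt1 pm.
case: e r cop => [|[|e]] // r cop.
  move: cop; rewrite /xg_subst expr0 mul1r deg_comp deg_Xn /coprime mulnC gcdnMr.
  by move=> /eqP m1'; rewrite m1' in m1.
case: g0; move: r; rewrite /xg_subst expr1 derivM derivX mul1r rootE.
rewrite hornerD hornerM hornerX mul0r addr0 horner_comp hornerXn expr0n.
by rewrite (gtn_eqF (ltnW m1)) => /eqP.
Qed.

Lemma inA_xg_pow m e g : (2 <= e)%N -> inA (xg_pow e g m).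
Proof.
move=> e2; rewrite /inA /xg_pow derivM derivXn hornerD !hornerM hornerMn !hornerXn.
by rewrite !expr0n; case: e e2 => [|[|e]] //= _; rewrite mul0rn !mul0r addr0.
Qed.

Variable w : {poly K}.
Hypothesis wMax : forall Z, composite Z = w -> all_irrA Z -> inMax w Z.

Notation reach := (obtainable w).

Lemma reach_refl Z : reach Z Z.
Proof. exact: rt_refl. Qed.

Lemma reach_trans Z1 Z2 Z3 : reach Z1 Z2 -> reach Z2 Z3 -> reach Z1 Z3.
Proof. exact: rt_trans. Qed.

(** The hypotheses on w, here and below, make every sequence met on the way an
element of Max(w). *)
Lemma adm_reach s t p q u : composite (s ++ [:: p, q & t]) = w ->
  all_irrA (s ++ [:: p, q & t]) -> compunit u -> inA (p \Po u) ->
  reach (s ++ [:: p, q & t]) (s ++ [:: p \Po u, compinv u \Po q & t]).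
Proof.
move=> cZ aZ cu Apu; apply: rt_step; split; first exact: wMax.
by apply: Or41; constructor; apply: admissibleP.
Qed.

(** The factor h to the right of the exchanged ones absorbs the unit u. All
units in the normal forms of ritt2 become admissible because the factors on
both sides are in A. *)
Lemma inner_step s t h p q p' q' u :
  composite (s ++ [:: p, q, h & t]) = w -> all_irrA (s ++ [:: p, q, h & t]) ->
  irrA p' -> irrA q' -> compunit u -> p \Po (q \Po u) = p' \Po q' ->
  coprime (deg p) (deg q) -> deg p' = deg q -> deg q' = deg p ->
  reach (s ++ [:: p, q, h & t]) (s ++ [:: p', q', compinv u \Po h & t]).
Proof.
move=> cZ aZ [ip' Ap'] [iq' Aq'] cu e cop dp' dq'.
have [_ /all_irrA_cons [[ip Ap] /all_irrA_cons [[iq Aq] _]]] := (all_irrA_cat _ _).1 aZ.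
have cui := unit_inv cu.
apply: rt_step; split; first exact: wMax.
have iqu : irred (q \Po u) by apply: irred_unit_r.
have dqu : deg (q \Po u) = deg q by apply: deg_unit_r.
have [||| [m [e0 [g [l [nu [x0 [z0 [pm g0 cl cnu [Ep Eq Ep' Eq']]]]]]]]]
      | [m [e0 [g [l [nu [x0 [z0 [pm g0 cl cnu [Ep' Eq' Ep Eq]]]]]]]]]
      | [m [n [l [mu1 [mu2 [nu [[pm om pn on mn] [cl c1 c2 cnu] [Ep Eq Ep' Eq']]]]]]]]
      ] := ritt2 char0 ip iqu ip' iq' e.
- by rewrite dq'.
- by rewrite dqu dp'.
- by rewrite dqu.
- have cX := unit_XsubC x0; have cZ0 := unit_XsubC z0.
  have x00 := inA_Xn_shift pm cl Ap Ep.
  rewrite x00 polyC0 subr0 comp_polyXr in Ep; rewrite x00 polyC0 addr0 comp_polyX in Eq.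
  have Eq1 : q = xg_subst e0 g m \Po (nu \Po compinv u).
    by rewrite comp_polyA -Eq compKVr.
  have Enu : (nu \Po compinv u) \Po u = nu by rewrite compVKr.
  apply: Or43.
  have := @TrCb_inner _ s t p q h m e0 g l (nu \Po compinv u) ('X - z0%:P) u cop pm g0 cl cu.
  rewrite -Ep' Enu compinv_XsubC -Eq'; apply=> //.
  + by apply: admissibleP; [apply: unit_comp | rewrite -Eq1].
  + by apply: admissibleP => //; apply: (inA_unit_cancel cl); rewrite -Ep'.
  + by apply: admissibleP => //; apply: (inA_unit_cancel (unit_XaddC z0)); rewrite -Eq'.
- have cX := unit_XsubC x0; have cZ0 := unit_XsubC z0.
  have x00 := inA_Xn_shift pm cl Ap' Ep'.
  rewrite x00 polyC0 subr0 comp_polyXr in Ep'; rewrite x00 polyC0 addr0 comp_polyX in Eq'.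
  have Eq1 : q = ('X + z0%:P) \Po ('X^m \Po (nu \Po compinv u)).
    by rewrite -(compKVr q cu) Eq !comp_polyA.
  have Enu : (nu \Po compinv u) \Po u = nu by rewrite compVKr.
  apply: Or44.
  have := @TrCc_inner _ s t p q h m e0 g l ('X - z0%:P) (nu \Po compinv u) u cop pm g0 cl cu.
  rewrite -Ep' Enu compinv_XsubC -Eq'; apply=> //.
  + by apply: admissibleP => //; apply: (inA_unit_cancel cl); rewrite -Ep.
  + apply: admissibleP; first exact: unit_comp.
    by apply: (inA_unit_cancel (unit_XaddC z0)); rewrite -Eq1.
  + by apply: admissibleP => //; rewrite -Eq'.
have Eq1 : q = compinv mu1 \Po (cheb K n \Po (nu \Po compinv u)).
  by rewrite -(compKVr q cu) Eq !comp_polyA.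
have Enu : (nu \Po compinv u) \Po u = nu by rewrite compVKr.
have cnuu : compunit (nu \Po compinv u) by apply: unit_comp.
apply: Or42.
have := @TrCa _ s t p q h m n l mu1 (nu \Po compinv u) mu2 u cop pm om pn on mn cl.
rewrite -Ep' Enu -Eq'; apply=> //.
- by apply: admissibleP => //; apply: (inA_unit_cancel cl); rewrite -Ep.
- by apply: admissibleP => //; apply: (inA_unit_cancel (unit_inv c1)); rewrite -Eq1.
- by apply: admissibleP => //; apply: (inA_unit_cancel cl); rewrite -Ep'.
apply: admissibleP => //; rewrite -comp_polyA Enu.
by apply: (inA_unit_cancel (unit_inv c2)); rewrite -Eq'.
Qed.

(** At the right end no factor can absorb a unit. The transformations (Cb) and
(Cc) give fixed normal forms, and an additional (Adm) between the two last
factors reaches the required ones. A Chebyshev exchange is impossible by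
cheb_deriv_coprime. *)
Lemma last_step s p q p' q' :
  composite (s ++ [:: p; q]) = w -> all_irrA (s ++ [:: p; q]) ->
  irrA p' -> irrA q' -> p \Po q = p' \Po q' ->
  coprime (deg p) (deg q) -> deg p' = deg q -> deg q' = deg p ->
  reach (s ++ [:: p; q]) (s ++ [:: p'; q']).
Proof.
move=> cZ aZ ap' aq' e cop dp' dq'.
have [as' /all_irrA_cons [ap /all_irrA_cons [aq _]]] := (all_irrA_cat _ _).1 aZ.
have [ip Ap] := ap; have [iq Aq] := aq; have [ip' Ap'] := ap'; have [iq' Aq'] := aq'.
have [||| [m [e0 [g [l [nu [x0 [z0 [pm g0 cl cnu [Ep Eq Ep' Eq']]]]]]]]]
      | [m [e0 [g [l [nu [x0 [z0 [pm g0 cl cnu [Ep' Eq' Ep Eq]]]]]]]]]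
      | [m [n [l [mu1 [mu2 [nu [[pm om pn on mn] [cl c1 c2 cnu] [Ep Eq Ep' Eq']]]]]]]]
      ] := ritt2 char0 ip iq ip' iq' e.
- by rewrite dq'.
- by rewrite dp'.
- exact: cop.
- have cX := unit_XsubC x0; have cZ0 := unit_XsubC z0.
  have x00 := inA_Xn_shift pm cl Ap Ep.
  rewrite x00 polyC0 subr0 comp_polyXr in Ep; rewrite x00 polyC0 addr0 comp_polyX in Eq.
  have Anu : inA ('X^m \Po nu) by apply: (inA_unit_cancel (unit_XaddC z0)); rewrite -Eq'.
  have nu0 := inA_Xn_unit pm cnu Anu.
  have [nuE nu1] := compunitE cnu; rewrite nu0 polyC0 addr0 in nuE.
  have e2 : (2 <= e0)%N.
    apply: (xg_exponent pm g0 cnu nu0); first by rewrite -Eq.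
    by move: cop; rewrite Ep Eq deg_unit_l // deg_Xn deg_unit_r.
  have step1 : reach (s ++ [:: p; q]) (s ++ [:: l \Po xg_pow e0 g m; 'X^m \Po nu]).
    apply: rt_step; split; first exact: wMax.
    apply: Or43; apply: TrCb_last => //.
    by exists nu`_1 => //; apply/eqP.
  apply: reach_trans step1 _.
  have Ap1 : irrA (l \Po xg_pow e0 g m).
    split; last by apply: inA_unit_l => //; apply: inA_xg_pow.
    have -> : l \Po xg_pow e0 g m = p' \Po compinv ('X - z0%:P).
      by rewrite Ep' comp_polyA compKVr.
    by apply: irred_unit_r => //; apply: unit_inv.
  have Aq1 : irrA ('X^m \Po nu).
    split=> //; have -> : 'X^m \Po nu = compinv ('X + z0%:P) \Po q'.
      by rewrite Eq' compVK //; apply: unit_XaddC.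
    by apply: irred_unit_l => //; apply: unit_inv; apply: unit_XaddC.
  have := @adm_reach s [::] (l \Po xg_pow e0 g m) ('X^m \Po nu) ('X - z0%:P).
  rewrite compinv_XsubC -Eq' -comp_polyA -Ep'; apply=> //.
    rewrite -cZ !composite_cat /=; congr (_ \Po _).
    rewrite !comp_polyXr Ep Eq -!comp_polyA; congr (_ \Po _).
    rewrite !comp_polyA; congr (_ \Po _).
    rewrite /xg_pow /xg_subst comp_polyM comp_Xn_poly comp_poly_exp comp_Xn_poly.
    by rewrite exprMn -!exprM mulnC.
  by apply/all_irrA_cat; split=> //; apply/all_irrA_cons; split=> //; apply/all_irrA_cons.
- have cX := unit_XsubC x0; have cZ0 := unit_XsubC z0; have cZ1 := unit_XaddC z0.
  have x00 := inA_Xn_shift pm cl Ap' Ep'.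
  rewrite x00 polyC0 subr0 comp_polyXr in Ep'; rewrite x00 polyC0 addr0 comp_polyX in Eq'.
  have Anu : inA ('X^m \Po nu) by apply: (inA_unit_cancel (unit_XaddC z0)); rewrite -Eq.
  have nu0 := inA_Xn_unit pm cnu Anu.
  have e2 : (2 <= e0)%N.
    apply: (xg_exponent pm g0 cnu nu0); first by rewrite -Eq'.
    by move: cop; rewrite -dp' -dq' Ep' Eq' coprime_sym deg_unit_l // deg_Xn deg_unit_r.
  have Ap1 : inA (l \Po xg_pow e0 g m) by apply: inA_unit_l => //; apply: inA_xg_pow.
  have Ep1 : p \Po ('X + z0%:P) = l \Po xg_pow e0 g m.
    by rewrite Ep -compinv_XsubC comp_polyA compKVr.
  have Ei : compinv ('X + z0%:P) = 'X - z0%:P by rewrite -compinv_XsubC compinv_inv.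
  have Eq1 : compinv ('X + z0%:P) \Po q = 'X^m \Po nu by rewrite Eq compVK.
  have step1 : reach (s ++ [:: p; q]) (s ++ [:: l \Po xg_pow e0 g m; 'X^m \Po nu]).
    by rewrite -Ep1 -Eq1; apply: adm_reach => //; rewrite Ep1.
  apply: reach_trans step1 _.
  apply: rt_step; split.
    apply: wMax.
      rewrite -cZ !composite_cat /=; congr (_ \Po _).
      by rewrite !comp_polyXr -Ep1 -Eq1 -comp_polyA compKV.
    apply/all_irrA_cat; split=> //; apply/all_irrA_cons; split.
      by split=> //; rewrite -Ep1; apply: irred_unit_r.
    apply/all_irrA_cons; split=> //; rewrite -Eq1; apply: irrA_unit_l => //.
    exact: unit_inv.
  apply: Or44.
  have := @TrCc_last _ s (l \Po xg_pow e0 g m) ('X^m \Po nu) m e0 g l nu.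
  rewrite -Ep' -Eq'; apply=> //; last exact: admissibleP.
  by rewrite -Ep1 -Eq1 deg_unit_r // deg_unit_l //; apply: unit_inv.
have r1 : root (cheb K n)^`() nu`_0.
  by apply/inA_unit_r => //; apply: (inA_unit_cancel (unit_inv c1)); rewrite -Eq.
have r2 : root (cheb K m)^`() nu`_0.
  by apply/inA_unit_r => //; apply: (inA_unit_cancel (unit_inv c2)); rewrite -Eq'.
have cmn : coprime m n.
  by rewrite prime_coprime // dvdn_prime2 //; apply/eqP.
by case: (cheb_deriv_coprime char0 (prime_gt0 pm) (prime_gt0 pn) cmn r2 r1).
Qed.

(** The diamond for two inequivalent last factors p and q, with a
decomposition B of b; the units u and v put c and d into A. *)
Lemma ritt_bridge P Q p q : all_irrA P -> all_irrA Q -> irred p -> irred q ->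
  composite P \Po p = composite Q \Po q -> ~ lequiv p q ->
  exists B c d u v, [/\ compunit u, compunit v, all_irrA (rcons B c) & all_irrA (rcons B d)] /\
  [/\ composite P \Po u = composite (rcons B c), composite Q \Po v = composite (rcons B d),
      c \Po (compinv u \Po p) = d \Po (compinv v \Po q) &
    [/\ coprime (deg p) (deg q), deg c = deg q & deg d = deg p]].
Proof.
move=> aP aQ ip iq e nl.
have dP := deg_composite_gt0 (all_irrA_irred aP).
have [cop [b [c [d [EP EQ ecd [ic id dc dd]]]]]] := diamond char0 ip iq e dP nl.
have b0 : (0 < deg b)%N by move: dP; rewrite EP deg_comp muln_gt0 => /andP [].
have [B [r [cr EB aB]]] := exists_decomposition char0 b0.
have cri := unit_inv cr.
have [dc1 _] := ic; have [dd1 _] := id.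
have [u cu Au] := exists_admissible char0 dc1.
have [v cv Av] := exists_admissible char0 dd1.
exists B, (compinv r \Po (c \Po u)), (compinv r \Po (d \Po v)), u, v.
have side y x : irred y -> compunit x -> inA (y \Po x) ->
    all_irrA (rcons B (compinv r \Po (y \Po x))).
  move=> iy cx Ax; apply/all_irrA_rcons; split=> //; apply: irrA_unit_l => //.
  by split=> //; apply: irred_unit_r.
split; first by split=> //; apply: side.
split.
- by rewrite composite_rcons EB EP !comp_polyA compKVr.
- by rewrite composite_rcons EB EQ !comp_polyA compKVr.
- by rewrite -!comp_polyA !compKV // ecd.
by split=> //; rewrite deg_unit_l // deg_unit_r.
Qed.

(** The decomposition is split into a part P, free up to a unit u on its
right, and a nonempty tail whose first factor h takes up u. Cancelling the
last factors p and q of P and Q up to a unit v moves v into the tail, and the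
unit u is then passed on to h by (Adm). *)
Lemma inner_reach P Q u h t : all_irrA P -> all_irrA Q -> all_irrA (h :: t) -> compunit u ->
  composite P \Po u = composite Q -> composite (P ++ h :: t) = w ->
  reach (P ++ h :: t) (Q ++ (compinv u \Po h) :: t).
Proof.
have [n] := ubnP (deg (composite P)); elim: n => // n IH in P Q u h t *.
rewrite ltnS => dP aP aQ aht cu e cZ.
case: (lastP P) dP aP e cZ => [|P' p] dP aP e cZ.
  have EQ : Q = [::].
    apply: composite_deg1; first exact: all_irrA_irred.
    by rewrite -e /= comp_polyX.
  have Eu : u = 'X by move: e; rewrite EQ /= comp_polyX.
  by rewrite EQ Eu compinvX comp_polyX; apply: reach_refl.
case: (lastP Q) aQ e => [|Q' q] aQ e.
  have E : rcons P' p = [::].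
    apply: composite_deg1; first exact: all_irrA_irred.
    by rewrite -(deg_unit_r _ cu) e /deg size_polyX.
  by have := congr1 size E; rewrite size_rcons.
have [aP' ap] := (all_irrA_rcons _ _).1 aP; have [aQ' aq] := (all_irrA_rcons _ _).1 aQ.
have [ip Ap] := ap; have [iq Aq] := aq; have [dp1 _] := ip; have [dq1 _] := iq.
have cui := unit_inv cu.
have dP' : (deg (composite P') < n)%N.
  apply: leq_trans dP; rewrite composite_rcons deg_comp ltn_Pmulr //.
  exact/deg_composite_gt0/all_irrA_irred.
have dQ' : (deg (composite Q') < n)%N.
  apply: leq_trans dP; rewrite -(deg_unit_r (composite (rcons P' p)) cu) e composite_rcons deg_comp ltn_Pmulr //.
  exact/deg_composite_gt0/all_irrA_irred.
rewrite !composite_rcons -comp_polyA in e.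
rewrite !cat_rcons in cZ *.
have aphT : all_irrA (p :: h :: t) by apply/all_irrA_cons.
have ipu : irred (p \Po u) by apply: irred_unit_r.
have [[v cv Ev]|nl] := classic (lequiv (p \Po u) q).
  have cvi := unit_inv cv.
  have e1 : composite P' \Po compinv v = composite Q'.
    have : composite P' = composite Q' \Po v.
      by apply: (@comp_can_r _ (p \Po u)); [case: ipu => /ltnW | rewrite e Ev comp_polyA].
    by move=> ->; rewrite compKVr.
  have step1 := IH P' Q' (compinv v) p (h :: t) dP' aP' aQ' aphT cvi e1 cZ.
  apply: reach_trans step1 _; rewrite compinv_inv //.
  have -> : q = (v \Po p) \Po u by rewrite Ev comp_polyA.
  have [ah at_] := (all_irrA_cons _ _).1 aht.
  apply: adm_reach => //.
  - rewrite -cZ !composite_cat /= -e1 -!comp_polyA compVK //.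
  - by apply/all_irrA_cat; split=> //; apply/all_irrA_cons; split; first exact: irrA_unit_l.
  - by rewrite -comp_polyA -Ev.
have [B [c [d [v1 [v2 [[cv1 cv2 aBc aBd] [E1 E2 ecd [cop dc dd]]]]]]]] :=
  ritt_bridge aP' aQ' ipu iq e nl.
have cv1i := unit_inv cv1; have cv2i := unit_inv cv2.
have [ah at_] := (all_irrA_cons _ _).1 aht.
have step1 := IH _ _ v1 p (h :: t) dP' aP' aBc aphT cv1 E1 cZ.
apply: reach_trans step1 _.
have E2' : composite (rcons B d) \Po compinv v2 = composite Q' by rewrite -E2 compKVr.
have dBd : (deg (composite (rcons B d)) < n)%N by rewrite -E2 deg_unit_r.
have ah' : irrA (compinv u \Po h) by apply: irrA_unit_l.
have aht' : all_irrA ((compinv v2 \Po q) :: (compinv u \Po h) :: t).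
  by apply/all_irrA_cons; split; [apply: irrA_unit_l | apply/all_irrA_cons].
have := IH _ _ (compinv v2) (compinv v2 \Po q) ((compinv u \Po h) :: t) dBd aBd aQ' aht' cv2i E2'.
rewrite compinv_inv // compKV // => step3.
have [aB ac] := (all_irrA_rcons _ _).1 aBc; have [_ ad] := (all_irrA_rcons _ _).1 aBd.
have cZ2 : composite (rcons B c ++ (compinv v1 \Po p) :: h :: t) = w.
  by rewrite -cZ !composite_cat /= -E1 -!comp_polyA compKV.
have cZ3 : composite (rcons B d ++ (compinv v2 \Po q) :: (compinv u \Po h) :: t) = w.
  rewrite -cZ !composite_cat /= -E2 -!comp_polyA compKV //.
  by rewrite [LHS]comp_polyA -e -!comp_polyA compKV.
apply: reach_trans (step3 cZ3); rewrite !cat_rcons in cZ2 *.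
apply: inner_step => //.
- apply/all_irrA_cat; split=> //; apply/all_irrA_cons; split=> //; apply/all_irrA_cons; split=> //.
  exact: irrA_unit_l.
- exact: irrA_unit_l.
- by rewrite -[(compinv v1 \Po p) \Po u]comp_polyA.
- rewrite dc deg_unit_l // coprime_sym.
  by move: cop; rewrite deg_unit_r.
- by rewrite dd (deg_unit_r _ cu) deg_unit_l.
- by rewrite deg_unit_l // dc.
Qed.

(** The argument of inner_reach for whole decompositions: the last factors are
now fixed by the condition at 0, so the exchange is an instance of last_step. *)
Theorem connected X Y : all_irrA X -> all_irrA Y -> composite X = w -> composite Y = w ->
  reach X Y.
Proof.
move=> aX aY cX cY; case: (lastP X) aX cX => [|P p] aP cP.
  have -> : Y = [::].
    by apply: composite_deg1; [exact: all_irrA_irred | rewrite cY -cP /deg size_polyX].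
  exact: reach_refl.
case: (lastP Y) aY cY => [|Q q] aQ cQ.
  have E : rcons P p = [::].
    by apply: composite_deg1; [exact: all_irrA_irred | rewrite cP -cQ /deg size_polyX].
  by have := congr1 size E; rewrite size_rcons.
have [aP' ap] := (all_irrA_rcons _ _).1 aP; have [aQ' aq] := (all_irrA_rcons _ _).1 aQ.
have [ip Ap] := ap; have [iq Aq] := aq.
have e : composite P \Po p = composite Q \Po q by rewrite -!composite_rcons cP.
have ap1 : all_irrA [:: p] by apply/all_irrA_cons.
rewrite -!cats1 in cP cQ *.
have [[v cv Ev]|nl] := classic (lequiv p q).
  have cvi := unit_inv cv.
  have e1 : composite P \Po compinv v = composite Q.
    have : composite P = composite Q \Po v.
      by apply: (@comp_can_r _ p); [case: ip => /ltnW | rewrite e Ev comp_polyA].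
    by move=> ->; rewrite compKVr.
  have := inner_reach aP' aQ' ap1 cvi e1 cP.
  by rewrite compinv_inv // -Ev.
have [B [c [d [v1 [v2 [[cv1 cv2 aBc aBd] [E1 E2 ecd [cop dc dd]]]]]]]] :=
  ritt_bridge aP' aQ' ip iq e nl.
have cv1i := unit_inv cv1; have cv2i := unit_inv cv2.
apply: reach_trans (inner_reach aP' aBc ap1 cv1 E1 cP) _.
have E2' : composite (rcons B d) \Po compinv v2 = composite Q by rewrite -E2 compKVr.
have aq1 : all_irrA [:: compinv v2 \Po q] by apply/all_irrA_cons; split; [apply: irrA_unit_l|].
have cZ2 : composite (rcons B c ++ [:: compinv v1 \Po p]) = w.
  by rewrite -cP !composite_cat /= !comp_polyXr -E1 -!comp_polyA compKV.
have cZ3 : composite (rcons B d ++ [:: compinv v2 \Po q]) = w.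
  by rewrite -cQ !composite_cat /= !comp_polyXr -E2 -!comp_polyA compKV.
have step3 := inner_reach aBd aQ' aq1 cv2i E2' cZ3.
rewrite compinv_inv // compKV // in step3.
apply: reach_trans step3.
have [aB ac] := (all_irrA_rcons _ _).1 aBc; have [_ ad] := (all_irrA_rcons _ _).1 aBd.
rewrite !cat_rcons in cZ2 *; apply: last_step => //.
- apply/all_irrA_cat; split=> //; apply/all_irrA_cons; split=> //; apply/all_irrA_cons; split=> //.
  exact: irrA_unit_l.
- exact: irrA_unit_l.
- by rewrite dc deg_unit_l // coprime_sym.
- by rewrite dd deg_unit_l.
- by rewrite deg_unit_l // dc.
Qed.

End Main.

(** * Decompositions of maximal length *)

Section Regular.
Variable K : closedFieldType.
Hypothesis char0 : [pchar K] =i pred0.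
Implicit Types (a b c p : {poly K}) (s t Z : seq {poly K}).

Lemma inA_nonscalar_deg p : inA_nonscalar p -> (1 < deg p)%N.
Proof.
move=> [Ap /degN0_scalar dp]; rewrite ltn_neqAle dp andbT eq_sym.
apply/eqP => cp; have [_ /eqP] := compunitE cp; apply.
by move: Ap; rewrite /inA horner_coef0 coef_deriv mulr1n.
Qed.

Lemma irrA_irredA p : irrA p -> irredA p.
Proof.
move=> [[dp ip] Ap]; split.
  split=> // -[c E]; move: dp.
  by rewrite E degC.
move=> [b [c [/inA_nonscalar_deg db /inA_nonscalar_deg dc E]]].
by apply: ip; exists b, c.
Qed.

(** Splitting all factors into irreducible ones; the unit v is carried over to
the next factor. *)
Lemma refine_composite Z : (forall p, p \in Z -> (1 < deg p)%N) ->
  exists s v, [/\ compunit v, (forall p, p \in s -> irred p),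
    composite s = composite Z \Po v & (size Z <= size s)%N].
Proof.
elim/last_ind: Z => [|Z p IH] H.
  by exists [::], 'X; split=> //; [apply: unit_X | rewrite comp_polyXr].
have [|s [v [cv is_ Es ss]]] := IH.
  by move=> q qZ; apply: H; rewrite mem_rcons inE qZ orbT.
have dp : (1 < deg p)%N by apply: H; rewrite mem_rcons mem_head.
have dvp : deg (compinv v \Po p) = deg p by rewrite deg_unit_l //; apply: unit_inv.
have [|t [v' [cv' Et at_]]] := @exists_decomposition _ char0 (compinv v \Po p).
  by rewrite dvp ltnW.
have t1 : (0 < size t)%N.
  case: t Et {at_} => //= E; have := congr1 (@deg K) E.
  by rewrite deg_unit_r // dvp /deg size_polyX => E'; move: dp; rewrite /deg -E'.
exists (s ++ t), v'; split=> //.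
- by move=> q; rewrite mem_cat => /orP [/is_|/at_ []].
- by rewrite composite_cat composite_rcons Es Et -!comp_polyA compKV.
by rewrite size_rcons size_cat -addn1 leq_add.
Qed.

(** A reducible factor could be split, contradicting ritt1 after refinement. *)
Lemma maximal_irreducible a s Z : decomposition a s -> decompA a Z ->
  size Z = size s -> all_irrA Z.
Proof.
move=> [cs is_] [cZ aZ] sZ p pZ.
have degZ q : q \in Z -> (1 < deg q)%N by move=> /aZ [/inA_nonscalar_deg].
have [[Ap _] _] := aZ p pZ; split=> //; split; first exact: degZ.
move=> [b [c [db dc E]]].
(* p is replaced by the two factors b and c *)
have [Z1 [Z2 EZ]] : exists Z1 Z2, Z = Z1 ++ p :: Z2.
  by case/splitPr: pZ => Z1 Z2; exists Z1, Z2.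
have [|t [v [cv it_ Et st]]] := @refine_composite (Z1 ++ [:: b, c & Z2]).
  move=> q; rewrite mem_cat !inE => /or4P [qZ|/eqP->|/eqP->|qZ] //; apply: degZ.
    by rewrite EZ mem_cat qZ.
  by rewrite EZ mem_cat inE qZ !orbT.
have : size s = size t.
  apply: (ritt1 char0 is_ it_ cv); rewrite cs Et -cZ EZ !composite_cat /= E.
  by rewrite !comp_polyA.
move=> E'; move: st; rewrite -E' -sZ EZ !size_cat /= !addnS.
by rewrite ltnn.
Qed.

End Regular.

Theorem theorem1p5 (K : closedFieldType) (char0 : [pchar K] =i pred0)
  (a : {poly K}) (aA : inA a) (a_nonscalar : ~ is_scalar a) (a_reg : regular a)
  (X Y : seq {poly K}) (XMax : inMax a X) (YMax : inMax a Y) :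
  obtainable a X Y.
Proof.
have [r [lenA [s [ds ss]]]] := a_reg.
have size_max Z : inMax a Z -> size Z = size s.
  move=> [dZ [_ maxZ]]; apply/eqP; rewrite eqn_leq ss (lenA.2 _ dZ) /=.
  by have [t [dt <-]] := lenA.1; apply: maxZ.
have aX := maximal_irreducible char0 ds XMax.1 (size_max _ XMax).
have aY := maximal_irreducible char0 ds YMax.1 (size_max _ YMax).
apply: (connected char0 _ aX aY XMax.1.1 YMax.1.1) => Z cZ aZ; split.
  by split=> // p /aZ /irrA_irredA.
suff -> : size Z = r by [].
rewrite -ss; symmetry; apply: (ritt1 char0 ds.2 (all_irrA_irred aZ) (unit_X K)).
by rewrite comp_polyXr ds.1 cZ.
Qed.
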